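(* Let $\mathbb D\subset\mathbb C$ be a contractible domain, $\hat{\mathfrak f}:\mathbb D\to S^5$ a smooth map and $\hat{\mathcal F}:\mathbb D\to\mathrm{SU}_3$ a smooth frame with $\hat{\mathcal F}e_3=\hat{\mathfrak f}$, $e_3=(0,0,1)^T$. Assume $\hat{\mathcal F}^{-1}d\hat{\mathcal F}=\hat{\mathcal U}dz+\hat{\mathcal V}d\bar z$ with $$\hat{\mathcal U}=\begin{pmatrix} u_{11}+w & u_{12} & u_{13} \\ u_{21} & -u_{11}+w & 0 \\ 0 & u_{32} & -2w \end{pmatrix},\qquad \hat{\mathcal V}=-\overline{\hat{\mathcal U}}^{\,T},$$ where $u_{13}$ and $u_{32}$ never vanish. Let $\sigma$ be the order $6$ automorphism of $\mathrm{SL}_3\mathbb C$ given by $\sigma(g)=P(g^T)^{-1}P$ with $P=\begin{pmatrix} 0 & \epsilon^2 & 0 \\ \epsilon^4 & 0 & 0 \\ 0 & 0 & 1 \end{pmatrix}$, $\epsilon=e^{i\pi/3}$. Then: (1) If $\hat{\mathcal F}$ is primitive harmonic relative to $\sigma$, then $\hat{\mathcal F}$ can be derived from a minimal Lagrangian immersion into $\mathbb{CP}^2$. (2) If $\hat{\mathcal F}$ is primitive harmonic relative to $\sigma^2$, then $\hat{\mathcal F}$ can be derived from a minimal immersion into $\mathbb{CP}^2$ without complex points. (3) If $\hat{\mathcal F}$ is primitive harmonic relative to $\sigma^3$, then $\hat{\mathcal F}$ can be derived from a minimal Lagrangian immersion or a flat homogeneous immersion into $\mathbb{CP}^2$. Here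 ''$\hat{\mathcal F}$ can be derived from an immersion $f:\mathbb D\to\mathbb{CP}^2$'' means: $f$ is a conformal immersion without complex points and there are a lift $\mathfrak f:\mathbb D\to S^5$ of $f$ and a smooth map $D$ from $\mathbb D$ to the diagonal matrices in $\mathrm{SU}_3$ such that $\hat{\mathcal F}D=\mathcal F(\mathfrak f)$.
   Context: $\mathbb{CP}^2$ carries the Fubini-Study metric of constant holomorphic sectional curvature $4$, $S^5\subset\mathbb C^3$ is the unit sphere and $\pi:S^5\to\mathbb{CP}^2$ the Hopf fibration. For $Z,W\in\mathbb C^3$ put $Z\cdot W=\sum_k z_kw_k$ (complex bilinear). A lift of $f:\mathbb D\to\mathbb{CP}^2$ is a smooth map $\mathfrak f:\mathbb D\to S^5$ with $f=\pi\circ\mathfrak f$. For a conformal immersion $f:\mathbb D\to\mathbb{CP}^2$ with induced metric $2e^{\omega}dz\,d\bar z$ and lift $\mathfrak f$ put $$\xi=\mathfrak f_z-(\mathfrak f_z\cdot\bar{\mathfrak f})\mathfrak f,\quad \eta=\mathfrak f_{\bar z}-(\mathfrak f_{\bar z}\cdot\bar{\mathfrak f})\mathfrak f,\quad a=e^{-\omega}\xi\cdot\bar\xi,\quad b=e^{-\omega}\eta\cdot\bar\eta .$$ Then $a+b=2$, and $a,b$ do not depend on the lift. A complex point is a point where $a=0$ or $b=0$; ''without complex points'' means $a,b>0$ everywhere. $f$ is Lagrangian iff $a=b=1$. The frame of $\mathfrak f$ is $$\mathcal F(\mathfrak f)=\left(-ie^{-\omega/2}a^{-1/2}\,\xi,\;-ie^{-\omega/2}b^{-1/2}\,\eta,\;\mathfrak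 f\right).$$ Flat homogeneous: the induced metric is flat and the image of $f$ is contained in a two-dimensional orbit of a Lie subgroup of $\mathrm{SU}_3$ (acting on $\mathbb{CP}^2$ by isometries). Let $G=\mathrm{SL}_3\mathbb C$, $\mathfrak g=\mathfrak{sl}_3\mathbb C$. The automorphisms $\sigma,\sigma^2,\sigma^3$ have orders $6,3,2$. For $\kappa\in\{\sigma,\sigma^2,\sigma^3\}$ of order $k$ let $\mathfrak g_m$ ($m$ mod $k$) be the eigenspace of $d\kappa$ on $\mathfrak g$ for the eigenvalue $e^{2\pi i m/k}$. A smooth map $\mathcal F:\mathbb D\to \mathrm{SU}_3$ is primitive harmonic relative to $\kappa$ if $$\mathcal F^{-1}d\mathcal F=\alpha_{-1}dz+\alpha_0'dz+\alpha_0''d\bar z+\alpha_1d\bar z$$ with $\alpha_{\pm1}$ taking values in $\mathfrak g_{\pm1}$ and $\alpha_0',\alpha_0''$ in $\mathfrak g_0$, and if $\beta_\lambda=\lambda^{-1}\alpha_{-1}dz+\alpha_0'dz+\alpha_0''d\bar z+\lambda\alpha_1d\bar z$ satisfies $d\beta_\lambda+\frac12[\beta_\lambda\wedge\beta_\lambda]=0$ for all $\lambda\in\mathbb C^*$. (For $k=2$, $\mathfrak g_{-1}=\mathfrak g_1$.) *)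

(* Defs.v *)
From HB Require Import structures.
From mathcomp Require Import all_boot all_order all_algebra.
From mathcomp Require Import spectral complex.
From mathcomp Require Import all_classical all_reals all_analysis.

Set Implicit Arguments.
Unset Strict Implicit.
Unset Printing Implicit Defensive.

Import Order.TTheory GRing.Theory Num.Theory numFieldNormedType.Exports.

Local Open Scope classical_set_scope.
Local Open Scope ring_scope.
Local Open Scope complex_scope.
Local Open Scope sesquilinear_scope.

(* MathComp-Analysis puts the modulus topology on R[i]^o only; this transports
   it to R[i] itself. *)
HB.instance Definition _ (R : realType) := NormedModule.copy R[i] R[i]^o.

Notation Re := complex.Re.
Notation Im := complex.Im.

Section Defs.
Variable R : realType.
Local Notation C := R[i].

(* Calculus on an open set D of the complex plane, with z = x + iy.  All maps
   are total functions of z : C; only their values on D matter. *)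

Definition dx (u : C -> R) (z : C) : R := derive1 (fun t : R => u (t +i* Im z)) (Re z).
Definition dy (u : C -> R) (z : C) : R := derive1 (fun t : R => u (Re z +i* t)) (Im z).

Definition partially_derivable (u : C -> R) (z : C) : Prop :=
  derivable (fun t : R => u (t +i* Im z)) (Re z) 1 /\
  derivable (fun t : R => u (Re z +i* t)) (Im z) 1.

Fixpoint class_C (n : nat) (D : set C) (u : C -> R) : Prop :=
  (forall z, D z -> {for z, continuous u}) /\
  if n is m.+1 then
    [/\ forall z, D z -> partially_derivable u z,
        class_C m D (dx u) & class_C m D (dy u)]
  else True.

Definition smooth (D : set C) (u : C -> R) : Prop := forall n, class_C n D u.

Definition msmooth (D : set C) m n (F : C -> 'M[C]_(m, n)) : Prop :=
  forall i j, smooth D (fun z => Re (F z i j)) /\ smooth D (fun z => Im (F z i j)).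

Definition mdx m n (F : C -> 'M[C]_(m, n)) (z : C) : 'M[C]_(m, n) :=
  \matrix_(i, j) (dx (fun y => Re (F y i j)) z +i* dx (fun y => Im (F y i j)) z).
Definition mdy m n (F : C -> 'M[C]_(m, n)) (z : C) : 'M[C]_(m, n) :=
  \matrix_(i, j) (dy (fun y => Re (F y i j)) z +i* dy (fun y => Im (F y i j)) z).

Definition mdz m n (F : C -> 'M[C]_(m, n)) (z : C) : 'M[C]_(m, n) :=
  2^-1 *: (mdx F z - 'i%C *: mdy F z).
Definition mdzbar m n (F : C -> 'M[C]_(m, n)) (z : C) : 'M[C]_(m, n) :=
  2^-1 *: (mdx F z + 'i%C *: mdy F z).

(* The curve g, with real parameter, has velocity A at time t. *)
Definition has_velocity m n (g : R -> 'M[C]_(m, n)) (t : R) (A : 'M[C]_(m, n)) : Prop :=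
  forall i j, is_derive t 1 (fun s => Re (g s i j)) (Re (A i j)) /\
              is_derive t 1 (fun s => Im (g s i j)) (Im (A i j)).

Definition contractible (D : set C) : Prop :=
  exists (c : C) (h : R * C -> C),
    [/\ D c,
        {within `[0, 1] `*` D, continuous h},
        forall t z, 0 <= t <= 1 -> D z -> D (h (t, z)) &
        forall z, D z -> h (0, z) = z /\ h (1, z) = c].

Definition contractible_domain (D : set C) : Prop :=
  [/\ open D, connected D & contractible D].

(* The projective plane.  A line spanned by the unit vector Z is represented by
   the orthogonal projector Z Z^* onto it.  For a unit vector Z and horizontal
   tangent vectors V, W at Z, the differentials X = V Z^* + Z V^* and
   Y = W Z^* + Z W^* of the Hopf map satisfy tr(X Y) / 2 = Re (V . conj W), so
   that gFS makes the Hopf map a Riemannian submersion of the unit sphere: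
   it is the Fubini-Study metric of holomorphic sectional curvature 4. *)

Definition S5 : set 'cV[C]_3 := [set Z | \sum_k `|Z k 0| ^+ 2 = 1].

Definition CP2 : set 'M[C]_3 := [set p | [/\ p ^t* = p, p *m p = p & \tr p = 1]].

Definition hopf (Z : 'cV[C]_3) : 'M[C]_3 := Z *m Z ^t*.

Definition gFS (X Y : 'M[C]_3) : R := Re (\tr (X *m Y)) / 2.

(* Orthogonal projection of the Hermitian matrices onto the tangent space
   {X Hermitian | p X + X p = X} of CP2 at p. *)
Definition tanproj (p X : 'M[C]_3) : 'M[C]_3 :=
  p *m X *m (1%:M - p) + (1%:M - p) *m X *m p.

(* The complex structure: it maps V Z^* + Z V^* to (iV) Z^* + Z (iV)^*. *)
Definition Jcplx (p X : 'M[C]_3) : 'M[C]_3 := 'i%C *: (X *m p - p *m X).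

Definition bdot (Z W : 'cV[C]_3) : C := \sum_k Z k 0 * W k 0.
Definition conjv (Z : 'cV[C]_3) : 'cV[C]_3 := map_mx Num.conj Z.

Definition conformal_immersion (D : set C) (f : C -> 'M[C]_3) : Prop :=
  msmooth D f /\
  forall z, D z ->
    [/\ CP2 (f z),
        0 < gFS (mdx f z) (mdx f z),
        gFS (mdx f z) (mdx f z) = gFS (mdy f z) (mdy f z) &
        gFS (mdx f z) (mdy f z) = 0].

(* The induced metric 2 e^omega dz dzbar is 2 e^omega (dx^2 + dy^2). *)
Definition omega (f : C -> 'M[C]_3) (z : C) : R :=
  ln (gFS (mdx f z) (mdx f z) / 2).

Definition lift (D : set C) (f : C -> 'M[C]_3) (l : C -> 'cV[C]_3) : Prop :=
  msmooth D l /\ forall z, D z -> S5 (l z) /\ f z = hopf (l z).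

Definition xi (l : C -> 'cV[C]_3) (z : C) : 'cV[C]_3 :=
  mdz l z - bdot (mdz l z) (conjv (l z)) *: l z.
Definition eta (l : C -> 'cV[C]_3) (z : C) : 'cV[C]_3 :=
  mdzbar l z - bdot (mdzbar l z) (conjv (l z)) *: l z.

Definition coef_a (f : C -> 'M[C]_3) (l : C -> 'cV[C]_3) (z : C) : R :=
  expR (- omega f z) * Re (bdot (xi l z) (conjv (xi l z))).
Definition coef_b (f : C -> 'M[C]_3) (l : C -> 'cV[C]_3) (z : C) : R :=
  expR (- omega f z) * Re (bdot (eta l z) (conjv (eta l z))).

(* coef_a and coef_b do not depend on the lift. *)
Definition without_complex_points (D : set C) (f : C -> 'M[C]_3) : Prop :=
  exists2 l, lift D f l & forall z, D z -> 0 < coef_a f l z /\ 0 < coef_b f l z.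

Definition cols3 (c1 c2 c3 : 'cV[C]_3) : 'M[C]_3 :=
  \matrix_(i, j) [:: c1 i 0; c2 i 0; c3 i 0]`_j.

Definition frame (f : C -> 'M[C]_3) (l : C -> 'cV[C]_3) (z : C) : 'M[C]_3 :=
  cols3
    ((- 'i%C * (expR (- omega f z / 2) / Num.sqrt (coef_a f l z))%:C) *: xi l z)
    ((- 'i%C * (expR (- omega f z / 2) / Num.sqrt (coef_b f l z))%:C) *: eta l z)
    (l z).

(* The Levi-Civita connection of CP2 along f is the derivative in the space of
   Hermitian matrices followed by tanproj. *)
Definition nabla_x (f V : C -> 'M[C]_3) (z : C) : 'M[C]_3 := tanproj (f z) (mdx V z).
Definition nabla_y (f V : C -> 'M[C]_3) (z : C) : 'M[C]_3 := tanproj (f z) (mdy V z).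

(* Component normal to the surface; the formula is valid when f_x and f_y are
   orthogonal, in particular for conformal immersions. *)
Definition normal_part (f : C -> 'M[C]_3) (z : C) (W : 'M[C]_3) : 'M[C]_3 :=
  W - (gFS W (mdx f z) / gFS (mdx f z) (mdx f z))%:C *: mdx f z
    - (gFS W (mdy f z) / gFS (mdy f z) (mdy f z))%:C *: mdy f z.

(* Half the trace of the second fundamental form of a conformal immersion. *)
Definition mean_curvature (f : C -> 'M[C]_3) (z : C) : 'M[C]_3 :=
  2^-1 *:
   ((gFS (mdx f z) (mdx f z))^-1%:C *: normal_part f z (nabla_x f (mdx f) z)
  + (gFS (mdy f z) (mdy f z))^-1%:C *: normal_part f z (nabla_y f (mdy f) z)).

Definition minimal (D : set C) (f : C -> 'M[C]_3) : Prop :=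
  forall z, D z -> mean_curvature f z = 0.

Definition lagrangian (D : set C) (f : C -> 'M[C]_3) : Prop :=
  forall z, D z -> gFS (Jcplx (f z) (mdx f z)) (mdy f z) = 0.

(* Curvature of rho (dx^2 + dy^2) is - (Laplacian of ln rho) / (2 rho); here
   rho = 2 e^omega. *)
Definition gauss_curvature (f : C -> 'M[C]_3) (z : C) : R :=
  - (dx (dx (omega f)) z + dy (dy (omega f)) z) / (4 * expR (omega f z)).

Definition flat (D : set C) (f : C -> 'M[C]_3) : Prop :=
  forall z, D z -> gauss_curvature f z = 0.

Definition SU3 : set 'M[C]_3 := [set g | g \is unitarymx /\ \det g = 1].

(* Real Lie subalgebras of su(3). *)
Definition lie_subalgebra_su3 (h : set 'M[C]_3) : Prop :=
  [/\ forall X, h X -> X ^t* = - X /\ \tr X = 0,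
      h 0,
      forall X Y, h X -> h Y -> h (X + Y),
      forall (s : R) X, h X -> h (s%:C *: X) &
      forall X Y, h X -> h Y -> h (X *m Y - Y *m X)].

(* g = exp X, the exponential being the value at time 1 of the solution of
   c' = c X, c(0) = 1. *)
Definition is_expmx (X g : 'M[C]_3) : Prop :=
  exists c : R -> 'M[C]_3,
    [/\ c 0 = 1%:M, forall t, has_velocity c t (c t *m X) & c 1 = g].

Definition exp_generated (h : set 'M[C]_3) : set 'M[C]_3 :=
  [set g | exists s : seq 'M[C]_3,
     (forall x, x \in s -> exists2 X, h X & is_expmx X x) /\ g = \prod_(x <- s) x].

(* H is a Lie subgroup of SU(3), not necessarily closed or connected, with Lie
   algebra h: its identity component is the subgroup generated by exp h, and it
   has at most countably many components. *)
Definition lie_subgroup_SU3 (H h : set 'M[C]_3) : Prop :=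
  [/\ lie_subalgebra_su3 h,
      H `<=` SU3,
      [/\ H 1%:M, forall x y, H x -> H y -> H (x *m y) & forall x, H x -> H (invmx x)],
      exp_generated h `<=` H &
      exists c : nat -> 'M[C]_3,
        forall g, H g -> exists n k, exp_generated h k /\ g = c n *m k].

Definition orbit (H : set 'M[C]_3) (p : 'M[C]_3) : set 'M[C]_3 :=
  [set q | exists2 g, H g & q = g *m p *m g ^t*].

(* The orbit of p is an immersed submanifold whose tangent space at p is
   {[X, p] | X in h}; this space has real dimension 2. *)
Definition two_dim_orbit (h : set 'M[C]_3) (p : 'M[C]_3) : Prop :=
  exists X Y, [/\ h X, h Y &
    forall W, h W -> exists! st : R * R,
      W *m p - p *m W =
        st.1%:C *: (X *m p - p *m X) + st.2%:C *: (Y *m p - p *m Y)].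

Definition flat_homogeneous (D : set C) (f : C -> 'M[C]_3) : Prop :=
  flat D f /\
  exists (H h : set 'M[C]_3) (p : 'M[C]_3),
    [/\ lie_subgroup_SU3 H h, CP2 p, two_dim_orbit h p & f @` D `<=` orbit H p].

Definition can_be_derived_from (D : set C) (F : C -> 'M[C]_3) (f : C -> 'M[C]_3) : Prop :=
  [/\ conformal_immersion D f, without_complex_points D f &
      exists (l : C -> 'cV[C]_3) (T : C -> 'M[C]_3),
        [/\ lift D f l, msmooth D T &
            forall z, D z ->
              [/\ is_diag_mx (T z), SU3 (T z) & F z *m T z = frame f l z]]].

Definition expi (t : R) : C := cos t +i* sin t.

Definition mx3 (s : seq (seq C)) : 'M[C]_3 := \matrix_(i, j) (nth [::] s i)`_j.

Definition epsilon : C := expi (pi / 3).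

Definition Pmx : 'M[C]_3 :=
  mx3 [:: [:: 0; epsilon ^+ 2; 0];
          [:: epsilon ^+ 4; 0; 0];
          [:: 0; 0; 1]].

Definition sigma (g : 'M[C]_3) : 'M[C]_3 := Pmx *m invmx (g^T) *m Pmx.

(* The eigenspace of the differential of kappa at the identity for the
   eigenvalue e^(2 pi i m / k); kappa is an automorphism of SL(3) given by a
   formula that makes sense on GL(3), which contains 1 + tX for small t. *)
Definition eigen_sl3 (kappa : 'M[C]_3 -> 'M[C]_3) (k : nat) (m : int) : set 'M[C]_3 :=
  [set X | \tr X = 0 /\
     has_velocity (fun t : R => kappa (1%:M + t%:C *: X)) 0
                  (expi (2 * pi * m%:~R / k%:R) *: X)].

(* For beta = P dz + Q dzbar, the form d beta + [beta /\ beta] / 2 equals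
   (Q_z - P_zbar + [P, Q]) dz /\ dzbar. *)
Definition maurer_cartan (D : set C) (P Q : C -> 'M[C]_3) : Prop :=
  forall z, D z -> mdz Q z - mdzbar P z + (P z *m Q z - Q z *m P z) = 0.

Definition primitive_harmonic (D : set C) (kappa : 'M[C]_3 -> 'M[C]_3) (k : nat)
    (F : C -> 'M[C]_3) : Prop :=
  exists A_1 A0' A0'' A1 : C -> 'M[C]_3,
    [/\ [/\ msmooth D A_1, msmooth D A0', msmooth D A0'' & msmooth D A1],
        forall z, D z ->
          [/\ eigen_sl3 kappa k (-1) (A_1 z), eigen_sl3 kappa k 0 (A0' z),
              eigen_sl3 kappa k 0 (A0'' z) & eigen_sl3 kappa k 1 (A1 z)],
        forall z, D z ->
          invmx (F z) *m mdz F z = A_1 z + A0' z /\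
          invmx (F z) *m mdzbar F z = A0'' z + A1 z &
        forall lambda : C, lambda != 0 ->
          maurer_cartan D (fun z => lambda^-1 *: A_1 z + A0' z)
                          (fun z => A0'' z + lambda *: A1 z)].

End Defs.

(* Main.v *)
(** The candidate immersion is always [f = hopf (Fhat e_3) = Fhat E_33 Fhat^*].  From
    [Fhat^-1 d Fhat = U dz - U^* dzbar] and the vanishing of two entries of [U], the
    projections of [fhat_z] and [fhat_zbar] orthogonal to [fhat] are [u13] times the first
    and [- conj u32] times the second column of [Fhat], so [f] is a conformal immersion
    with [2 e^omega = |u13|^2 + |u32|^2], is Lagrangian iff [|u13| = |u32|], and is minimal
    when [u12 = 0].  Passing from [Fhat] to the frame of a lift of [f] amounts to extracting
    a cube root of a unimodular function on the contractible domain, which makes the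
    diagonal correction have determinant one.

    For [sigma] and [sigma^2] the eigenspaces force [u12 = 0], and for [sigma] also
    [u13 = u32].  For [sigma^3] write [u13 = s + d] and [u32 = s - d]; the zero curvature
    equations give [s conj d = 0].  As [u13] has no zero, by connectedness either [s = 0]
    everywhere, and then [w = u12 = 0], or [d = 0] everywhere.  In the second case [w] is
    holomorphic and [|w / s|] is constant.  If this constant is zero, then [u12 = 0].
    Otherwise [2 e^omega] is a constant times [|w|^2], so the metric is flat, and after a diagonal
    gauge [U] becomes [w] times a constant normal matrix; diagonalising that matrix exhibits
    [f] as contained in an orbit of a maximal torus of [SU(3)]. *)
Require Import Defs.
From HB Require Import structures.
From mathcomp Require Import all_boot all_order all_algebra.
From mathcomp Require Import spectral complex.
From mathcomp Require Import all_classical all_reals all_analysis.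
From mathcomp Require Import ring lra.
Import Order.TTheory GRing.Theory Num.Theory numFieldNormedType.Exports.
Local Open Scope classical_set_scope.
Local Open Scope ring_scope.
Local Open Scope complex_scope.
Local Open Scope sesquilinear_scope.

Local Notation Re := complex.Re.
Local Notation Im := complex.Im.

Set Implicit Arguments.
Unset Strict Implicit.
Unset Printing Implicit Defensive.

(** * Wirtinger calculus *)

(** In the order two case the [lambda^-1] part of the zero curvature equations gives both w_zbar = -
    s conj d and w d = 0. Where [d] is non-zero, [w] vanishes on an open set, hence so does its
    derivative: this is the source of s conj d = 0. Once [d = 0], the part constant in [lambda]
    contains the algebraic relation p conj s = 3 s conj w, that is p = 3 s conj q with q = w / s.
    Comparing zbar-derivatives gives q_z = u q, next to q_zbar = - conj u q, whence |q| is constant.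
    The phase of conj q is the diagonal gauge; its integrability removes the derivative of [u] from
    the remaining equation, which then prescribes the modulus of the one entry not yet known to be
    constant. That entry is holomorphic after division by [w], hence constant, and the prescribed
    modulus is exactly the condition for the matrix to be normal. The contraction of the domain is
    only continuous, so a logarithm cannot be integrated along its paths. The cube root is therefore
    built by subdividing these paths, which yields a continuous function, and its smoothness is
    recovered from the equation r^3 = g. *)

Section ComplexParts.
Variable R : realType.
Local Notation C := R[i].
Implicit Types x y : C.

Lemma Re_add x y : Re (x + y) = Re x + Re y. Proof. by case: x y => [a b] [c d]. Qed.
Lemma Im_add x y : Im (x + y) = Im x + Im y. Proof. by case: x y => [a b] [c d]. Qed.
Lemma Re_opp x : Re (- x) = - Re x. Proof. by case: x. Qed.
Lemma Im_opp x : Im (- x) = - Im x. Proof. by case: x. Qed.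
Lemma Re_mul x y : Re (x * y) = Re x * Re y - Im x * Im y.
Proof. by case: x y => [a b] [c d]. Qed.
Lemma Im_mul x y : Im (x * y) = Re x * Im y + Im x * Re y.
Proof. by case: x y => [a b] [c d]. Qed.
Lemma Re_conj x : Re (Num.conj x) = Re x. Proof. by case: x. Qed.
Lemma Im_conj x : Im (Num.conj x) = - Im x. Proof. by case: x. Qed.
Lemma Re_real (r : R) : Re r%:C = r. Proof. by []. Qed.
Lemma Im_real (r : R) : Im r%:C = 0. Proof. by []. Qed.
Definition ReIm := (Re_add, Im_add, Re_opp, Im_opp, Re_mul, Im_mul, Re_conj, Im_conj, Re_real, Im_real).

Lemma complexP x y : Re x = Re y -> Im x = Im y -> x = y.
Proof. by case: x y => ? ? [? ?] /= -> ->. Qed.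

End ComplexParts.

(** * Derivatives of complex and matrix curves *)

Section Curves.
Variable R : realType.
Local Notation C := R[i].
Implicit Types (g h : R -> C) (a b : C) (t : R).

(** The entrywise content of [has_velocity]: the product rule for complex curves lifts to matrix
    products through [cder_sum]. *)
Definition cder g t a := is_derive t 1 (fun s => Re (g s)) (Re a) /\
                         is_derive t 1 (fun s => Im (g s)) (Im a).

Lemma cder_cst a t : cder (fun=> a) t 0.
Proof. by split; apply: is_derive_cst. Qed.

Lemma cderD g h t a b : cder g t a -> cder h t b ->
  cder (fun s => g s + h s) t (a + b).
Proof.
move=> [g1 g2] [h1 h2]; split; rewrite ?ReIm.
  by rewrite (_ : (fun s => _) = (fun s => Re (g s)) + (fun s => Re (h s)));
    [exact: is_deriveD|apply/funext => s; rewrite !ReIm].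
by rewrite (_ : (fun s => _) = (fun s => Im (g s)) + (fun s => Im (h s)));
  [exact: is_deriveD|apply/funext => s; rewrite !ReIm].
Qed.

Lemma cderM g h t a b : cder g t a -> cder h t b ->
  cder (fun s => g s * h s) t (a * h t + g t * b).
Proof.
move=> [g1 g2] [h1 h2]; split.
  rewrite (_ : (fun s => _) = (fun s => Re (g s)) * (fun s => Re (h s)) -
     (fun s => Im (g s)) * (fun s => Im (h s))); last first.
    by apply/funext => s; rewrite !ReIm.
  apply: is_derive_eq; rewrite !ReIm /GRing.scale /=.
move: (Re (g t)) (Im (g t)) (Re (h t)) (Im (h t)) (Re a) (Im a) (Re b) (Im b); clear.
by move=> x1 x2 x3 x4 x5 x6 x7 x8; ring.
rewrite (_ : (fun s => _) = (fun s => Re (g s)) * (fun s => Im (h s)) +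
     (fun s => Im (g s)) * (fun s => Re (h s))); last first.
  by apply/funext => s; rewrite !ReIm.
apply: (is_derive_eq (is_deriveD (is_deriveM g1 h2) (is_deriveM g2 h1))).
rewrite !ReIm /GRing.scale /=.
move: (Re (g t)) (Im (g t)) (Re (h t)) (Im (h t)) (Re a) (Im a) (Re b) (Im b); clear.
by move=> x1 x2 x3 x4 x5 x6 x7 x8; ring.
Qed.

Lemma cder_conj g t a : cder g t a -> cder (fun s => Num.conj (g s)) t (Num.conj a).
Proof.
move=> [g1 g2]; split; rewrite ReIm.
  rewrite (_ : (fun s => _) = (fun s => Re (g s))); first exact: g1.
  by apply/funext => s; rewrite ReIm.
rewrite (_ : (fun s => _) = - (fun s => Im (g s))); first exact: is_deriveN.
by apply/funext => s; rewrite ReIm.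
Qed.

Lemma cder_near g h t a : (\forall s \near t, g s = h s) ->
  cder g t a -> cder h t a.
Proof.
move=> gh [g1 g2]; split.
  by apply: near_eq_is_derive g1; near=> s; congr Re; near: s.
by apply: near_eq_is_derive g2; near=> s; congr Im; near: s.
Unshelve. all: by end_near. Qed.

Lemma cder_unique g t a b : cder g t a -> cder g t b -> a = b.
Proof.
move=> [g1 g2] [h1 h2]; apply: complexP.
  by rewrite -(derive_val (is_derive := g1)) -(derive_val (is_derive := h1)).
by rewrite -(derive_val (is_derive := g2)) -(derive_val (is_derive := h2)).
Qed.

Lemma cder_real t : cder (fun s => s%:C) t 1.
Proof. split; [exact: is_derive_id|exact: is_derive_cst]. Qed.

Lemma cder_sum (I : Type) (r : seq I) (g : I -> R -> C) t (a : I -> C) :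
  (forall i, cder (g i) t (a i)) ->
  cder (fun s => \sum_(i <- r) g i s) t (\sum_(i <- r) a i).
Proof.
move=> ga; elim: r => [|i r IH].
  rewrite big_nil; under eq_fun do rewrite big_nil; exact: cder_cst.
by rewrite big_cons; under eq_fun do rewrite big_cons; exact: cderD.
Qed.

Lemma cder_cst_eq g (t s : R) : (forall x, cder g x 0) -> g t = g s.
Proof.
move=> g0; apply: complexP.
  by apply: (@is_derive_0_is_cst _ (fun s => Re (g s))) => x; case: (g0 x).
by apply: (@is_derive_0_is_cst _ (fun s => Im (g s))) => x; case: (g0 x).
Qed.

End Curves.

Section Velocity.
Variable R : realType.
Local Notation C := R[i].

Lemma velocity_near m n (g h : R -> 'M[C]_(m, n)) t A :
  (\forall s \near t, g s = h s) -> has_velocity g t A -> has_velocity h t A.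
Proof.
move=> gh gA i j; apply: (cder_near _ (gA i j)).
by near=> s; congr fun_of_matrix; near: s.
Unshelve. all: by end_near. Qed.

Lemma velocity_cst m n (A : 'M[C]_(m, n)) t : has_velocity (fun=> A) t 0.
Proof. by move=> i j; rewrite mxE; exact: cder_cst. Qed.

Lemma velocityD m n (g h : R -> 'M[C]_(m, n)) t A B :
  has_velocity g t A -> has_velocity h t B ->
  has_velocity (fun s => g s + h s) t (A + B).
Proof.
move=> gA hB i j; rewrite mxE; under eq_fun do rewrite mxE.
under [X in _ /\ is_derive _ _ X _]eq_fun do rewrite mxE.
exact: cderD (gA i j) (hB i j).
Qed.

Lemma velocityM m n p (g : R -> 'M[C]_(m, n)) (h : R -> 'M[C]_(n, p)) t A B :
  has_velocity g t A -> has_velocity h t B ->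
  has_velocity (fun s => g s *m h s) t (A *m h t + g t *m B).
Proof.
move=> gA hB i j; rewrite !mxE -big_split /=.
under eq_fun do rewrite mxE.
under [X in _ /\ is_derive _ _ X _]eq_fun do rewrite mxE.
by apply: cder_sum => k; apply: cderM; [exact: gA | exact: hB].
Qed.

Lemma velocity_unique m n (g : R -> 'M[C]_(m, n)) t A B :
  has_velocity g t A -> has_velocity g t B -> A = B.
Proof. by move=> gA gB; apply/matrixP => i j; apply: cder_unique (gA i j) (gB i j). Qed.

Lemma velocity_scale m n (g : R -> C) t a (A : 'M[C]_(m, n)) :
  cder g t a -> has_velocity (fun s => g s *: A) t (a *: A).
Proof.
move=> ga i j; rewrite mxE; under eq_fun do rewrite mxE.
under [X in _ /\ is_derive _ _ X _]eq_fun do rewrite mxE.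
have := cderM ga (cder_cst (A i j) t); rewrite mulr0 addr0; exact.
Qed.

Lemma velocity_cst_eq m n (g : R -> 'M[C]_(m, n)) (t s : R) :
  (forall x, has_velocity g x 0) -> g t = g s.
Proof.
move=> g0; apply/matrixP => i j; apply: (@cder_cst_eq _ (fun s => g s i j)) => x.
by have := g0 x i j; rewrite mxE.
Qed.

End Velocity.

(** * Neighbourhoods in the complex plane by real coordinates *)

Section ComplexTopology.
Variable R : realType.
Local Notation C := R[i].

Lemma norm_le_ReIm (x : C) : `|x| <= (`|Re x| + `|Im x|)%:C.
Proof.
rewrite normc_def lecE /= eqxx /= -[leRHS]ger0_norm ?addr_ge0// -sqrtr_sqr.
rewrite ler_wsqrtr// sqrrD -!normrX.
rewrite [X in _ <= X + _ + _]ger0_norm ?sqr_ge0// [X in _ <= _ + _ + X]ger0_norm ?sqr_ge0//.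
by rewrite -addrA lerD2l addrC lerDl mulrn_wge0 ?mulr_ge0.
Qed.

Lemma norm_ge_Im (x : C) : `|Im x|%:C <= `|x|.
Proof.
rewrite normc_def lecR -sqrtr_sqr ler_sqrt ?sqr_ge0 ?lerDr ?sqr_ge0//.
by rewrite addr_ge0 ?sqr_ge0.
Qed.

(** A disc contains the box of half its radius because [|x|] is at most [|Re x| + |Im x|], and a box
    contains the disc of the same radius. Neighbourhoods can then be handled one real coordinate at
    a time. *)
Lemma nbhs_box (z : C) (P : set C) : nbhs z P <->
  exists2 e : R, 0 < e & forall t : C, `|Re t - Re z| < e -> `|Im t - Im z| < e -> P t.
Proof.
split.
  (* The radius [e] is an element of [C]; being positive, it has imaginary part zero. *)
  move=> /nbhs_ballP[e /= e0 eP]; move: e0; rewrite ltcE => /andP[/eqP e0 e1].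
  exists (Re e / 2); first by rewrite divr_gt0.
  move=> t t1 t2; apply: eP => /=.
  rewrite -ball_normE /= (_ : e = (Re e)%:C); last exact: complexP.
  rewrite distrC; apply: le_lt_trans (norm_le_ReIm _) _; rewrite ltcR [ltRHS]splitr.
  by rewrite !ReIm ltrD.
move=> [e e0 eP]; apply/nbhs_ballP; exists e%:C; first by rewrite /= ltcR.
move=> t; rewrite -ball_normE /= distrC => zt.
apply: eP.
  by have := le_lt_trans (normc_ge_Re (t - z)) zt; rewrite ltcR !ReIm.
by have := le_lt_trans (norm_ge_Im (t - z)) zt; rewrite ltcR !ReIm.
Qed.

Lemma Re_continuous : continuous (@complex.Re R).
Proof.
move=> z P /nbhs_ballP[e /= e0 eP]; apply/nbhs_box; exists e => // t t1 _.
by apply: eP; rewrite /= /ball /= distrC.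
Qed.

Lemma Im_continuous : continuous (@complex.Im R).
Proof.
move=> z P /nbhs_ballP[e /= e0 eP]; apply/nbhs_box; exists e => // t _ t1.
by apply: eP; rewrite /= /ball /= distrC.
Qed.

Lemma complex_cvg (T : Type) (F : set_system T) (FF : Filter F) (g : T -> C) (l : C) :
  (fun x => Re (g x)) @ F --> Re l -> (fun x => Im (g x)) @ F --> Im l -> g @ F --> l.
Proof.
move=> gr gi P /nbhs_box[e e0 eP]; rewrite /nbhs /=.
have {}gr := gr _ (nbhsx_ballx (Re l) e e0).
have {}gi := gi _ (nbhsx_ballx (Im l) e e0).
rewrite /nbhs /= in gr gi; apply: (@filterS2 _ F FF _ _ _ _ gr gi) => x.
by rewrite /= /ball /= => x1 x2; apply: eP; rewrite distrC.
Qed.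

(** A boolean direction treats both partial derivatives at once: [true] is horizontal, [false]
    vertical, and [coor] is the parameter at which the line passes through [z]. *)
Definition line (b : bool) (z : C) (t : R) : C := if b then t +i* Im z else Re z +i* t.
Definition coor (b : bool) (z : C) : R := if b then Re z else Im z.

Lemma line_coor b z : line b z (coor b z) = z. Proof. by case: b z => [] []. Qed.

Lemma line_continuous b z : continuous (line b z).
Proof. by move=> t; case: b; apply: complex_cvg; (exact: cvg_id || exact: cvg_cst). Qed.

Lemma near_line b z (P : set C) : nbhs z P -> \forall t \near coor b z, P (line b z t).
Proof. by move=> zP; apply: line_continuous; rewrite line_coor. Qed.

End ComplexTopology.

(** * Partial derivatives and smooth real functions *)

Section Partials.
Variable R : realType.
Local Notation C := R[i].
Implicit Types (u v : C -> R) (D : set C).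

(** [pd true] and [pd false] are convertible to [dx] and [dy]. *)
Definition pd (b : bool) u (z : C) : R := derive1 (fun t => u (line b z t)) (coor b z).

Lemma pd_val b u z a :
  is_derive (coor b z) 1 (fun t => u (line b z t)) a -> pd b u z = a.
Proof. by move=> h; rewrite /pd derive1E; apply: derive_val. Qed.

Lemma pd_congr b u v z : (\near z, u z = v z) -> pd b u z = pd b v z.
Proof.
move=> uv; rewrite /pd !derive1E; apply: near_eq_derive.
exact: (near_line b uv).
Qed.

Lemma continuous_congr (T S : topologicalType) (u v : T -> S) (z : T) :
  (\near z, u z = v z) -> {for z, continuous u} -> {for z, continuous v}.
Proof.
move=> uv uc; have E : u z = v z by exact: (nbhs_singleton uv).
move=> P; rewrite -E => /uc; rewrite /nbhs /= => H.
by apply: (@filterS2 _ (nbhs z) _ _ _ _ _ uv H) => t /= <-.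
Qed.

Lemma class_C_cont n D u : class_C n D u -> forall z, D z -> {for z, continuous u}.
Proof. by case: n => [[]|n []]. Qed.

Lemma class_CS n D u : class_C n.+1 D u <->
  [/\ forall z, D z -> {for z, continuous u},
      forall b z, D z -> is_derive (coor b z) 1 (fun t => u (line b z t)) (pd b u z) &
      forall b, class_C n D (pd b u)].
Proof.
split.
  move=> [uc [ud u1 u2]]; split => //; last by case.
  move=> b z Dz; rewrite /pd derive1E; apply: derivableP.
  by have [ux uy] := ud z Dz; case: b; [exact: ux|exact: uy].
move=> [uc ud up]; split => //; split.
- by move=> z Dz; split; [have := ud true z Dz|have := ud false z Dz] => -[].
- exact: up true.
- exact: up false.
Qed.

Lemma class_C_pred n D u : class_C n.+1 D u -> class_C n D u.
Proof.
elim: n u => [|n IH] u; first by move=> /class_CS[].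
move=> /class_CS[uc ud up]; apply/class_CS; split=> // b; exact: IH.
Qed.

Lemma class_C_congr n D u v : open D -> (forall z, D z -> u z = v z) ->
  class_C n D u -> class_C n D v.
Proof.
move=> oD; have oDn z : D z -> nbhs z D by move=> Dz; exact: open_nbhs_nbhs.
elim: n u v => [|n IH] u v uv.
  move=> [uc _]; split => // z Dz.
  apply: continuous_congr (uc z Dz).
  by apply: (@filterS _ (nbhs z) _) (oDn _ Dz) => t /uv.
move=> /class_CS[uc ud up]; apply/class_CS; split.
- move=> z Dz.
  apply: continuous_congr (uc z Dz).
  by apply: (@filterS _ (nbhs z) _) (oDn _ Dz) => t /uv.
- move=> b z Dz; rewrite -(@pd_congr b u v); last by apply: (@filterS _ (nbhs z) _) (oDn _ Dz) => t /uv.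
  apply: near_eq_is_derive (ud b z Dz).
  have zuv : nbhs z [set t | u t = v t].
    by apply: (@filterS _ (nbhs z) _) (oDn _ Dz) => t /uv.
  exact: (near_line b zuv).
- move=> b; apply: IH (up b) => z Dz; apply: pd_congr.
  by apply: (@filterS _ (nbhs z) _) (oDn _ Dz) => t /uv.
Qed.

Lemma smooth_congr D u v : open D -> (forall z, D z -> u z = v z) ->
  smooth D u -> smooth D v.
Proof. by move=> oD uv us n; apply: class_C_congr (us n). Qed.

Lemma smooth_cont D u z : smooth D u -> D z -> {for z, continuous u}.
Proof. by move=> /(_ 0%N)/class_C_cont; apply. Qed.

Lemma smooth_is_derive D u b z : smooth D u -> D z ->
  is_derive (coor b z) 1 (fun t => u (line b z t)) (pd b u z).
Proof. by move=> /(_ 1%N)/class_CS[_ + _]; apply. Qed.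

Lemma smooth_pd D u b : smooth D u -> smooth D (pd b u).
Proof. by move=> us n; have /class_CS[_ _ /(_ b)] := us n.+1. Qed.

(** Bootstrap: when the partial derivatives are expressed by [u] itself and smooth functions, they
    inherit the class of [u], so that [u] gains one order at each step. *)
Lemma smooth_intro D u (du : bool -> C -> R) : open D ->
  (forall z, D z -> {for z, continuous u}) ->
  (forall b z, D z -> is_derive (coor b z) 1 (fun t => u (line b z t)) (du b z)) ->
  (forall n, class_C n D u -> forall b, class_C n D (du b)) ->
  smooth D u.
Proof.
move=> oD uc ud up; elim=> [|n IH]; first by split.
have pdE b z : D z -> pd b u z = du b z by move=> /ud/pd_val.
apply/class_CS; split => //.
- by move=> b z Dz; rewrite pdE//; exact: ud.
- by move=> b; apply: (class_C_congr oD _ (up n IH b)) => z /pdE.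
Qed.

Lemma class_C_cst n D (c : R) : class_C n D (fun=> c).
Proof.
elim: n c => [|n IH] c; first by split => // z _; exact: cst_continuous.
apply/class_CS; split.
- by move=> z _; exact: cst_continuous.
- move=> b z _; rewrite (_ : pd _ _ _ = 0); first exact: is_derive_cst.
  by apply: pd_val; exact: is_derive_cst.
- move=> b; rewrite (_ : pd _ _ = fun=> 0)//.
  by apply/funext => z; apply: pd_val; exact: is_derive_cst.
Qed.

Lemma class_CD n D u v : open D -> class_C n D u -> class_C n D v ->
  class_C n D (fun z => u z + v z).
Proof.
move=> oD; elim: n u v => [|n IH] u v.
  by move=> [uc _] [vc _]; split => // z Dz; exact: (continuousD (uc z Dz) (vc z Dz)).
move=> /class_CS[uc ud up] /class_CS[vc vd vp].
have dD b z : D z ->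
    is_derive (coor b z) 1 (fun t => u (line b z t) + v (line b z t)) (pd b u z + pd b v z).
  by move=> Dz; apply: is_deriveD; [exact: ud|exact: vd].
apply/class_CS; split.
- by move=> z Dz; exact: (continuousD (uc z Dz) (vc z Dz)).
- by move=> b z Dz; rewrite (pd_val (dD b z Dz)); exact: dD.
- move=> b; apply: (class_C_congr oD _ (IH _ _ (up b) (vp b))) => z Dz.
  by rewrite (pd_val (dD b z Dz)).
Qed.

Lemma class_CM n D u v : open D -> class_C n D u -> class_C n D v ->
  class_C n D (fun z => u z * v z).
Proof.
move=> oD; elim: n u v => [|n IH] u v.
  by move=> [uc _] [vc _]; split => // z Dz; exact: (continuousM (uc z Dz) (vc z Dz)).
move=> uC vC; move: (uC) (vC) => /class_CS[uc ud up] /class_CS[vc vd vp].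
have dM b z : D z ->
    is_derive (coor b z) 1 (fun t => u (line b z t) * v (line b z t))
      (u z * pd b v z + v z * pd b u z).
  move=> Dz.
  by have := is_deriveM (ud b z Dz) (vd b z Dz); rewrite line_coor; exact.
apply/class_CS; split.
- by move=> z Dz; exact: (continuousM (uc z Dz) (vc z Dz)).
- by move=> b z Dz; rewrite (pd_val (dM b z Dz)); exact: dM.
- move=> b; apply: (class_C_congr oD (u := fun z => u z * pd b v z + v z * pd b u z)) => [z Dz|].
    by rewrite (pd_val (dM b z Dz)).
  by apply: class_CD => //; apply: IH => //; exact: class_C_pred.
Qed.

Lemma smooth_cst D (c : R) : smooth D (fun=> c).
Proof. by move=> n; exact: class_C_cst. Qed.

Lemma smoothD D u v : open D -> smooth D u -> smooth D v -> smooth D (fun z => u z + v z).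
Proof. by move=> oD us vs n; apply: class_CD. Qed.

Lemma smoothM D u v : open D -> smooth D u -> smooth D v -> smooth D (fun z => u z * v z).
Proof. by move=> oD us vs n; apply: class_CM. Qed.

Lemma smoothN D u : open D -> smooth D u -> smooth D (fun z => - u z).
Proof.
move=> oD us; have := smoothM oD (smooth_cst D (-1)) us.
by apply: smooth_congr => // z _; rewrite mulN1r.
Qed.

Lemma smoothV D u : open D -> (forall z, D z -> u z != 0) -> smooth D u ->
  smooth D (fun z => (u z)^-1).
Proof.
move=> oD u0 us.
apply: (@smooth_intro _ _ (fun b z => - (((u z)^-1 * (u z)^-1) * pd b u z))) => //.
- by move=> z Dz; exact: (continuousV (u0 z Dz) (smooth_cont us Dz)).
- move=> b z Dz; have ud := smooth_is_derive b us Dz.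
  have uz0 : u (line b z (coor b z)) != 0 by rewrite line_coor u0.
  have := is_deriveV uz0 ud; rewrite line_coor => h; apply: (is_derive_eq h).
  by rewrite /GRing.scale /= -invfM expr2 mulNr.
- move=> n uV b; have uVV := class_CM oD (class_CM oD uV uV) (smooth_pd b us n).
  have := class_CM oD (class_C_cst n D (-1)) uVV.
  by apply: class_C_congr => // z _; rewrite mulN1r.
Qed.

Lemma smooth_sqrt D u : open D -> (forall z, D z -> 0 < u z) -> smooth D u ->
  smooth D (fun z => Num.sqrt (u z)).
Proof.
move=> oD u0 us.
have uVs : smooth D (fun z => (u z)^-1).
  by apply: smoothV => // z /u0 /lt0r_neq0.
(* The derivative is written with the root and with [(u z)^-1] rather than with the inverse of the
   root, so that the bootstrap only meets the root and functions already known to be smooth. *)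
apply: (@smooth_intro _ _ (fun b z => 2^-1 * (Num.sqrt (u z) * ((u z)^-1 * pd b u z)))) => //.
- move=> z Dz; apply: (@continuous_comp _ _ _ u Num.sqrt); first exact: smooth_cont Dz.
  exact: sqrt_continuous.
- move=> b z Dz; have ud := smooth_is_derive b us Dz.
  have uz0 : 0 < u (line b z (coor b z)) by rewrite line_coor u0.
  have := is_derive1_comp (is_derive1_sqrt uz0) ud; rewrite line_coor => h.
  apply: (is_derive_eq h); rewrite mulrA mulrA -{3}(sqr_sqrtr (ltW (u0 _ Dz))).
  congr (_ * _); have s0 : Num.sqrt (u z) != 0 by rewrite gt_eqF// sqrtr_gt0 u0.
  by field.
- move=> n uS b; apply: class_CM => //; first exact: class_C_cst.
  by apply: (class_CM oD uS); apply: (class_CM oD (uVs n)); exact: smooth_pd.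
Qed.

End Partials.

(** * Mean values and the symmetry of second derivatives *)

Section MeanValue.
Variable R : realType.
Local Notation C := R[i].

Lemma mvt_closed (f df : R -> R) (a b : R) : a < b ->
  (forall x, a <= x <= b -> is_derive x 1 f (df x)) ->
  exists2 c, a < c < b & f b - f a = df c * (b - a).
Proof.
move=> ab fd.
have [||c] := @MVT R f df a b ab.
- by move=> x; rewrite in_itv /= => /andP[? ?]; apply: fd; rewrite !ltW.
- apply: derivable_within_continuous => x; rewrite in_itv /= => xab.
  exact: (ex_derive (is_derive := fd x xab)).
by rewrite in_itv /= => cab E; exists c.
Qed.

Lemma derive0_eq (f : R -> R) (a b e : R) : `|b - a| < e ->
  (forall x, `|x - a| < e -> is_derive x 1 f 0) -> f b = f a.
Proof.
move=> abe fd; have [ab|ba|->//] := ltgtP a b.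
  have [|c _ /eqP] := @mvt_closed f (fun=> 0) a b ab; last by rewrite mul0r subr_eq0 => /eqP.
  move=> x /andP[ax xb]; apply: fd; apply: le_lt_trans abe.
  by rewrite !ger0_norm ?subr_ge0 ?(ltW ab)// lerB.
have [|c _ /eqP] := @mvt_closed f (fun=> 0) b a ba; last by rewrite mul0r subr_eq0 => /eqP.
move=> x /andP[ax xb]; apply: fd; apply: le_lt_trans abe.
by rewrite !ler0_norm ?subr_le0 ?(ltW ba)// lerN2 lerB.
Qed.

(** The mean value theorem is applied in [x] to the difference of two horizontal sections, then in
    [y] to [g1]: the second difference over a square is the area times a value of the mixed
    derivative. *)
Lemma rectangle_mvt (g g1 g12 : R -> R -> R) (a b h : R) : 0 < h ->
  (forall x y, a <= x <= a + h -> b <= y <= b + h ->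
     is_derive x 1 (fun x' => g x' y) (g1 x y)) ->
  (forall x y, a <= x <= a + h -> b <= y <= b + h ->
     is_derive y 1 (g1 x) (g12 x y)) ->
  exists x y, [/\ a < x < a + h, b < y < b + h &
    g (a + h) (b + h) - g (a + h) b - (g a (b + h) - g a b) = g12 x y * h * h].
Proof.
move=> h0 gd g1d.
have bb : b <= b <= b + h by rewrite lexx lerDl ltW.
have bh : b <= b + h <= b + h by rewrite lexx lerDl ltW.
have [||x xab E] := @mvt_closed (fun x => g x (b + h) - g x b)
  (fun x => g1 x (b + h) - g1 x b) a (a + h); first by rewrite ltrDl.
  by move=> x xab; apply: is_deriveB; apply: gd.
have xab' : a <= x <= a + h by case/andP: xab => ? ?; rewrite !ltW.
have [||y yab E'] := @mvt_closed (g1 x) (g12 x) b (b + h); first by rewrite ltrDl.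
  by move=> y yab; exact: g1d.
exists x, y; split=> //.
move: E'; rewrite (addrC b) addrK => E'; move: E; rewrite (addrC b) E' (addrC a) addrK => ->.
by [].
Qed.

Lemma half_dist_absurd (p q s : R) :
  `|p - s| < `|p - q| / 2 -> `|q - s| < `|p - q| / 2 -> False.
Proof.
move=> h1 h2; have := ler_distD s p q; rewrite leNgt => /negP; apply.
by rewrite [ltRHS]splitr; apply: ltrD => //; rewrite distrC.
Qed.

(** Schwarz's theorem. The second difference of [u] over a small square at [z] does not depend on
    the order of the differences, so some value of one mixed derivative equals some value of the
    other. By continuity these values lie within half the supposed gap of [P z] and [Q z], which is
    absurd. *)
Lemma pd_comm (D : set C) (u : C -> R) z : open D -> class_C 2 D u -> D z ->
  pd true (pd false u) z = pd false (pd true u) z.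
Proof.
move=> oD uC Dz; apply/eqP/negPn/negP => ne.
have /class_CS[_ ud up] := uC.
have /class_CS[_ u1 u11] := up true; have /class_CS[_ u2 u22] := up false.
have Pc := class_C_cont (u22 true) Dz; have Qc := class_C_cont (u11 false) Dz.
set P := pd true _ in ne Pc *; set Q := pd false _ in ne Qc *.
have e0 : 0 < `|P z - Q z| / 2 by rewrite divr_gt0// normr_gt0 subr_eq0.
set e := _ / 2 in e0.
have /nbhs_box[r1 r10 H1] : nbhs z D by exact: open_nbhs_nbhs.
have /nbhs_box[r2 r20 H2] := Pc _ (nbhsx_ballx (P z) e e0).
have /nbhs_box[r3 r30 H3] := Qc _ (nbhsx_ballx (Q z) e e0).
pose r := Num.min r1 (Num.min r2 r3); pose h := r / 2.
have r0 : 0 < r by rewrite !lt_min r10 r20 r30.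
have h0 : 0 < h by rewrite divr_gt0.
have hr : h < r by rewrite /h ltr_pdivrMr// mulr_natr mulr2n ltrDl.
have close (a x : R) : a <= x <= a + h -> `|x - a| < r.
  move=> /andP[ax xh]; rewrite ger0_norm ?subr_ge0//; apply: le_lt_trans hr.
  by rewrite lerBlDl.
have inD x y : Re z <= x <= Re z + h -> Im z <= y <= Im z + h -> D (x +i* y).
  by move=> /close + /close; rewrite /r !lt_min => /andP[? _] /andP[? _]; exact: H1.
have [||x [y [/andP[x1 x2] /andP[y1 y2] E1]]] := @rectangle_mvt
    (fun x y => u (x +i* y)) (fun x y => pd true u (x +i* y)) (fun x y => Q (x +i* y)) (Re z) (Im z) h h0.
- by move=> t s ht hs; exact: (ud true _ (inD t s ht hs)).
- by move=> t s ht hs; exact: (u1 false _ (inD t s ht hs)).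
have [||y' [x' [/andP[y1' y2'] /andP[x1' x2'] E2]]] := @rectangle_mvt
    (fun y x => u (x +i* y)) (fun y x => pd false u (x +i* y)) (fun y x => P (x +i* y)) (Im z) (Re z) h h0.
- by move=> t s ht hs; exact: (ud false _ (inD s t hs ht)).
- by move=> t s ht hs; exact: (u2 true _ (inD s t hs ht)).
have gen (p q k a b c d : R) : k != 0 ->
    a - b - (c - d) = q * k * k -> a - c - (b - d) = p * k * k -> p = q.
  move=> k0 e1 e2; have kk : k * k != 0 by rewrite mulf_neq0.
  by apply: (mulIf kk); rewrite !mulrA -e1 -e2; ring.
have h0' : h != 0 by rewrite gt_eqF.
have PQ := gen _ _ _ _ _ _ _ h0' E1 E2.
have hx := close _ _ (introT andP (conj (ltW x1) (ltW x2))).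
have hy := close _ _ (introT andP (conj (ltW y1) (ltW y2))).
have hx' := close _ _ (introT andP (conj (ltW x1') (ltW x2'))).
have hy' := close _ _ (introT andP (conj (ltW y1') (ltW y2'))).
move: hx hy hx' hy'; rewrite /r !lt_min => /and3P[_ _ hx] /and3P[_ _ hy] /and3P[_ hx' _] /and3P[_ hy' _].
have l2 := H2 (x' +i* y') hx' hy'; have l1 := H3 (x +i* y) hx hy.
by apply: (half_dist_absurd l2); rewrite PQ; exact: l1.
Qed.

End MeanValue.

(** * Locally constant properties on a connected open set *)

Section Connected.
Variable R : realType.
Local Notation C := R[i].
Implicit Types D : set C.

(** The local hypothesis makes both [P] and its negation open in [D], so the part of [D] where [P]
    holds is relatively open and closed. *)
Lemma connected_local D (P : C -> Prop) : open D -> connected D ->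
  (forall z, D z -> exists2 A, nbhs z A & forall t, A t -> D t -> (P t <-> P z)) ->
  forall z0, D z0 -> P z0 -> forall z, D z -> P z.
Proof.
move=> oD cD lP z0 Dz0 Pz0 z Dz.
have step (Q : C -> Prop) :
    (forall z, D z -> exists2 A, nbhs z A & forall t, A t -> D t -> (Q t <-> Q z)) ->
    open [set z | D z /\ Q z].
  move=> lQ; rewrite openE => t [Dt Qt]; have [A At AQ] := lQ t Dt.
  have nD : nbhs t D by exact: open_nbhs_nbhs.
  by apply: (@filterS2 _ (nbhs t) _ _ _ _ _ At nD) => s As Ds; split => //; apply/AQ.
have /seteqP[_ /(_ z Dz)[]//] : D `&` P = D.
apply: cD.
- by exists z0.
- exists [set z | D z /\ P z]; first exact: step.
  by apply/seteqP; split => t /= [].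
- exists (~` [set z | D z /\ ~ P z]).
    rewrite closedC; apply: step => t Dt; have [A At AQ] := lP t Dt.
    by exists A => // s As Ds; have [h1 h2] := AQ s As Ds; split => [nPs /h2 //|nPt /h1].
  apply/seteqP; split => t /=; first by move=> [Dt Pt]; split => // -[].
  by move=> [Dt nP]; split => //; apply: contrapT => nPt; apply: nP.
Qed.

(** Inside a box two points are joined by a horizontal and a vertical segment, and [derive0_eq]
    applies along each. *)
Lemma smooth_constant D (u : C -> R) : open D -> connected D -> smooth D u ->
  (forall b z, D z -> pd b u z = 0) -> forall z0 z, D z0 -> D z -> u z = u z0.
Proof.
move=> oD cD us u0 z0 z Dz0 Dz.
apply: (@connected_local D (fun t => u t = u z0) oD cD _ z0 Dz0 erefl z Dz).
move=> {Dz}z Dz; have nD : nbhs z D by exact: open_nbhs_nbhs.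
move: nD => /nbhs_box[e e0 eD].
exists [set t | `|Re t - Re z| < e /\ `|Im t - Im z| < e].
  by apply/nbhs_box; exists e.
move=> t [t1 t2] Dt; suff -> : u t = u z by [].
have eta (x : C) : Re x +i* Im x = x by case: x.
have E1 : u (Re t +i* Im t) = u (Re z +i* Im t).
  apply: (@derive0_eq R (fun s => u (s +i* Im t)) _ _ e t1) => x xz.
  by have Dx := eD (x +i* Im t) xz t2; have := smooth_is_derive true us Dx; rewrite u0.
have E2 : u (Re z +i* Im t) = u (Re z +i* Im z).
  apply: (@derive0_eq R (fun s => u (Re z +i* s)) _ _ e t2) => y yz.
  have Dy : D (Re z +i* y) by apply: eD; rewrite //= subrr normr0.
  by have := smooth_is_derive false us Dy; rewrite u0.
by move: E1; rewrite E2 !eta.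
Qed.

End Connected.

(** * Wirtinger derivatives of functions *)

Section Wirtinger.
Variable R : realType.
Local Notation C := R[i].
Variable D : set C.
Hypothesis oD : open D.
Implicit Types (g h : C -> C) (s z : C).

Definition csmooth g := smooth D (fun z => Re (g z)) /\ smooth D (fun z => Im (g z)).

Definition cpd b g z : C := pd b (fun y => Re (g y)) z +i* pd b (fun y => Im (g y)) z.

(** The value [s = - 'i] gives d/dz and [s = 'i] gives d/dzbar. With [s] as a parameter each rule is
    proved once for both, and conjugating the function amounts to conjugating [s]. *)
Definition Dw s g z : C := 2^-1 * (cpd true g z + s * cpd false g z).

Lemma open_near z : D z -> nbhs z D.
Proof. by move=> Dz; exact: open_nbhs_nbhs. Qed.

Lemma csmooth_cder b g z : csmooth g -> D z ->
  cder (fun t => g (line b z t)) (coor b z) (cpd b g z).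
Proof. by move=> [g1 g2] Dz; split; [exact: (smooth_is_derive b g1 Dz)|exact: (smooth_is_derive b g2 Dz)]. Qed.

Lemma cpd_val b g z a : cder (fun t => g (line b z t)) (coor b z) a -> cpd b g z = a.
Proof. by move=> [g1 g2]; apply: complexP; [exact: (pd_val g1)|exact: (pd_val g2)]. Qed.

Lemma cpd_congr b g h z : D z -> (forall y, D y -> g y = h y) -> cpd b g z = cpd b h z.
Proof.
move=> Dz gh; congr (_ +i* _); apply: pd_congr.
  by apply: (@filterS _ (nbhs z) _) (open_near Dz) => t /gh ->.
by apply: (@filterS _ (nbhs z) _) (open_near Dz) => t /gh ->.
Qed.

Lemma csmooth_congr g h : (forall y, D y -> g y = h y) -> csmooth g -> csmooth h.
Proof.
move=> gh [g1 g2]; split.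
  by apply: smooth_congr g1 => // z /gh ->.
by apply: smooth_congr g2 => // z /gh ->.
Qed.

Lemma csmooth_cst (c : C) : csmooth (fun=> c).
Proof. by split; exact: smooth_cst. Qed.

Lemma csmoothD g h : csmooth g -> csmooth h -> csmooth (fun z => g z + h z).
Proof.
move=> [g1 g2] [h1 h2]; split.
  by apply: smooth_congr (smoothD oD g1 h1) => // z _; rewrite ReIm.
by apply: smooth_congr (smoothD oD g2 h2) => // z _; rewrite ReIm.
Qed.

Lemma csmoothM g h : csmooth g -> csmooth h -> csmooth (fun z => g z * h z).
Proof.
move=> [g1 g2] [h1 h2]; split.
  have := smoothD oD (smoothM oD g1 h1) (smoothN oD (smoothM oD g2 h2)).
  by apply: smooth_congr => // z _; rewrite ReIm.
have := smoothD oD (smoothM oD g1 h2) (smoothM oD g2 h1).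
by apply: smooth_congr => // z _; rewrite ReIm.
Qed.

Lemma csmoothN g : csmooth g -> csmooth (fun z => - g z).
Proof.
move=> gs; have := csmoothM (csmooth_cst (-1)) gs.
by apply: csmooth_congr => z _; rewrite mulN1r.
Qed.

Lemma csmoothJ g : csmooth g -> csmooth (fun z => Num.conj (g z)).
Proof.
move=> [g1 g2]; split.
  by apply: smooth_congr g1 => // z _; rewrite ReIm.
by apply: smooth_congr (smoothN oD g2) => // z _; rewrite ReIm.
Qed.

Lemma csmooth_real (u : C -> R) : smooth D u -> csmooth (fun z => (u z)%:C).
Proof. by split => //=; exact: smooth_cst. Qed.

Lemma normc2E (x : C) : x * Num.conj x = (Re x ^+ 2 + Im x ^+ 2)%:C.
Proof. by rewrite add_Re2_Im2 -normCK. Qed.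

Lemma normc2_gt0 (x : C) : x != 0 -> 0 < Re x ^+ 2 + Im x ^+ 2.
Proof.
move=> x0; rewrite lt_neqAle addr_ge0 ?sqr_ge0// andbT eq_sym.
apply: contra_neq x0 => h; apply/eqP; rewrite -normr_eq0 -sqrf_eq0.
by rewrite normCK normc2E h.
Qed.

Lemma smooth_normc2 g : csmooth g -> smooth D (fun z => Re (g z) ^+ 2 + Im (g z) ^+ 2).
Proof. by move=> [g1 g2]; apply: smoothD => //; apply: smoothM. Qed.

Lemma csmoothV g : (forall z, D z -> g z != 0) -> csmooth g -> csmooth (fun z => (g z)^-1).
Proof.
move=> g0 gs.
have n0 z : D z -> Re (g z) ^+ 2 + Im (g z) ^+ 2 != 0.
  by move=> /g0/normc2_gt0/lt0r_neq0.
have := csmoothM (csmoothJ gs) (csmooth_real (smoothV oD n0 (smooth_normc2 gs))).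
apply: csmooth_congr => z Dz; rewrite fmorphV /= -normc2E invfM mulrCA mulfV ?mulr1//.
by rewrite conjC_eq0 g0.
Qed.

Lemma csmooth_sum (I : Type) (r : seq I) (g : I -> C -> C) :
  (forall i, csmooth (g i)) -> csmooth (fun z => \sum_(i <- r) g i z).
Proof.
move=> gs; elim: r => [|i r IH].
  by apply: csmooth_congr (csmooth_cst 0) => z _; rewrite big_nil.
by apply: csmooth_congr (csmoothD (gs i) IH) => z _; rewrite big_cons.
Qed.

Lemma csmooth_cpd b g : csmooth g -> csmooth (cpd b g).
Proof. by move=> [g1 g2]; split; exact: smooth_pd. Qed.

Lemma csmooth_Dw s g : csmooth g -> csmooth (Dw s g).
Proof.
move=> gs; apply: csmoothM; first exact: csmooth_cst.
apply: csmoothD; first exact: csmooth_cpd.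
by apply: csmoothM; [exact: csmooth_cst|exact: csmooth_cpd].
Qed.

Lemma csmooth_cont g z : csmooth g -> D z -> {for z, continuous g}.
Proof.
move=> [g1 g2] Dz; apply: (@complex_cvg _ _ (nbhs z) _).
  exact: (smooth_cont g1 Dz).
exact: (smooth_cont g2 Dz).
Qed.

Lemma csmooth_near_neq0 g z : csmooth g -> D z -> g z != 0 ->
  nbhs z [set t | D t /\ g t != 0].
Proof.
move=> gs Dz g0.
have pos : 0 < Re (g z) ^+ 2 + Im (g z) ^+ 2 by exact: normc2_gt0.
have := smooth_cont (smooth_normc2 gs) Dz.
move=> /(_ _ (nbhsx_ballx (Re (g z) ^+ 2 + Im (g z) ^+ 2) _ pos)).
rewrite /nbhs /= => H; apply: (@filterS2 _ (nbhs z) _ _ _ _ _ (open_near Dz) H) => t Dt.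
rewrite /ball /= => hb; split => //; apply/eqP => gt0; move: hb.
by rewrite gt0 /= expr0n addr0 subr0 gtr0_norm// ltxx.
Qed.

Lemma Dw_congr s g h z : D z -> (forall y, D y -> g y = h y) -> Dw s g z = Dw s h z.
Proof. by move=> Dz gh; rewrite /Dw !(cpd_congr _ Dz gh). Qed.

Lemma Dw_cst s (c : C) z : Dw s (fun=> c) z = 0.
Proof. by rewrite /Dw !(@cpd_val _ _ _ 0) ?mulr0 ?addr0 ?mulr0//; exact: cder_cst. Qed.

Lemma DwD s g h z : csmooth g -> csmooth h -> D z ->
  Dw s (fun y => g y + h y) z = Dw s g z + Dw s h z.
Proof.
move=> gs hs Dz; have E b : cpd b (fun y => g y + h y) z = cpd b g z + cpd b h z.
  by apply: cpd_val; apply: cderD; exact: csmooth_cder.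
by rewrite /Dw !E; ring.
Qed.

Lemma DwM s g h z : csmooth g -> csmooth h -> D z ->
  Dw s (fun y => g y * h y) z = Dw s g z * h z + g z * Dw s h z.
Proof.
move=> gs hs Dz.
have E b : cpd b (fun y => g y * h y) z = cpd b g z * h z + g z * cpd b h z.
  apply: cpd_val; have := cderM (csmooth_cder b gs Dz) (csmooth_cder b hs Dz).
  by rewrite line_coor.
by rewrite /Dw !E; ring.
Qed.

Lemma DwMc s (c : C) h z : csmooth h -> D z -> Dw s (fun y => c * h y) z = c * Dw s h z.
Proof. by move=> hs Dz; rewrite DwM//; [rewrite Dw_cst mul0r add0r|exact: csmooth_cst]. Qed.

Lemma DwN s h z : csmooth h -> D z -> Dw s (fun y => - h y) z = - Dw s h z.
Proof.
move=> hs Dz; rewrite -mulN1r -DwMc//; apply: Dw_congr => // y _.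
by rewrite mulN1r.
Qed.

Lemma DwJ s g z : csmooth g -> D z ->
  Dw s (fun y => Num.conj (g y)) z = Num.conj (Dw (Num.conj s) g z).
Proof.
move=> gs Dz.
have E b : cpd b (fun y => Num.conj (g y)) z = Num.conj (cpd b g z).
  by apply: cpd_val; apply: cder_conj; exact: csmooth_cder.
rewrite /Dw !E rmorphM rmorphD rmorphM fmorphV rmorph_nat /=.
by rewrite -[Num.conj (Num.conj s)]/(s^*^*) conjcK.
Qed.

Lemma Dw_sum s (I : Type) (r : seq I) (g : I -> C -> C) z :
  (forall i, csmooth (g i)) -> D z ->
  Dw s (fun y => \sum_(i <- r) g i y) z = \sum_(i <- r) Dw s (g i) z.
Proof.
move=> gs Dz; elim: r => [|i r IH].
  by rewrite big_nil (@Dw_congr _ _ (fun=> 0)) ?Dw_cst// => y _; rewrite big_nil.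
rewrite big_cons -IH -DwD//; last exact: csmooth_sum.
by apply: Dw_congr => // y _; rewrite big_cons.
Qed.

Lemma cpd_comm g z : csmooth g -> D z ->
  cpd true (cpd false g) z = cpd false (cpd true g) z.
Proof. by move=> [g1 g2] Dz; exact: (congr2 (@Complex R) (pd_comm oD (g1 2%N) Dz) (pd_comm oD (g2 2%N) Dz)). Qed.

Lemma cpdD b g h z : csmooth g -> csmooth h -> D z ->
  cpd b (fun y => g y + h y) z = cpd b g z + cpd b h z.
Proof. by move=> gs hs Dz; apply: cpd_val; apply: cderD; exact: csmooth_cder. Qed.

Lemma cpdMc b (c : C) h z : csmooth h -> D z -> cpd b (fun y => c * h y) z = c * cpd b h z.
Proof.
move=> hs Dz; apply: cpd_val.
by have := cderM (cder_cst c (coor b z)) (csmooth_cder b hs Dz); rewrite mul0r add0r.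
Qed.

Lemma cpd_Dw b s g z : csmooth g -> D z ->
  cpd b (Dw s g) z = 2^-1 * (cpd b (cpd true g) z + s * cpd b (cpd false g) z).
Proof.
move=> gs Dz; have c1 := csmooth_cpd true gs; have c2 := csmooth_cpd false gs.
have c3 : csmooth (fun y => s * cpd false g y) by apply: csmoothM => //; exact: csmooth_cst.
by rewrite cpdMc// ?cpdD// ?cpdMc//; exact: csmoothD.
Qed.

Lemma Dw_def s g z : Dw s g z = 2^-1 * (cpd true g z + s * cpd false g z).
Proof. by []. Qed.

Lemma Dw_comm s s' g z : csmooth g -> D z -> Dw s (Dw s' g) z = Dw s' (Dw s g) z.
Proof.
move=> gs Dz; rewrite (Dw_def s (Dw s' g)) (Dw_def s' (Dw s g)).
rewrite !(cpd_Dw _ _ gs Dz) (cpd_comm gs Dz).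
move: (cpd _ _ _) (cpd _ (cpd false g) _) (cpd _ (cpd true g) _) => a b c; ring.
Qed.

Lemma wirtinger0 (x y : C) :
  2^-1 * (x + - 'i%C * y) = 0 -> 2^-1 * (x + 'i%C * y) = 0 -> x = 0 /\ y = 0.
Proof.
have i2 : (2 : C) != 0 by rewrite pnatr_eq0.
move=> /eqP; rewrite mulf_eq0 invr_eq0 (negPf i2) /= => /eqP e1.
move=> /eqP; rewrite mulf_eq0 invr_eq0 (negPf i2) /= => /eqP e2.
have x0 : x = 0.
  by apply: (mulfI i2); rewrite mulr0 -[RHS]addr0 -{1}e1 -e2; ring.
split=> //; move: e2; rewrite x0 add0r => /eqP; rewrite mulf_eq0 => /orP[|/eqP//].
by rewrite eq_complex /= oner_eq0 andbF.
Qed.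

Lemma wirtinger_x (x y : C) :
  x = 2^-1 * (x + - 'i%C * y) + 2^-1 * (x + 'i%C * y).
Proof. by field. Qed.

Lemma wirtinger_y (x y : C) :
  y = 'i%C * (2^-1 * (x + - 'i%C * y) - 2^-1 * (x + 'i%C * y)).
Proof.
have E (i : C) : i * (2^-1 * (x + - i * y) - 2^-1 * (x + i * y)) = - (i * i) * y.
  by field.
by rewrite E -expr2 sqr_i opprK mul1r.
Qed.

Lemma Dw_eq0_constant g : connected D -> csmooth g ->
  (forall z, D z -> Dw (- 'i%C) g z = 0) -> (forall z, D z -> Dw 'i%C g z = 0) ->
  forall z0 z, D z0 -> D z -> g z = g z0.
Proof.
move=> cD [g1 g2] d1 d2.
have E b z : D z -> cpd b g z = 0.
  by move=> Dz; have [x0 y0] := wirtinger0 (d1 z Dz) (d2 z Dz); case: b.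
move=> z0 z Dz0 Dz; apply: complexP.
  apply: (smooth_constant oD cD g1 _ Dz0 Dz) => b y Dy.
  by have := congr1 (@complex.Re R) (E b y Dy).
apply: (smooth_constant oD cD g2 _ Dz0 Dz) => b y Dy.
by have := congr1 (@complex.Im R) (E b y Dy).
Qed.

End Wirtinger.

(** * Wirtinger derivatives of matrices *)

Section MatrixWirtinger.
Variable R : realType.
Local Notation C := R[i].
Variable D : set C.
Hypothesis oD : open D.
Implicit Types (g h : C -> C) (s z : C).
Implicit Types m n p : nat.

Definition Mw s m n (F : C -> 'M[C]_(m, n)) z : 'M[C]_(m, n) :=
  \matrix_(i, j) Dw s (fun y => F y i j) z.

Lemma mdzE m n (F : C -> 'M[C]_(m, n)) z : mdz F z = Mw (- 'i%C) F z.
Proof. by apply/matrixP => i j; rewrite !mxE /Dw mulNr. Qed.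

Lemma mdzbarE m n (F : C -> 'M[C]_(m, n)) z : mdzbar F z = Mw 'i%C F z.
Proof. by apply/matrixP => i j; rewrite !mxE /Dw. Qed.

Lemma mdx_Mw m n (F : C -> 'M[C]_(m, n)) z : mdx F z = Mw (- 'i%C) F z + Mw 'i%C F z.
Proof.
apply/matrixP => i j; rewrite !mxE -[LHS]/(cpd true (fun y => F y i j) z) /Dw.
exact: wirtinger_x.
Qed.

Lemma mdy_Mw m n (F : C -> 'M[C]_(m, n)) z :
  mdy F z = 'i%C *: (Mw (- 'i%C) F z - Mw 'i%C F z).
Proof.
apply/matrixP => i j; rewrite !mxE -[LHS]/(cpd false (fun y => F y i j) z) /Dw.
exact: wirtinger_y.
Qed.

Lemma msmoothE m n (F : C -> 'M[C]_(m, n)) :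
  msmooth D F <-> forall i j, csmooth D (fun z => F z i j).
Proof. by []. Qed.

Lemma msmooth_congr m n (F G : C -> 'M[C]_(m, n)) : (forall y, D y -> F y = G y) ->
  msmooth D F -> msmooth D G.
Proof. by move=> FG Fs i j; apply: (csmooth_congr oD _ (Fs i j)) => y /FG ->. Qed.

Lemma msmooth_cst m n (A : 'M[C]_(m, n)) : msmooth D (fun=> A).
Proof. by move=> i j; exact: csmooth_cst. Qed.

Lemma msmoothD m n (F G : C -> 'M[C]_(m, n)) : msmooth D F -> msmooth D G ->
  msmooth D (fun z => F z + G z).
Proof.
by move=> Fs Gs i j; apply: (csmooth_congr oD _ (csmoothD oD (Fs i j) (Gs i j))) => z _; rewrite mxE.
Qed.

Lemma msmoothM m n p (F : C -> 'M[C]_(m, n)) (G : C -> 'M[C]_(n, p)) :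
  msmooth D F -> msmooth D G -> msmooth D (fun z => F z *m G z).
Proof.
move=> Fs Gs i j.
apply: (csmooth_congr oD (g := fun z => \sum_k F z i k * G z k j)) => [z _|].
  by rewrite mxE.
by apply: (csmooth_sum oD) => k; exact: (csmoothM oD).
Qed.

Lemma msmoothJ m n (F : C -> 'M[C]_(m, n)) : msmooth D F -> msmooth D (fun z => (F z)^t*).
Proof.
by move=> Fs i j; apply: (csmooth_congr oD _ (csmoothJ oD (Fs j i))) => z _; rewrite !mxE.
Qed.

Lemma msmoothZ m n g (F : C -> 'M[C]_(m, n)) : csmooth D g -> msmooth D F ->
  msmooth D (fun z => g z *: F z).
Proof.
by move=> gs Fs i j; apply: (csmooth_congr oD _ (csmoothM oD gs (Fs i j))) => z _; rewrite mxE.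
Qed.

Lemma msmoothN m n (F : C -> 'M[C]_(m, n)) : msmooth D F -> msmooth D (fun z => - F z).
Proof.
by move=> Fs i j; apply: (csmooth_congr oD _ (csmoothN oD (Fs i j))) => z _; rewrite mxE.
Qed.

Lemma msmooth_Mw s m n (F : C -> 'M[C]_(m, n)) : msmooth D F -> msmooth D (Mw s F).
Proof.
by move=> Fs i j; apply: (csmooth_congr oD _ (csmooth_Dw oD s (Fs i j))) => z _; rewrite mxE.
Qed.

Lemma Mw_congr s m n (F G : C -> 'M[C]_(m, n)) z : D z -> (forall y, D y -> F y = G y) ->
  Mw s F z = Mw s G z.
Proof.
by move=> Dz FG; apply/matrixP => i j; rewrite !mxE; apply: (Dw_congr oD) => // y /FG ->.
Qed.

Lemma Mw_cst s m n (A : 'M[C]_(m, n)) z : Mw s (fun=> A) z = 0.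
Proof. by apply/matrixP => i j; rewrite !mxE Dw_cst. Qed.

Lemma MwD s m n (F G : C -> 'M[C]_(m, n)) z : msmooth D F -> msmooth D G -> D z ->
  Mw s (fun y => F y + G y) z = Mw s F z + Mw s G z.
Proof.
move=> Fs Gs Dz; apply/matrixP => i j; rewrite !mxE -(DwD _ (Fs i j) (Gs i j) Dz).
by apply: (Dw_congr oD) => // y _; rewrite mxE.
Qed.

Lemma MwM s m n p (F : C -> 'M[C]_(m, n)) (G : C -> 'M[C]_(n, p)) z :
  msmooth D F -> msmooth D G -> D z ->
  Mw s (fun y => F y *m G y) z = Mw s F z *m G z + F z *m Mw s G z.
Proof.
move=> Fs Gs Dz; apply/matrixP => i j; rewrite !mxE.
rewrite (@Dw_congr _ D oD _ _ (fun y => \sum_k F y i k * G y k j))//; last by move=> y _; rewrite mxE.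
rewrite (Dw_sum oD)//; last by move=> k; exact: (csmoothM oD (Fs i k) (Gs k j)).
by rewrite -big_split; apply: eq_bigr => k _; rewrite !mxE (DwM _ (Fs i k) (Gs k j) Dz).
Qed.

Lemma MwJ s m n (F : C -> 'M[C]_(m, n)) z : msmooth D F -> D z ->
  Mw s (fun y => (F y)^t*) z = (Mw (Num.conj s) F z)^t*.
Proof.
move=> Fs Dz; apply/matrixP => i j; rewrite !mxE -(DwJ _ (Fs j i) Dz).
by apply: (Dw_congr oD) => // y _; rewrite !mxE.
Qed.

Lemma MwZ s m n g (F : C -> 'M[C]_(m, n)) z : csmooth D g -> msmooth D F -> D z ->
  Mw s (fun y => g y *: F y) z = Dw s g z *: F z + g z *: Mw s F z.
Proof.
move=> gs Fs Dz; apply/matrixP => i j; rewrite !mxE -(DwM _ gs (Fs i j) Dz).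
by apply: (Dw_congr oD) => // y _; rewrite !mxE.
Qed.

Lemma MwN s m n (F : C -> 'M[C]_(m, n)) z : msmooth D F -> D z ->
  Mw s (fun y => - F y) z = - Mw s F z.
Proof.
move=> Fs Dz; apply/matrixP => i j; rewrite !mxE -(DwN oD _ (Fs i j) Dz).
by apply: (Dw_congr oD) => // y _; rewrite !mxE.
Qed.

Lemma Mw_comm s s' m n (F : C -> 'M[C]_(m, n)) z : msmooth D F -> D z ->
  Mw s (Mw s' F) z = Mw s' (Mw s F) z.
Proof.
move=> Fs Dz; apply/matrixP => i j; rewrite !mxE.
rewrite (@Dw_congr _ D oD _ _ (Dw s' (fun y => F y i j)))//; last by move=> y _; rewrite mxE.
rewrite (Dw_comm oD _ _ (Fs i j) Dz); apply: (Dw_congr oD) => // y _; by rewrite mxE.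
Qed.

Lemma Mw_eq0_constant m n (F : C -> 'M[C]_(m, n)) : connected D -> msmooth D F ->
  (forall z, D z -> Mw (- 'i%C) F z = 0) -> (forall z, D z -> Mw 'i%C F z = 0) ->
  forall z0 z, D z0 -> D z -> F z = F z0.
Proof.
move=> cD Fs d1 d2 z0 z Dz0 Dz; apply/matrixP => i j.
apply: (Dw_eq0_constant oD cD (Fs i j) _ _ Dz0 Dz) => y Dy.
  by have /matrixP/(_ i j) := d1 y Dy; rewrite !mxE.
by have /matrixP/(_ i j) := d2 y Dy; rewrite !mxE.
Qed.

End MatrixWirtinger.

(** * Cube roots of unimodular functions *)

Section RealModulus.
Variable R : realType.
Local Notation C := R[i].
Implicit Types x y : C.

(** The norm on [R[i]] takes its values in [R[i]]; a modulus in [R] makes estimates accessible to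
    real arithmetic. *)
Definition nm x : R := Re `|x|.

Lemma nmE x : `|x| = (nm x)%:C.
Proof. by rewrite /nm RRe_real// normr_real. Qed.

Lemma nm_ge0 x : 0 <= nm x.
Proof. by rewrite -lecR -nmE normr_ge0. Qed.

Lemma nm_eq0 x : (nm x == 0) = (x == 0).
Proof.
apply/eqP/eqP => [h|->]; last by rewrite /nm normr0.
by apply: normr0_eq0; rewrite nmE h.
Qed.

Lemma nmD x y : nm (x + y) <= nm x + nm y.
Proof. by rewrite -lecR rmorphD /= -!nmE ler_normD. Qed.

Lemma nmM x y : nm (x * y) = nm x * nm y.
Proof. by have := normrM x y; rewrite !nmE -rmorphM => -[]. Qed.

Lemma nmN x : nm (- x) = nm x.
Proof. by rewrite /nm normrN. Qed.

Lemma nmB x y : nm (x - y) = nm (y - x).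
Proof. by rewrite -nmN opprB. Qed.

Lemma nm_real (r : R) : nm r%:C = `|r|.
Proof. by rewrite /nm normc_def /= expr0n addr0 sqrtr_sqr. Qed.

Lemma nm1 : nm 1 = 1. Proof. by rewrite /nm normr1. Qed.

Lemma nm_nat n : nm n%:R = n%:R.
Proof. by rewrite /nm normr_nat -[n%:R]/(n%:R) ; rewrite -(rmorph_nat (real_complex R)). Qed.

Lemma nmX x n : nm (x ^+ n) = nm x ^+ n.
Proof. by elim: n => [|n IH]; rewrite ?expr0 ?nm1// !exprS nmM IH. Qed.

Lemma nm_conj x : nm (Num.conj x) = nm x.
Proof. by rewrite /nm norm_conjC. Qed.

Lemma nm_unit x : nm x = 1 <-> x * Num.conj x = 1.
Proof.
rewrite -normCK nmE; split => [->|/eqP]; first by rewrite expr1n.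
rewrite -rmorphXn -(rmorph1 (real_complex R)) (inj_eq (@complexI R)).
by rewrite sqrf_eq1 => /orP[/eqP//|/eqP h]; have := nm_ge0 x; rewrite h oppr_ge0 ler10.
Qed.

Lemma Re_le_nm x : `|Re x| <= nm x.
Proof. by rewrite -lecR -nmE normc_ge_Re. Qed.

Lemma Im_le_nm x : `|Im x| <= nm x.
Proof. by rewrite -lecR -nmE norm_ge_Im. Qed.

Lemma nm_le_ReIm x : nm x <= `|Re x| + `|Im x|.
Proof. by rewrite -lecR -nmE norm_le_ReIm. Qed.

End RealModulus.

Section CubeRoot.
Variable R : realType.
Local Notation C := R[i].
Implicit Types x y : C.

(* Near [1] the factor [y^2 + y y' + y'^2] of [y^3 - y'^3] is within [7/3] of [3]. *)
Lemma cube_expanding y y' : nm (y - 1) <= 3^-1 -> nm (y' - 1) <= 3^-1 ->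
  2/3 * nm (y - y') <= nm (y ^+ 3 - y' ^+ 3).
Proof.
move=> h h'.
have -> : y ^+ 3 - y' ^+ 3 = (y - y') * (y ^+ 2 + y * y' + y' ^+ 2) by ring.
rewrite nmM mulrC ler_wpM2l ?nm_ge0//.
have prod (a b : C) : nm (a - 1) <= 3^-1 -> nm (b - 1) <= 3^-1 -> nm (a * b - 1) <= 7/9.
  move=> ha hb; have -> : a * b - 1 = (a - 1) * (b - 1) + ((a - 1) + (b - 1)) by ring.
  have := nmD ((a - 1) * (b - 1)) ((a - 1) + (b - 1)); have := nmD (a - 1) (b - 1).
  rewrite nmM; have := nm_ge0 (a - 1); have := nm_ge0 (b - 1).
  move: ha hb; move: (nm (a - 1)) (nm (b - 1)) (nm _) (nm _) => p q r s; nra.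
have E : 3 = (y ^+ 2 + y * y' + y' ^+ 2) - ((y * y - 1) + (y * y' - 1) + (y' * y' - 1)) by ring.
have := nmD (y ^+ 2 + y * y' + y' ^+ 2) (- ((y * y - 1) + (y * y' - 1) + (y' * y' - 1))).
rewrite -E nmN nm_nat.
have := nmD ((y * y - 1) + (y * y' - 1)) (y' * y' - 1); have := nmD (y * y - 1) (y * y' - 1).
have := prod _ _ h h; have := prod _ _ h h'; have := prod _ _ h' h'.
move: (nm _) (nm _) (nm _) (nm (y * y - 1 + _)) (nm (y * y - 1 + _ + _)) (nm _) => a b c d e f; lra.
Qed.

Lemma cube_inj_near1 y y' : nm (y - 1) <= 3^-1 -> nm (y' - 1) <= 3^-1 ->
  y ^+ 3 = y' ^+ 3 -> y = y'.
Proof.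
move=> h h' E; have := cube_expanding h h'; rewrite E subrr (_ : nm 0 = 0); last first.
  by apply/eqP; rewrite nm_eq0.
move=> le0; apply/eqP; rewrite -subr_eq0 -nm_eq0 eq_le nm_ge0 andbT.
by move: le0; move: (nm _) => a; lra.
Qed.

(** With [w] a primitive cube root of unity, x - 1 = (y - 1)(y - w)(y - w^2) for any cube root [y]
    of [x]. If every factor had modulus at least 1/9, the product would have modulus at least 1/729.
    So [y] is close to some cube root of unity, and dividing by it gives the root near 1. *)
Lemma cube_root_near1 x : nm (x - 1) < 729^-1 ->
  exists y, y ^+ 3 = x /\ nm (y - 1) < 9^-1.
Proof.
move=> x1; pose y := 3.-root x; have yx : y ^+ 3 = x by rewrite rootCK.
have [w w1 w3] : exists2 w : C, w != 1 & w ^+ 2 + w + 1 = 0.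
  pose d : C := sqrtC (-3); have d2 : d ^+ 2 = -3 by rewrite sqrtCK.
  have n2 : (2 : C) != 0 by rewrite pnatr_eq0.
  have wE : (((-1 + d) / 2) ^+ 2 + ((-1 + d) / 2) + 1 = 0 :> C).
    have -> : ((-1 + d) / 2) ^+ 2 + ((-1 + d) / 2) + 1 = (d ^+ 2 + 3) / 4 by field.
    by rewrite d2 addNr mul0r.
  exists ((-1 + d) / 2) => //; apply/eqP => e; move: wE; rewrite e expr1n => /eqP.
  by rewrite (_ : 1 + 1 + 1 = 3%:R) ?pnatr_eq0//; ring.
have w31 : w ^+ 3 = 1.
  by apply/eqP; rewrite -subr_eq0 -[X in _ == X](mulr0 (w - 1)) -w3; apply/eqP; ring.
have nw : nm w = 1.
  have := congr1 (@nm R) w31; rewrite nmX nm1 => /eqP.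
  by rewrite pexpr_eq1 ?nm_ge0// => /eqP.
have E : x - 1 = (y - 1) * (y - w) * (y - w ^+ 2).
  rewrite -yx; apply/eqP; rewrite -subr_eq0; apply/eqP.
  have -> : y ^+ 3 - 1 - (y - 1) * (y - w) * (y - w ^+ 2) =
     (y ^+ 2 - y * w) * (w ^+ 2 + w + 1) + (w ^+ 3 - 1) by ring.
  by rewrite w3 w31 subrr mulr0 addr0.
have cube v : v ^+ 3 = 1 -> nm v = 1 -> nm (y - v) < 9^-1 ->
    exists y, y ^+ 3 = x /\ nm (y - 1) < 9^-1.
  (* Since [v ^+ 3 = 1], the witness is the quotient of [y] by [v]. *)
  move=> v3 nv hv; exists (y * v ^+ 2); split.
    by rewrite exprMn yx -exprM mulnC exprM v3 expr1n mulr1.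
  have -> : y * v ^+ 2 - 1 = (y - v) * v ^+ 2 by rewrite mulrBl -exprS v3.
  by rewrite nmM nmX nv expr1n mulr1.
have [h1|h1] := ltP (nm (y - 1)) 9^-1; first by apply: (cube 1) => //; rewrite ?expr1n ?nm1.
have [h2|h2] := ltP (nm (y - w)) 9^-1; first by apply: (cube w).
have [h3|h3] := ltP (nm (y - w ^+ 2)) 9^-1.
  by apply: (cube (w ^+ 2)) => //; rewrite ?nmX ?nw ?expr1n// -exprM mulnC exprM w31 expr1n.
move: x1; rewrite E !nmM; move: h1 h2 h3.
move: (nm _) (nm _) (nm _) => a b c ha hb hc; rewrite ltNge => /negP[].
have -> : (729^-1 : R) = 9^-1 * 9^-1 * 9^-1 by field.
by rewrite !ler_pM// ?mulr_ge0 ?invr_ge0.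
Qed.

(** A principal branch near 1; the default [0] is taken only when no such root exists. *)
Definition croot x : C := xget 0 [set y | y ^+ 3 = x /\ nm (y - 1) < 9^-1].

Lemma crootP x : nm (x - 1) < 729^-1 -> croot x ^+ 3 = x /\ nm (croot x - 1) < 9^-1.
Proof. by move=> /cube_root_near1[y yP]; rewrite /croot; case: xgetP => [z -> //|/(_ y)]. Qed.

(** Both sides have the same cube, and a product of two numbers within 1/9 of 1 is within 19/81 of
    1. This is below 1/3, where cubing is injective; hence the choice of 1/9. *)
Lemma crootM a b : nm (a - 1) < 729^-1 -> nm (b - 1) < 729^-1 -> nm (a * b - 1) < 729^-1 ->
  croot (a * b) = croot a * croot b.
Proof.
move=> /crootP[a3 a1] /crootP[b3 b1] /crootP[c3 c1].
apply: cube_inj_near1; last by rewrite exprMn a3 b3 c3.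
  by apply: le_trans (ltW c1) _; lra.
have -> : croot a * croot b - 1 = (croot a - 1) * (croot b - 1) + ((croot a - 1) + (croot b - 1)) by ring.
have := nmD ((croot a - 1) * (croot b - 1)) ((croot a - 1) + (croot b - 1)).
have := nmD (croot a - 1) (croot b - 1).
rewrite nmM; have := nm_ge0 (croot a - 1); have := nm_ge0 (croot b - 1).
move: a1 b1; move: (nm _) (nm _) (nm _) (nm _) => p q r s; nra.
Qed.

Lemma croot_lipschitz a b : nm (a - 1) < 729^-1 -> nm (b - 1) < 729^-1 ->
  nm (croot a - croot b) <= 3/2 * nm (a - b).
Proof.
move=> /crootP[a3 a1] /crootP[b3 b1].
have := @cube_expanding (croot a) (croot b); rewrite a3 b3 => h.
have : 2/3 * nm (croot a - croot b) <= nm (a - b).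
  by apply: h; [apply: le_trans (ltW a1) _|apply: le_trans (ltW b1) _]; lra.
by move: (nm _) (nm _) => p q; lra.
Qed.

End CubeRoot.

(** * Continuity by real and imaginary parts *)

Section RIcontinuity.
Variable R : realType.
Local Notation C := R[i].
Variable T : topologicalType.
Implicit Types (f g : T -> C) (z : T).

(** The domain [T] is arbitrary because the notion serves both on the plane and along the real
    parameter of a coordinate line. *)
Definition RIcont f z :=
  {for z, continuous (fun t => Re (f t))} /\ {for z, continuous (fun t => Im (f t))}.

Lemma RIcontP f z : RIcont f z <->
  forall e : R, 0 < e -> nbhs z [set t | nm (f t - f z) < e].
Proof.
split=> [[f1 f2] e e0|fc].
  have e2 : 0 < e / 2 by rewrite divr_gt0.
  have {}f1 := f1 _ (nbhsx_ballx (Re (f z)) _ e2).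
  have {}f2 := f2 _ (nbhsx_ballx (Im (f z)) _ e2).
  apply: (@filterS2 _ (nbhs z) _ _ _ _ _ f1 f2) => t; rewrite /ball /= => t1 t2.
  apply: le_lt_trans (nm_le_ReIm _) _; rewrite !ReIm [ltRHS]splitr.
  by rewrite -(distrC (Re (f z))) -(distrC (Im (f z))) ltrD.
by split=> P /nbhs_ballP[e /= e0 eP]; apply: (@filterS _ (nbhs z) _ _ _ _ (fc e e0)) => t /= tz;
  apply: eP; rewrite /ball /= distrC; apply: le_lt_trans tz;
  [rewrite -Re_opp -Re_add; exact: Re_le_nm|rewrite -Im_opp -Im_add; exact: Im_le_nm].
Qed.

Lemma RIcont_cst (c : C) z : RIcont (fun=> c) z.
Proof. by split; exact: cst_continuous. Qed.

Lemma RIcontM f g z : RIcont f z -> RIcont g z -> RIcont (fun t => f t * g t) z.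
Proof.
move=> [f1 f2] [g1 g2]; split.
  rewrite (_ : (fun t => _) = (fun t => Re (f t) * Re (g t) - Im (f t) * Im (g t))).
    exact: continuousB (continuousM f1 g1) (continuousM f2 g2).
  by apply/funext => t; rewrite ReIm.
rewrite (_ : (fun t => _) = (fun t => Re (f t) * Im (g t) + Im (f t) * Re (g t))).
  exact: continuousD (continuousM f1 g2) (continuousM f2 g1).
by apply/funext => t; rewrite ReIm.
Qed.

Lemma RIcont_congr f g z : (\near z, f z = g z) -> RIcont f z -> RIcont g z.
Proof.
move=> fg [f1 f2]; split.
  apply: continuous_congr f1; apply: (@filterS _ (nbhs z) _ _ _ _ fg) => t; exact: congr1.
apply: continuous_congr f2; apply: (@filterS _ (nbhs z) _ _ _ _ fg) => t; exact: congr1.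
Qed.

Lemma RIcont_prod (I : Type) (r : seq I) (P : pred I) (f : I -> T -> C) z :
  (forall i, P i -> RIcont (f i) z) -> RIcont (fun t => \prod_(i <- r | P i) f i t) z.
Proof.
move=> fc; elim: r => [|i r IH].
  by apply: RIcont_congr (RIcont_cst 1 z); apply: (@filterE _ (nbhs z)) => t; rewrite big_nil.
case Pi : (P i).
  apply: RIcont_congr (RIcontM (fc i Pi) IH).
  by apply: (@filterE _ (nbhs z)) => t; rewrite big_cons Pi.
by apply: RIcont_congr IH; apply: (@filterE _ (nbhs z)) => t; rewrite big_cons Pi.
Qed.

End RIcontinuity.

Lemma prod_pairs (K : comNzRingType) (F : nat -> K) m :
  \prod_(0 <= k < m.*2) F k = \prod_(0 <= k < m) (F k.*2 * F k.*2.+1).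
Proof.
elim: m => [|m IH]; first by rewrite !big_geq.
by rewrite doubleS !big_nat_recr//= IH mulrA.
Qed.

Lemma telescope_prod (K : fieldType) (F : nat -> K) m : (forall k, (k <= m)%N -> F k != 0) ->
  \prod_(0 <= k < m) (F k / F k.+1) = F 0%N / F m.
Proof.
elim: m => [|m IH] F0; first by rewrite big_geq ?divff ?F0.
rewrite big_nat_recr//= IH ?mulrA ?divfK ?F0// => k km.
by apply: F0; exact: leqW.
Qed.

(** * Continuous cube roots on a contractible open set *)

Section ContinuousCubeRoot.
Variable R : realType.
Local Notation C := R[i].
Variables (D : set C) (h : R * C -> C) (c : C) (g : C -> C).
Hypothesis oD : open D.
Hypothesis Dc : D c.
Hypothesis hcont : {within `[0, 1] `*` D, continuous h}.
Hypothesis hD : forall (t : R) z, 0 <= t <= 1 -> D z -> D (h (t, z)).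
Hypothesis h01 : forall z, D z -> h (0, z) = z /\ h (1, z) = c.
Hypothesis gcont : forall z, D z -> {for z, continuous g}.
Hypothesis g1 : forall z, D z -> nm (g z) = 1.

Let G t z := g (h (t, z)).

Let nmG (t : R) z : 0 <= t <= 1 -> D z -> nm (G t z) = 1.
Proof. by move=> t01 Dz; apply/g1/hD. Qed.

Let G0 (t : R) z : 0 <= t <= 1 -> D z -> G t z != 0.
Proof. by move=> t01 Dz; rewrite -nm_eq0 nmG// oner_eq0. Qed.

Let G_near (t : R) z (e : R) : 0 <= t <= 1 -> D z -> 0 < e -> exists2 d : R, 0 < d &
  forall (s : R) y, 0 <= s <= 1 -> D y -> `|s - t| < d -> `|Re y - Re z| < d -> `|Im y - Im z| < d ->
    nm (G s y - G t z) < e.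
Proof.
move=> t01 Dz e0.
have Kt : (`[0, 1] `*` D) (t, z) by split => //=; rewrite in_itv.
have hc := ((subspace_continuousP _ _).1 hcont) _ Kt.
have gP : nbhs (h (t, z)) [set y | nm (g y - G t z) < e].
  have gz := gcont (hD t01 Dz).
  have rg : RIcont g (h (t, z)).
    split.
      exact: (@continuous_comp _ _ _ g (@complex.Re R) _ gz (@Re_continuous R _)).
    exact: (@continuous_comp _ _ _ g (@complex.Im R) _ gz (@Im_continuous R _)).
  exact: (RIcontP _ _).1 rg e e0.
have [[U V] /= [/nbhs_ballP[d1 /= d10 U1] /nbhs_box[d2 d20 V2]] UV] := hc _ gP.
exists (Num.min d1 d2); first by rewrite lt_min d10.
move=> s y s01 Dy; rewrite !lt_min => /andP[s1 _] /andP[_ y2] /andP[_ y3].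
have Us : U s by apply: U1; rewrite /ball /= distrC.
have Vy : V y by apply: V2.
by apply: (UV (s, y)) => //; split => //=; rewrite in_itv.
Qed.

(* Along [t |-> g (h (t, z))] a subdivision into [2 ^ n] steps that is fine at [z] has
   consecutive ratios close to [1], which have a principal cube root [croot]; the product of
   these roots does not change under refinement, so it is locally continuous in [z]. *)
Let fine z n := forall s t : R, 0 <= s <= 1 -> 0 <= t <= 1 -> `|s - t| <= (2 ^ n)%:R^-1 ->
  nm (G s z / G t z - 1) < 729^-1.

Let fineS z n : fine z n -> fine z n.+1.
Proof.
move=> fz s t s01 t01 st; apply: fz => //; apply: le_trans st _.
rewrite lef_pV2 ?posrE ?ltr0n ?expn_gt0//.
by rewrite ler_nat leq_exp2l.
Qed.

(** Continuity at each [(t, z)] gives a step size valid near [t] and [z]; compactness of the unit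
    interval makes it uniform in [t], so one depth serves a whole neighbourhood of [z]. *)
Let fine_near z : D z -> exists n,
  nbhs z [set y | D y -> forall m, (n <= m)%N -> fine y m].
Proof.
move=> Dz; have e0 : 0 < 729^-1 / 2 :> R by lra.
pose d (n : nat) : R := n.+1%:R^-1.
have d0 n : 0 < d n by rewrite invr_gt0.
have dle m n : (n <= m)%N -> d m <= d n.
  by move=> nm; rewrite /d lef_pV2 ?posrE// ler_nat.
have dlt (e : R) : 0 < e -> exists n, d n < e.
  move=> e1; exists (Num.truncn e^-1).
  rewrite /d -[ltRHS]invrK ltf_pV2 ?posrE ?invr_gt0//.
  by rewrite truncnS_gt.
pose P (n : nat) (t : R) := 0 <= t <= 1 -> forall (s : R) y, 0 <= s <= 1 -> D y -> `|s - t| < d n ->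
  `|Re y - Re z| < d n -> `|Im y - Im z| < d n -> nm (G s y / G t y - 1) < 729^-1.
have cov := (compact_near_coveringP _).1 (@segment_compact R 0 1).
have [|N _ NP] := cov nat \oo P _.
  move=> t; rewrite /= in_itv /= => t01.
  have [e e1 eG] := G_near t01 Dz e0.
  have [n ne] : exists n, d n < e / 2 by apply: dlt; rewrite divr_gt0.
  exists ([set s : R | `|s - t| < d n], [set m | (n <= m)%N]).
    split => /=; last by exists n.
    by apply/nbhs_ballP; exists (d n) => //= s; rewrite /ball /= distrC.
  move=> [x m] /= [xt nm'] x01 s y s01 Dy sx y1 y2.
  have mn := dle _ _ nm'.
  have de : d n < e by apply: lt_trans ne _; rewrite ltr_pdivrMr// mulr_natr mulr2n ltrDl.
  have y1' : `|Re y - Re z| < e by apply: lt_trans de; apply: lt_le_trans y1 mn.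
  have y2' : `|Im y - Im z| < e by apply: lt_trans de; apply: lt_le_trans y2 mn.
  have sG : nm (G s y - G t z) < 729^-1 / 2.
    apply: eG => //; apply: le_lt_trans (ler_distD x _ _) _.
    rewrite [ltRHS]splitr; apply: ltrD; last exact: lt_trans xt ne.
    by apply: lt_trans ne; apply: lt_le_trans sx mn.
  have xG : nm (G x y - G t z) < 729^-1 / 2.
    by apply: eG => //; exact: lt_trans xt de.
  (* Both values are compared with [G t z], and division by the unimodular [G x y] leaves the
     modulus of the difference unchanged. *)
  have -> : G s y / G x y - 1 = ((G s y - G t z) + (G t z - G x y)) * (G x y)^-1.
    by rewrite addrA subrK mulrBl divff ?G0.
  have nV : nm (G x y)^-1 = 1.
    apply: (mulfI (x := nm (G x y))); first by rewrite nmG// oner_eq0.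
    by rewrite -nmM divff ?G0// nm1 nmG// mulr1.
  rewrite nmM nV mulr1; apply: le_lt_trans (nmD _ _) _.
  rewrite (nmB (G t z)).
  by move: sG xG; move: (nm _) (nm _) => a b; lra.
(* For [m] above [N] a step of length 1/2^m is shorter than [d N], because m < 2^m. *)
exists N.+1; apply/nbhs_box; exists (d N) => // y y1 y2 Dy m Nm s t s01 t01 st.
apply: (NP N (leqnn N) t) => //=.
apply: le_lt_trans st _; rewrite /d ltf_pV2 ?posrE ?ltr0n ?expn_gt0// ltr_nat.
by apply: leq_ltn_trans Nm _; exact: ltn_expl.
Qed.

Let p n k : R := k%:R / (2 ^ n)%:R.

Let p01 n k : (k <= 2 ^ n)%N -> 0 <= p n k <= 1.
Proof.
move=> kn; rewrite /p divr_ge0//= ler_pdivrMr ?ltr0n ?expn_gt0// mul1r.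
by rewrite ler_nat.
Qed.

Let p_step n k : `|p n k - p n k.+1| <= (2 ^ n)%:R^-1.
Proof.
by rewrite /p -mulrBl -natr1 opprD addNKr mulN1r normrN ger0_norm ?invr_ge0.
Qed.

Let p_double n k : p n.+1 k.*2 = p n k.
Proof.
rewrite /p expnS -mul2n !natrM invfM mulrACA divff ?mul1r// pnatr_eq0.
Qed.

Let ratio n z k := G (p n k) z / G (p n k.+1) z.

Let ratio_near n z k : fine z n -> (k < 2 ^ n)%N -> nm (ratio n z k - 1) < 729^-1.
Proof. by move=> fz kn; apply: fz (p_step n k); apply: p01 => //; exact: ltnW. Qed.

(** The ratios telescope to the quotient of [g z] by [g c], since the path runs from [z] to the
    fixed point [c]. The constant factor in front restores [g c], so the cube is [g z]. *)
Let Q n z := 3.-root (g c) * \prod_(0 <= k < 2 ^ n) croot (ratio n z k).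

Let Q_cube n z : D z -> fine z n -> Q n z ^+ 3 = g z.
Proof.
move=> Dz fz; rewrite exprMn rootCK// -prodrXl.
rewrite (eq_big_nat _ _ (F2 := ratio n z)); last first.
  by move=> k /andP[_ kn]; have [] := crootP (ratio_near fz kn).
rewrite (telescope_prod (F := fun k => G (p n k) z)); last first.
  by move=> k kn; apply: G0 => //; exact: p01.
have -> : p n 0 = 0 by rewrite /p mul0r.
have -> : p n (2 ^ n) = 1 by rewrite /p divff// pnatr_eq0 expn_eq0.
rewrite /G; have [-> ->] := h01 Dz.
by rewrite mulrC divfK// -nm_eq0 g1// oner_eq0.
Qed.

(** Halving the steps splits each ratio into a product of two; all three numbers are near 1, so
    [crootM] applies factor by factor. *)
Let QS n z : D z -> fine z n -> Q n.+1 z = Q n z.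
Proof.
move=> Dz fz; rewrite /Q expnS mul2n prod_pairs; congr (_ * _).
apply: eq_big_nat => k /andP[_ kn].
have kn2 : (k.*2.+1 < 2 ^ n.+1)%N by rewrite expnS mul2n -doubleS leq_double.
have E : ratio n z k = ratio n.+1 z k.*2 * ratio n.+1 z k.*2.+1.
  rewrite /ratio -doubleS !p_double mulrA divfK// G0// p01//; exact: ltnW.
have kn1 := ltnW kn2.
have := ratio_near fz kn; rewrite E => c3.
have a1 := ratio_near (fineS fz) kn1; have a2 := ratio_near (fineS fz) kn2.
by rewrite (crootM a1 a2 c3).
Qed.

Let fine_le z n m : (n <= m)%N -> fine z n -> fine z m.
Proof. by move=> /subnK <-; elim: (m - n)%N => [|k IH] fz //; apply: fineS; exact: IH. Qed.

Let Q_le z n m : D z -> (n <= m)%N -> fine z n -> Q m z = Q n z.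
Proof.
move=> Dz /subnK <- fz; elim: (m - n)%N => [|k IH] //.
by rewrite addSn QS//; exact: (fine_le (leq_addl k n) fz).
Qed.

Let Q_unique z n m : D z -> fine z n -> fine z m -> Q n z = Q m z.
Proof.
move=> Dz fn fm.
by rewrite -(Q_le Dz (leq_maxl n m) fn) (Q_le Dz (leq_maxr n m) fm).
Qed.

Let Q_cont n z : D z -> nbhs z [set y | D y -> fine y n] -> RIcont (Q n) z.
Proof.
move=> Dz nf; have nD : nbhs z D by exact: open_nbhs_nbhs.
have fz : fine z n by have /nbhs_box[e e0 eP] := nf; apply: eP; rewrite ?subrr ?normr0.
apply: RIcontM; first exact: RIcont_cst.
under eq_fun do rewrite big_nat.
apply: RIcont_prod => k /andP[_ kn]; apply/RIcontP => e e0.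
have k1 := p01 (ltnW kn); have k2 := p01 kn.
have rc : RIcont (fun y => ratio n y k) z.
  have Gc t : 0 <= t <= 1 -> RIcont (G t) z.
    move=> t01; apply/RIcontP => e' e'0; have [d d0 dG] := G_near t01 Dz e'0.
    have nb : nbhs z [set y | `|Re y - Re z| < d /\ `|Im y - Im z| < d].
      by apply/nbhs_box; exists d.
    apply: (@filterS2 _ (nbhs z) _ _ _ _ _ nb nD) => y [y1 y2] Dy.
    by apply: dG => //; rewrite subrr normr0.
  have Gj t : 0 <= t <= 1 -> RIcont (fun y => Num.conj (G t y)) z.
    move=> t01; apply/RIcontP => e' e'0; apply: (@filterS _ (nbhs z) _ _ _ _ ((RIcontP _ _).1 (Gc t t01) e' e'0)).
    by move=> y /=; rewrite -rmorphB nm_conj.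
  (* As [G] is unimodular, the quotient equals a product with a conjugate. *)
  apply: RIcont_congr (RIcontM (Gc _ k1) (Gj _ k2)).
  apply: (@filterS _ (nbhs z) _ _ _ _ nD) => y Dy; rewrite /ratio; congr (_ * _).
  apply: (mulfI (G0 k2 Dy)); rewrite mulfV ?G0//; apply/nm_unit; exact: nmG.
have e1 : 0 < 2/3 * e by rewrite mulr_gt0.
have := (RIcontP _ _).1 rc _ e1.
move=> H; have H2 : nbhs z [set y | D y /\ fine y n].
  by apply: (@filterS2 _ (nbhs z) _ _ _ _ _ nD nf) => y Dy /(_ Dy).
apply: (@filterS2 _ (nbhs z) _ _ _ _ _ H H2) => y /= hy [Dy fy].
apply: le_lt_trans (croot_lipschitz (ratio_near fy kn) (ratio_near fz kn)) _.
by move: hy; move: (nm _) => a; lra.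
Qed.

Lemma continuous_cube_root :
  exists r : C -> C, forall z, D z -> r z ^+ 3 = g z /\ RIcont r z.
Proof.
(* The depth chosen at [z] may jump as [z] moves; [Q_unique] replaces it by a depth that is valid on
   a neighbourhood. *)
pose r z := Q (xget 0%N [set n | fine z n]) z.
have rE z n : D z -> fine z n -> r z = Q n z.
  move=> Dz fz; rewrite /r; case: xgetP => [m -> fm|/(_ n)//]; exact: Q_unique.
exists r => z Dz; have [n nb] := fine_near Dz.
have nD : nbhs z D by exact: open_nbhs_nbhs.
have fz : fine z n.
  by have /nbhs_box[e e0 eP] := nb; apply: eP; rewrite ?subrr ?normr0.
split; first by rewrite (rE z n)// Q_cube.
have nf : nbhs z [set y | D y -> fine y n].
  by apply: (@filterS _ (nbhs z) _ _ _ _ nb) => y /= H Dy; exact: H.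
apply: RIcont_congr (Q_cont Dz nf).
by apply: (@filterS2 _ (nbhs z) _ _ _ _ _ nD nf) => y Dy /(_ Dy) fy; rewrite (rE y n).
Qed.

End ContinuousCubeRoot.

(** * Smoothness of continuous cube roots *)

Section SmoothCubeRoot.
Variable R : realType.
Local Notation C := R[i].

Lemma RIcontD (T : topologicalType) (f g : T -> C) z :
  RIcont f z -> RIcont g z -> RIcont (fun t => f t + g t) z.
Proof.
move=> [f1 f2] [g1 g2]; split.
  rewrite (_ : (fun t => _) = (fun t => Re (f t) + Re (g t))).
    exact: continuousD f1 g1.
  by apply/funext => t; rewrite ReIm.
rewrite (_ : (fun t => _) = (fun t => Im (f t) + Im (g t))).
  exact: continuousD f2 g2.
by apply/funext => t; rewrite ReIm.
Qed.

Lemma RIcontV (T : topologicalType) (f : T -> C) z :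
  f z != 0 -> RIcont f z -> RIcont (fun t => (f t)^-1) z.
Proof.
move=> fz0 [f1 f2].
pose n t := Re (f t) * Re (f t) + Im (f t) * Im (f t).
have nc : {for z, continuous n}.
  exact: continuousD (continuousM f1 f1) (continuousM f2 f2).
have n0 : n z != 0 by rewrite gt_eqF// /n -!expr2; exact: normc2_gt0.
have nV : {for z, continuous (fun t => (n t)^-1)} by exact: continuousV.
have E t : (f t)^-1 = Num.conj (f t) * ((n t)^-1)%:C.
  have [->|ft0] := eqVneq (f t) 0; first by rewrite invr0 rmorph0 mul0r.
  apply: (mulfI ft0); rewrite mulfV// mulrA normc2E -rmorphM /= /n -!expr2 divff//.
  by rewrite gt_eqF// normc2_gt0.
split.
  rewrite (_ : (fun t => _) = (fun t => Re (f t) * (n t)^-1)).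
    exact: continuousM f1 nV.
  by apply/funext => t; rewrite E !ReIm mulr0 subr0.
rewrite (_ : (fun t => _) = (fun t => - Im (f t) * (n t)^-1)).
  exact: continuousM (continuousN f2) nV.
by apply/funext => t; rewrite E !ReIm mulr0 add0r.
Qed.

(** A derivative as the value of a continuous slope function: slopes can be divided, so a root is
    differentiated without an inverse function theorem. *)
Lemma cder_caratheodory (g : R -> C) t a : cder g t a <->
  exists p : R -> C, [/\ forall s, g s - g t = p s * (s - t)%:C, RIcont p t & p t = a].
Proof.
split=> [[/is_derive1_caratheodory[p1 [e1 c1 v1]] /is_derive1_caratheodory[p2 [e2 c2 v2]]]|].
  exists (fun s => p1 s +i* p2 s); split.
  - by move=> s; apply: complexP; rewrite !ReIm /= ?e1 ?e2 mulr0 ?subr0 ?add0r.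
  - by split.
  - by apply: complexP; rewrite /= ?v1 ?v2.
move=> [p [e [c1 c2] v]]; split; apply/is_derive1_caratheodory.
  exists (fun s => Re (p s)); split => //; last by rewrite v.
  by move=> s; rewrite -Re_opp -Re_add e !ReIm mulr0 subr0.
exists (fun s => Im (p s)); split => //; last by rewrite v.
by move=> s; rewrite -Im_opp -Im_add e !ReIm mulr0 add0r.
Qed.

(** Factoring the difference of two cubes shows that the slope of [r] is the slope of [g] divided by
    [den]. Continuity of [r] makes [den] continuous, with the non-zero value 3 r(t)^2 at [t]. *)
Lemma cder_cube_root (r g : R -> C) t a : RIcont r t -> r t != 0 ->
  (\forall s \near t, r s ^+ 3 = g s) -> cder g t a -> cder r t (a / (3 * r t ^+ 2)).
Proof.
move=> rc rt0 rg /cder_caratheodory[p [pE pc pt]].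
pose den s := r s * r s + r s * r t + r t * r t.
have denc : RIcont den t.
  apply: RIcontD; last exact: RIcont_cst.
  by apply: RIcontD; apply: RIcontM => //; exact: RIcont_cst.
have dent : den t = 3 * r t ^+ 2 by rewrite /den; ring.
have dent0 : den t != 0 by rewrite dent mulf_neq0 ?expf_neq0// pnatr_eq0.
have den_near : \forall s \near t, den s != 0.
  have n0 : 0 < nm (den t) by rewrite lt_neqAle nm_ge0 andbT eq_sym nm_eq0.
  have := (RIcontP _ _).1 denc _ n0; apply: filterS => s /= h.
  by apply/eqP => d0; move: h; rewrite d0 sub0r nmN ltxx.
apply/cder_caratheodory.
exists (fun s => if s == t then a / den t else (r s - r t) / (s - t)%:C); split.
- move=> s; case: eqP => [->|/eqP st]; first by rewrite !subrr mulr0.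
  rewrite divfK// eq_complex /= subr_eq0 eqxx andbT; exact: st.
- apply: RIcont_congr (RIcontM pc (RIcontV dent0 denc)).
  have rgt := nbhs_singleton rg.
  near=> s; case: eqP => [->|/eqP st]; first by rewrite pt.
  have st0 : (s - t)%:C != 0 :> C by rewrite eq_complex /= subr_eq0 eqxx andbT; exact: st.
  have ds : den s != 0 by near: s.
  apply: (mulIf ds); rewrite divfK//; apply: (mulIf st0).
  rewrite -pE mulrAC divfK//.
  have <- : r s ^+ 3 = g s by near: s.
  by rewrite -rgt /den; ring.
- by rewrite eqxx dent.
Unshelve. all: by end_near. Qed.

Variable D : set C.
Hypothesis oD : open D.

Definition class_cC n (g : C -> C) :=
  class_C n D (fun z => Re (g z)) /\ class_C n D (fun z => Im (g z)).

Lemma class_cCM n g h : class_cC n g -> class_cC n h -> class_cC n (fun z => g z * h z).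
Proof.
have NN u : class_C n D u -> class_C n D (fun z => - u z).
  move=> uC; apply: (class_C_congr oD _ (class_CM oD (class_C_cst n D (-1)) uC)).
  by move=> z _; rewrite mulN1r.
move=> [g1 g2] [h1 h2]; split.
  apply: (class_C_congr oD _ (class_CD oD (class_CM oD g1 h1) (NN _ (class_CM oD g2 h2)))).
  by move=> z _; rewrite ReIm.
apply: (class_C_congr oD _ (class_CD oD (class_CM oD g1 h2) (class_CM oD g2 h1))).
by move=> z _; rewrite ReIm.
Qed.

Lemma class_cCJ n g : class_cC n g -> class_cC n (fun z => Num.conj (g z)).
Proof.
move=> [g1 g2]; split.
  by apply: (class_C_congr oD _ g1) => z _; rewrite ReIm.
apply: (class_C_congr oD _ (class_CM oD (class_C_cst n D (-1)) g2)).
by move=> z _; rewrite mulN1r ReIm.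
Qed.

(** Since [r] is unimodular, its inverse is its conjugate and each partial derivative is a third of
    that of [g] times conj(r)^2. This is of the same class as [r], and the bootstrap applies. *)
Lemma csmooth_cube_root g r : csmooth D g -> (forall z, D z -> nm (g z) = 1) ->
  (forall z, D z -> r z ^+ 3 = g z /\ RIcont r z) -> csmooth D r.
Proof.
move=> gs g1 rP.
have nr z : D z -> nm (r z) = 1.
  move=> Dz; have := g1 z Dz; have [<- _] := rP z Dz; rewrite nmX => /eqP.
  by rewrite pexpr_eq1 ?nm_ge0// => /eqP.
have rd b z : D z -> cder (fun t => r (line b z t)) (coor b z)
    (3^-1 * (cpd b g z * (Num.conj (r z) * Num.conj (r z)))).
  move=> Dz; have [_ [r1 r2]] := rP z Dz.
  have rc : RIcont (fun t => r (line b z t)) (coor b z).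
    have lc := @line_continuous R b z (coor b z).
    by split; [apply: (@continuous_comp _ _ _ (line b z) (fun y => Re (r y)))
              |apply: (@continuous_comp _ _ _ (line b z) (fun y => Im (r y)))] => //;
       rewrite line_coor.
  have r0 : r (line b z (coor b z)) != 0 by rewrite line_coor -nm_eq0 nr// oner_eq0.
  have rg : \forall s \near coor b z, r (line b z s) ^+ 3 = g (line b z s).
    have nb : nbhs z [set y | r y ^+ 3 = g y].
      by apply: (@filterS _ (nbhs z) _ _ _ _ (open_near oD Dz)) => y /rP[].
    exact: (near_line b nb).
  have := cder_cube_root rc r0 rg (csmooth_cder b gs Dz); rewrite line_coor.
  rewrite line_coor in r0.
  have /nm_unit rr := nr z Dz.
  suff -> : cpd b g z / (3 * r z ^+ 2) =
    3^-1 * (cpd b g z * (Num.conj (r z) * Num.conj (r z))) by [].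
  have -> : Num.conj (r z) = (r z)^-1 by apply: (mulfI r0); rewrite rr divff.
  by field.
have key n : class_cC n r.
  elim: n => [|n [i1 i2]].
    by split; split => // z Dz; have [_ []] := rP z Dz.
  have dn b : class_cC n (fun z => 3^-1 * (cpd b g z * (Num.conj (r z) * Num.conj (r z)))).
    apply: class_cCM; first by split; exact: class_C_cst.
    apply: class_cCM; last by apply: class_cCM; apply: class_cCJ.
    by have [h1 h2] := csmooth_cpd b gs; split; [exact: h1|exact: h2].
  split; apply/class_CS; split.
  - by move=> z Dz; have [_ []] := rP z Dz.
  - by move=> b z Dz; have [h _] := rd b z Dz; rewrite (pd_val h).
  - move=> b; have [h _] := dn b; apply: (class_C_congr oD _ h) => z Dz.
    by have [h' _] := rd b z Dz; rewrite (pd_val h').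
  - by move=> z Dz; have [_ []] := rP z Dz.
  - by move=> b z Dz; have [_ h] := rd b z Dz; rewrite (pd_val h).
  - move=> b; have [_ h] := dn b; apply: (class_C_congr oD _ h) => z Dz.
    by have [_ h'] := rd b z Dz; rewrite (pd_val h').
by split=> n; have [] := key n.
Qed.

Lemma unimodular_cube_root g : contractible D -> csmooth D g ->
  (forall z, D z -> nm (g z) = 1) ->
  exists r, csmooth D r /\ forall z, D z -> r z ^+ 3 = g z.
Proof.
move=> [c [h [Dc hc hD h01]]] gs g1.
have gc z : D z -> {for z, continuous g} by exact: csmooth_cont.
have [r rP] := continuous_cube_root oD Dc hc hD h01 gc g1.
exists r; split; first exact: csmooth_cube_root gs g1 rP.
by move=> z /rP[].
Qed.

End SmoothCubeRoot.

(** * Three-by-three matrices *)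

Section Explicit3.
Variable R : realType.
Local Notation C := R[i].

Definition o0 : 'I_3 := Ordinal (isT : (0 < 3)%N).
Definition o1 : 'I_3 := Ordinal (isT : (1 < 3)%N).
Definition o2 : 'I_3 := Ordinal (isT : (2 < 3)%N).

Lemma ord3P (P : 'I_3 -> Prop) : P o0 -> P o1 -> P o2 -> forall i, P i.
Proof.
move=> p0 p1 p2 [[|[|[|//]]] h].
- by rewrite (_ : Ordinal h = o0)//; apply: val_inj.
- by rewrite (_ : Ordinal h = o1)//; apply: val_inj.
- by rewrite (_ : Ordinal h = o2)//; apply: val_inj.
Qed.

Lemma sum3 (V : nmodType) (f : 'I_3 -> V) : \sum_i f i = f o0 + f o1 + f o2.
Proof.
rewrite !big_ord_recl big_ord0 addr0 addrA.
by congr (_ + _ + _); congr f; apply: val_inj.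
Qed.

Lemma prod3 (f : 'I_3 -> C) : \prod_i f i = f o0 * f o1 * f o2.
Proof.
rewrite !big_ord_recl big_ord0 mulr1 mulrA.
by congr (_ * _ * _); congr f; apply: val_inj.
Qed.

(** With all nine entries explicit, matrix products, adjoints and commutators reduce by rewriting to
    scalar identities. *)
Definition mk (a b c d e f g h i : C) : 'M[C]_3 :=
  mx3 [:: [:: a; b; c]; [:: d; e; f]; [:: g; h; i]].

Lemma mk_eta (A : 'M[C]_3) : A = mk (A o0 o0) (A o0 o1) (A o0 o2)
  (A o1 o0) (A o1 o1) (A o1 o2) (A o2 o0) (A o2 o1) (A o2 o2).
Proof. by apply/matrixP; apply: ord3P; apply: ord3P; rewrite !mxE. Qed.

Lemma mkE a b c d e f g h i :
  (mk a b c d e f g h i o0 o0 = a) * (mk a b c d e f g h i o0 o1 = b) *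
  (mk a b c d e f g h i o0 o2 = c) * (mk a b c d e f g h i o1 o0 = d) *
  (mk a b c d e f g h i o1 o1 = e) * (mk a b c d e f g h i o1 o2 = f) *
  (mk a b c d e f g h i o2 o0 = g) * (mk a b c d e f g h i o2 o1 = h) *
  (mk a b c d e f g h i o2 o2 = i).
Proof. by rewrite !mxE. Qed.

Lemma mk_mul a b c d e f g h i a' b' c' d' e' f' g' h' i' :
  mk a b c d e f g h i *m mk a' b' c' d' e' f' g' h' i' =
  mk (a * a' + b * d' + c * g') (a * b' + b * e' + c * h') (a * c' + b * f' + c * i')
     (d * a' + e * d' + f * g') (d * b' + e * e' + f * h') (d * c' + e * f' + f * i')
     (g * a' + h * d' + i * g') (g * b' + h * e' + i * h') (g * c' + h * f' + i * i').
Proof. by apply/matrixP; apply: ord3P; apply: ord3P; rewrite mxE sum3 !mkE. Qed.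

Lemma mk_add a b c d e f g h i a' b' c' d' e' f' g' h' i' :
  mk a b c d e f g h i + mk a' b' c' d' e' f' g' h' i' =
  mk (a + a') (b + b') (c + c') (d + d') (e + e') (f + f') (g + g') (h + h') (i + i').
Proof. by apply/matrixP; apply: ord3P; apply: ord3P; rewrite mxE !mkE. Qed.

Lemma mk_opp a b c d e f g h i :
  - mk a b c d e f g h i = mk (- a) (- b) (- c) (- d) (- e) (- f) (- g) (- h) (- i).
Proof. by apply/matrixP; apply: ord3P; apply: ord3P; rewrite mxE !mkE. Qed.

Lemma mk_scale k a b c d e f g h i :
  k *: mk a b c d e f g h i =
  mk (k * a) (k * b) (k * c) (k * d) (k * e) (k * f) (k * g) (k * h) (k * i).
Proof. by apply/matrixP; apply: ord3P; apply: ord3P; rewrite mxE !mkE. Qed.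

Lemma mk_adj a b c d e f g h i : (mk a b c d e f g h i)^t* =
  mk (Num.conj a) (Num.conj d) (Num.conj g) (Num.conj b) (Num.conj e) (Num.conj h)
     (Num.conj c) (Num.conj f) (Num.conj i).
Proof. by apply/matrixP; apply: ord3P; apply: ord3P; rewrite mxE mxE !mkE. Qed.

Lemma mk_tr a b c d e f g h i : (mk a b c d e f g h i)^T = mk a d g b e h c f i.
Proof. by apply/matrixP; apply: ord3P; apply: ord3P; rewrite mxE !mkE. Qed.

Lemma mk_trace a b c d e f g h i : \tr (mk a b c d e f g h i) = a + e + i.
Proof. by rewrite /mxtrace sum3 !mkE. Qed.

Lemma mk0 : 0 = mk 0 0 0 0 0 0 0 0 0.
Proof. by apply/matrixP; apply: ord3P; apply: ord3P; rewrite mxE !mkE. Qed.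

Lemma mk_scalar k : k%:M = mk k 0 0 0 k 0 0 0 k.
Proof. by apply/matrixP; apply: ord3P; apply: ord3P; rewrite mxE !mkE. Qed.

Definition simp0 := (mul0r, mulr0, addr0, add0r, mul1r, mulr1, oppr0, subr0, sub0r).

Definition mkS := (mk_mul, mk_add, mk_opp, mk_scale, mk_adj, mk_scalar).

Lemma mk_diag (v : 'rV[C]_3) :
  diag_mx v = mk (v 0 o0) 0 0 0 (v 0 o1) 0 0 0 (v 0 o2).
Proof. by apply/matrixP; apply: ord3P; apply: ord3P; rewrite !mxE. Qed.

Lemma mk_is_diag a e i : is_diag_mx (mk a 0 0 0 e 0 0 0 i).
Proof.
apply/is_diag_mxP; apply: ord3P; apply: ord3P => //; by rewrite mkE.
Qed.

Lemma mk_det_diag a e i : \det (mk a 0 0 0 e 0 0 0 i) = a * e * i.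
Proof.
have -> : mk a 0 0 0 e 0 0 0 i = diag_mx (\row_j [:: a; e; i]`_j).
  by rewrite mk_diag !mxE.
by rewrite det_diag prod3 !mxE.
Qed.

Definition E3 : 'M[C]_3 := mk 0 0 0 0 0 0 0 0 1.

Definition cv (a b c : C) : 'cV[C]_3 := \matrix_(i, j) [:: a; b; c]`_i.

Lemma cvE a b c : (cv a b c o0 0 = a) * (cv a b c o1 0 = b) * (cv a b c o2 0 = c).
Proof. by rewrite !mxE. Qed.

Lemma cvP (v w : 'cV[C]_3) : v o0 0 = w o0 0 -> v o1 0 = w o1 0 -> v o2 0 = w o2 0 -> v = w.
Proof. by move=> h0 h1 h2; apply/matrixP => i j; rewrite (ord1 j); move: i; apply: ord3P. Qed.

Lemma mk_mulcv a b c d e f g h i x y z : mk a b c d e f g h i *m cv x y z =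
  cv (a * x + b * y + c * z) (d * x + e * y + f * z) (g * x + h * y + i * z).
Proof. by apply: cvP; rewrite mxE sum3 !mkE !cvE. Qed.

Lemma cvD a b c a' b' c' : cv a b c + cv a' b' c' = cv (a + a') (b + b') (c + c').
Proof. by apply: cvP; rewrite mxE !cvE. Qed.

Lemma cvN a b c : - cv a b c = cv (- a) (- b) (- c).
Proof. by apply: cvP; rewrite mxE !cvE. Qed.

Lemma cvZ k a b c : k *: cv a b c = cv (k * a) (k * b) (k * c).
Proof. by apply: cvP; rewrite mxE !cvE. Qed.

Lemma bdot_conjv (v w : 'cV[C]_3) : bdot v (conjv w) = (w^t* *m v) 0 0.
Proof. by rewrite /bdot mxE; apply: eq_bigr => k _; rewrite !mxE mulrC. Qed.

Lemma bdot_cv a b c a' b' c' : bdot (cv a b c) (conjv (cv a' b' c')) =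
  a * Num.conj a' + b * Num.conj b' + c * Num.conj c'.
Proof. by rewrite /bdot sum3 !mxE. Qed.

Lemma bdot_norm (v : 'cV[C]_3) : bdot v (conjv v) = \sum_k `|v k 0| ^+ 2.
Proof. by apply: eq_bigr => k _; rewrite mxE normCK. Qed.

Lemma bdot_scale k (v : 'cV[C]_3) :
  bdot (k *: v) (conjv (k *: v)) = k * Num.conj k * bdot v (conjv v).
Proof.
by rewrite /bdot mulr_sumr; apply: eq_bigr => i _; rewrite !mxE rmorphM mulrACA.
Qed.

Lemma adjM m n p (A : 'M[C]_(m, n)) (B : 'M[C]_(n, p)) : (A *m B)^t* = B^t* *m A^t*.
Proof. by rewrite trmx_mul map_mxM. Qed.

Lemma adjK m n (A : 'M[C]_(m, n)) : A^t*^t* = A.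
Proof. by apply/matrixP => i j; rewrite !mxE conjCK. Qed.

Lemma adjB m n (A B : 'M[C]_(m, n)) : (A - B)^t* = A^t* - B^t*.
Proof. by apply/matrixP => i j; rewrite !mxE rmorphB. Qed.

Lemma adjN m n (A : 'M[C]_(m, n)) : (- A)^t* = - A^t*.
Proof. by apply/matrixP => i j; rewrite !mxE rmorphN. Qed.

Lemma unitary_mulJ (F : 'M[C]_3) : F \is unitarymx -> F *m F^t* = 1%:M.
Proof. by move/unitarymxP. Qed.

Lemma unitary_Jmul (F : 'M[C]_3) : F \is unitarymx -> F^t* *m F = 1%:M.
Proof. by move/unitarymxP/mulmx1C. Qed.

Lemma unitary_inv (F : 'M[C]_3) : F \is unitarymx -> invmx F = F^t*.
Proof.
move=> Fu; have FJ := unitary_mulJ Fu.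
have Fi : F \in unitmx by have [] := mulmx1_unit FJ.
by rewrite -[LHS]mulmx1 -FJ mulKmx.
Qed.

Lemma bdot_unitary (F : 'M[C]_3) v w : F \is unitarymx ->
  bdot (F *m v) (conjv (F *m w)) = bdot v (conjv w).
Proof.
by move=> Fu; rewrite !bdot_conjv adjM mulmxA -(mulmxA (w^t*)) unitary_Jmul// mulmx1.
Qed.

Lemma unitary_conjM (F A B : 'M[C]_3) : F \is unitarymx ->
  (F *m A *m F^t*) *m (F *m B *m F^t*) = F *m (A *m B) *m F^t*.
Proof.
move=> Fu; rewrite -!mulmxA; congr (_ *m (_ *m _)).
by rewrite (mulmxA (F^t*)) unitary_Jmul// mul1mx.
Qed.

Lemma unitary_conj_inj (F A B : 'M[C]_3) : F \is unitarymx ->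
  F *m A *m F^t* = F *m B *m F^t* -> A = B.
Proof.
move=> Fu h; have := congr1 (fun M => F^t* *m M *m F) h.
by rewrite !mulmxA unitary_Jmul// !mul1mx -!mulmxA unitary_Jmul// !mulmx1.
Qed.

Lemma unitary_conjB1 (F E : 'M[C]_3) : F \is unitarymx ->
  1%:M - F *m E *m F^t* = F *m (1%:M - E) *m F^t*.
Proof. by move=> Fu; rewrite mulmxBr mulmxBl mulmx1 unitary_mulJ. Qed.

Definition n2 (x : C) : R := Re x ^+ 2 + Im x ^+ 2.

Lemma n2E (x : C) : x * Num.conj x = (n2 x)%:C. Proof. exact: normc2E. Qed.

Lemma Re_half (r : R) : Re (2 * r%:C) / 2 = r.
Proof.
by rewrite -(rmorph_nat (real_complex R)) -rmorphM /= mulrAC divff ?mul1r// pnatr_eq0.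
Qed.

Lemma n2_nm (x : C) : n2 x = nm x ^+ 2.
Proof. by have := normCK x; rewrite nmE n2E -rmorphXn => -[]. Qed.

Lemma gFS_conj (F A B : 'M[C]_3) : F \is unitarymx ->
  gFS (F *m A *m F^t*) (F *m B *m F^t*) = gFS A B.
Proof.
move=> Fu; rewrite /gFS; congr (Re _ / 2).
by rewrite unitary_conjM// mxtrace_mulC (mulmxA (F^t*)) unitary_Jmul// mul1mx.
Qed.

End Explicit3.

(** * The surface of a moving frame *)

Section Conjugation.
Variable R : realType.
Local Notation C := R[i].

Lemma conjI : Num.conj ('i%C : C) = - 'i%C.
Proof. by apply: complexP; rewrite !ReIm /= ?oppr0. Qed.

Lemma conjNI : Num.conj (- 'i%C : C) = 'i%C.
Proof. by rewrite rmorphN /= conjI opprK. Qed.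

Lemma conj_real (r : R) : Num.conj (r%:C) = r%:C.
Proof. by apply: complexP; rewrite !ReIm ?oppr0. Qed.

Lemma mulII : 'i%C * 'i%C = -1 :> C.
Proof. by rewrite -expr2 sqr_i. Qed.

Lemma Mw_mk s (a b c d e f g h i : C -> C) z :
  Mw s (fun y => mk (a y) (b y) (c y) (d y) (e y) (f y) (g y) (h y) (i y)) z =
  mk (Dw s a z) (Dw s b z) (Dw s c z) (Dw s d z) (Dw s e z) (Dw s f z)
     (Dw s g z) (Dw s h z) (Dw s i z).
Proof.
by apply/matrixP; apply: ord3P; apply: ord3P; rewrite mxE mkE; congr (Dw s _ z);
  apply/funext => y; rewrite mkE.
Qed.

Lemma msmooth_mk (D : set C) (oD : open D) (a b c d e f g h i : C -> C) :
  csmooth D a -> csmooth D b -> csmooth D c -> csmooth D d -> csmooth D e ->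
  csmooth D f -> csmooth D g -> csmooth D h -> csmooth D i ->
  msmooth D (fun y => mk (a y) (b y) (c y) (d y) (e y) (f y) (g y) (h y) (i y)).
Proof.
move=> ca cb cc cd ce cf cg ch ci; apply/msmoothE; apply: ord3P; apply: ord3P;
  [apply: (csmooth_congr oD _ ca)|apply: (csmooth_congr oD _ cb)
  |apply: (csmooth_congr oD _ cc)|apply: (csmooth_congr oD _ cd)
  |apply: (csmooth_congr oD _ ce)|apply: (csmooth_congr oD _ cf)
  |apply: (csmooth_congr oD _ cg)|apply: (csmooth_congr oD _ ch)
  |apply: (csmooth_congr oD _ ci)] => y _; rewrite mkE //.
Qed.

Lemma laplacian_Mw (D : set C) (oD : open D) m n (F : C -> 'M[C]_(m, n)) z :
  msmooth D F -> D z ->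
  mdx (mdx F) z + mdy (mdy F) z = 4 *: Mw 'i%C (Mw (- 'i%C) F) z.
Proof.
move=> Fs Dz.
have ex : mdx F = fun y => Mw (- 'i%C) F y + Mw 'i%C F y by apply/funext => y; exact: mdx_Mw.
have ey : mdy F = fun y => 'i%C *: (Mw (- 'i%C) F y - Mw 'i%C F y).
  by apply/funext => y; exact: mdy_Mw.
have s1 := msmooth_Mw oD (- 'i%C) Fs; have s2 := msmooth_Mw oD 'i%C Fs.
have sN := msmoothN oD s2.
have e s : Mw s (fun y => 'i%C *: (Mw (- 'i%C) F y - Mw 'i%C F y)) z =
    'i%C *: (Mw s (Mw (- 'i%C) F) z - Mw s (Mw 'i%C F) z).
  rewrite (MwZ oD _ (csmooth_cst D _) (msmoothD oD s1 sN) Dz) Dw_cst scale0r add0r.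
  by rewrite (MwD oD _ s1 sN Dz) (MwN oD _ s2 Dz).
rewrite mdx_Mw mdy_Mw ex ey !(MwD oD _ s1 s2 Dz) !e (Mw_comm oD (- 'i%C) 'i%C Fs Dz).
move: (Mw _ (Mw (- 'i%C) F) z) (Mw 'i%C (Mw 'i%C F) z) (Mw 'i%C (Mw _ F) z) => p q r.
rewrite -scalerBr scalerA mulII scaleN1r.
apply/matrixP => i j; rewrite !mxE; ring.
Qed.

Lemma gFSDl (A B X : 'M[C]_3) : gFS (A + B) X = gFS A X + gFS B X.
Proof. by rewrite /gFS mulmxDl mxtraceD Re_add mulrDl. Qed.

Lemma normal_componentD (X Y A B : 'M[C]_3) (p q : R) :
  A + B - (gFS (A + B) X / p)%:C *: X - (gFS (A + B) Y / q)%:C *: Y =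
  (A - (gFS A X / p)%:C *: X - (gFS A Y / q)%:C *: Y) +
  (B - (gFS B X / p)%:C *: X - (gFS B Y / q)%:C *: Y).
Proof.
have h Z k : (gFS (A + B) Z / k)%:C *: Z = (gFS A Z / k)%:C *: Z + (gFS B Z / k)%:C *: Z.
  rewrite gFSDl mulrDl.
  exact: (etrans (congr1 (fun c => c *: Z) (rmorphD (real_complex R) _ _)) (scalerDl _ _ _)).
have sh (V : zmodType) (a b x x' y y' : V) :
    a + b - (x + x') - (y + y') = (a - x - y) + (b - x' - y').
  by rewrite !opprD (addrACA a) (addrACA (a - x)).
by rewrite (h X p) (h Y q) sh.
Qed.

Lemma normal_partD (f : C -> 'M[C]_3) z A B :
  normal_part f z (A + B) = normal_part f z A + normal_part f z B.
Proof. exact: normal_componentD. Qed.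

Lemma normal_part0 (f : C -> 'M[C]_3) z : normal_part f z 0 = 0.
Proof.
by apply: (addrI (normal_part f z 0)); rewrite -normal_partD !addr0.
Qed.

Lemma tanprojD (p A B : 'M[C]_3) : tanproj p (A + B) = tanproj p A + tanproj p B.
Proof.
rewrite /tanproj; move: (1%:M - p) => q.
by rewrite !mulmxDr !mulmxDl addrACA.
Qed.

Lemma tanproj_conj (F Y : 'M[C]_3) (k : C) : F \is unitarymx ->
  tanproj (F *m E3 R *m F^t*) (k *: (F *m Y *m F^t*)) =
  F *m (k *: (E3 R *m Y *m (1%:M - E3 R) + (1%:M - E3 R) *m Y *m E3 R)) *m F^t*.
Proof.
move=> Fu; rewrite /tanproj unitary_conjB1//; move: (1%:M - E3 R) (E3 R) => P E.
rewrite [k *: (_ *m _)]scalemxAl scalemxAr !unitary_conjM// -mulmxDl -mulmxDr.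
by congr (_ *m _ *m _); rewrite -!scalemxAr -!scalemxAl scalerDr.
Qed.

(** For a conformal map the two terms carry the same weight; as [tanproj] and [normal_part] are
    additive, the mean curvature is a multiple of the normal part of the projected Laplacian. *)
Lemma mean_curvature0 (f : C -> 'M[C]_3) z :
  gFS (mdx f z) (mdx f z) = gFS (mdy f z) (mdy f z) ->
  tanproj (f z) (mdx (mdx f) z + mdy (mdy f) z) = 0 -> mean_curvature f z = 0.
Proof.
have gen (k k' : R) (A B : 'M[C]_3) : k = k' -> A + B = 0 ->
    2^-1 *: (k^-1%:C *: A + k'^-1%:C *: B) = 0.
  by move=> -> h; rewrite -scalerDr h !scaler0.
move=> e h; apply: (gen _ _ _ _ e).
apply: (etrans (esym (normal_partD _ _ _ _))).
rewrite /nabla_x /nabla_y.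
apply: (etrans (congr1 (normal_part f z) (esym (tanprojD _ _ _)))).
by apply: (etrans (congr1 (normal_part f z) h)); exact: normal_part0.
Qed.

Lemma gFSE (A B : 'M[C]_3) : gFS A B = Re (\tr (A *m B)) / 2.
Proof. by []. Qed.

Lemma omegaE (f : C -> 'M[C]_3) z : omega f z = ln (gFS (mdx f z) (mdx f z) / 2).
Proof. by []. Qed.

Lemma sqrt_n2 (x : C) : Num.sqrt (n2 x) = nm x.
Proof. by rewrite n2_nm sqrtr_sqr ger0_norm ?nm_ge0. Qed.

Lemma cv_outer (k : C) : cv 0 0 k *m (cv 0 0 k)^t* = (k * Num.conj k) *: E3 R.
Proof.
by apply/matrixP; apply: ord3P; apply: ord3P; rewrite !mxE big_ord1 !mxE /= ?rmorph0 ?simp0.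
Qed.

Lemma hopf_mul (F : 'M[C]_3) v : hopf (F *m v) = F *m (v *m v^t*) *m F^t*.
Proof. by rewrite /hopf adjM !mulmxA. Qed.

Lemma normalize_unit (x : C) : nm x != 0 ->
  x * Num.conj x * ((nm x)^-1%:C * (nm x)^-1%:C) = 1.
Proof.
move=> x0; rewrite n2E n2_nm -!(rmorphM (real_complex R)) /= expr2 mulrACA divff// mulr1.
exact: rmorph1.
Qed.

Lemma mul_diag_cols (F : 'M[C]_3) p q r : F *m mk p 0 0 0 q 0 0 0 r =
  cols3 (p *: (F *m cv 1 0 0)) (q *: (F *m cv 0 1 0)) (r *: (F *m cv 0 0 1)).
Proof.
apply/matrixP => i; apply: ord3P;
  by rewrite [LHS]mxE sum3 !mkE [RHS]mxE /= mxE mxE sum3 !cvE !simp0 mulrC.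
Qed.

End Conjugation.

(** * Metric, minimality and adapted lift of the surface of a frame *)

Section MovingFrame.
#[local] Opaque mdx mdy Mw Dw gFS omega normal_part.
Variable R : realType.
Local Notation C := R[i].
Variable D : set C.
Hypothesis oD : open D.
Variables F U : C -> 'M[C]_3.
Hypothesis Fs : msmooth D F.
Hypothesis Fu : forall z, D z -> F z \is unitarymx.
Hypothesis Fz : forall z, D z -> Mw (- 'i%C) F z = F z *m U z.
Hypothesis Fzb : forall z, D z -> Mw 'i%C F z = - (F z *m (U z)^t*).
Hypothesis U12 : forall z, D z -> U z o1 o2 = 0.
Hypothesis U20 : forall z, D z -> U z o2 o0 = 0.

Let a z : C := U z o0 o2.
Let b z : C := U z o2 o1.

Hypothesis ab0 : forall z, D z -> a z != 0 /\ b z != 0.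

(** The coefficients inherit smoothness from the frame, because [U] is the adjoint of [F] times its
    z-derivative. *)
Lemma frame_U_smooth : msmooth D U.
Proof.
have := msmoothM oD (msmoothJ oD Fs) (msmooth_Mw oD (- 'i%C) Fs).
apply: (msmooth_congr oD) => z Dz.
by rewrite Fz// mulmxA unitary_Jmul ?mul1mx// Fu.
Qed.

Let as_ : csmooth D a. Proof. exact: frame_U_smooth. Qed.
Let bs_ : csmooth D b. Proof. exact: frame_U_smooth. Qed.

Definition surf z : 'M[C]_3 := F z *m E3 R *m (F z)^t*.

(** The z-derivative of [surf] read in the frame [F]: the commutator of [U] with [E3], in which only
    the entries [a] and [- b] survive. *)
Let X z : 'M[C]_3 := mk 0 0 (a z) 0 0 0 0 (- b z) 0.

Let UX z : D z -> U z *m E3 R - E3 R *m U z = X z.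
Proof.
move=> Dz; rewrite (mk_eta (U z)) /E3 !mkS U12// U20// /X /a /b; rewrite ?simp0; congr mk; ring.
Qed.

Lemma surf_smooth : msmooth D surf.
Proof.
apply: (msmoothM oD); last exact: (msmoothJ oD Fs).
by apply: (msmoothM oD) => //; exact: msmooth_cst.
Qed.

Let MwFJ (s : C) (A : C -> 'M[C]_3) z : D z -> msmooth D A ->
  Mw s (fun y => F y *m A y *m (F y)^t*) z =
  Mw s F z *m A z *m (F z)^t* + F z *m Mw s A z *m (F z)^t* +
  F z *m A z *m (Mw (Num.conj s) F z)^t*.
Proof.
move=> Dz As; have FA : msmooth D (fun y => F y *m A y) by exact: msmoothM.
by rewrite (MwM oD _ FA (msmoothJ oD Fs) Dz) (MwM oD _ Fs As Dz) mulmxDl (MwJ oD _ Fs Dz).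
Qed.

(** The z-derivative of the adjoint of [F] is the adjoint of its zbar-derivative, that is [- U]
    times the adjoint of [F]. In the moving frame differentiation is therefore a commutator with [U]
    plus the derivative of [A]. *)
Let Mw_z A z : D z -> msmooth D A -> Mw (- 'i%C) (fun y => F y *m A y *m (F y)^t*) z =
  F z *m (U z *m A z - A z *m U z + Mw (- 'i%C) A z) *m (F z)^t*.
Proof.
move=> Dz As; rewrite MwFJ// conjNI Fz// Fzb// adjN adjM adjK.
rewrite mulmxDr mulmxBr mulmxDl mulmxBl mulmxN !mulmxA.
by rewrite addrAC.
Qed.

Let Mw_zb A z : D z -> msmooth D A -> Mw 'i%C (fun y => F y *m A y *m (F y)^t*) z =
  F z *m (A z *m (U z)^t* - (U z)^t* *m A z + Mw 'i%C A z) *m (F z)^t*.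
Proof.
move=> Dz As; rewrite MwFJ// conjI Fz// Fzb// adjM.
rewrite mulmxDr mulmxBr mulmxDl mulmxBl !mulNmx !mulmxA.
by rewrite addrC addrA.
Qed.

Let surf_z z : D z -> Mw (- 'i%C) surf z = F z *m X z *m (F z)^t*.
Proof.
move=> Dz; rewrite (Mw_z Dz (msmooth_cst D (E3 R))) Mw_cst addr0 UX//.
Qed.

Let surf_zb z : D z -> Mw 'i%C surf z = F z *m (X z)^t* *m (F z)^t*.
Proof.
move=> Dz; rewrite (Mw_zb Dz (msmooth_cst D (E3 R))) Mw_cst addr0 -UX//.
have E3J : (E3 R)^t* = E3 R by rewrite /E3 mk_adj !rmorph0 rmorph1.
by rewrite adjB !adjM E3J.
Qed.

(** [S1] is the sum of [X] and its adjoint, [S2] is ['i] times their difference: the x- and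
    y-derivatives of [surf] read in the frame. *)
Let S1 z : 'M[C]_3 := mk 0 0 (a z) 0 0 (- Num.conj (b z)) (Num.conj (a z)) (- b z) 0.
Let S2 z : 'M[C]_3 := 'i%C *:
  mk 0 0 (a z) 0 0 (Num.conj (b z)) (- Num.conj (a z)) (- b z) 0.

Let surf_x z : D z -> mdx surf z = F z *m S1 z *m (F z)^t*.
Proof.
move=> Dz; rewrite mdx_Mw surf_z// surf_zb// -mulmxDl -mulmxDr; congr (_ *m _ *m _).
by rewrite /X !mkS /S1 rmorphN rmorph0 /=; rewrite ?simp0; congr mk; ring.
Qed.

Let surf_y z : D z -> mdy surf z = F z *m S2 z *m (F z)^t*.
Proof.
move=> Dz; rewrite mdy_Mw surf_z// surf_zb// -mulmxBl -mulmxBr scalemxAl scalemxAr.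
rewrite (_ : X z - (X z)^t* = mk 0 0 (a z) 0 0 (Num.conj (b z)) (- Num.conj (a z)) (- b z) 0) //.
by rewrite /X !mkS rmorphN rmorph0 /= !simp0 opprK.
Qed.

Let gFS_xx z : D z -> gFS (mdx surf z) (mdx surf z) = n2 (a z) + n2 (b z).
Proof.
move=> Dz; rewrite surf_x// gFS_conj ?Fu// gFSE.
rewrite (_ : \tr _ = 2 * (a z * Num.conj (a z) + b z * Num.conj (b z))); last first.
  by rewrite /S1 mk_mul mk_trace !simp0; ring.
by rewrite !n2E -rmorphD; exact: Re_half.
Qed.

Let gFS_yy z : D z -> gFS (mdy surf z) (mdy surf z) = n2 (a z) + n2 (b z).
Proof.
move=> Dz; rewrite surf_y// gFS_conj ?Fu// gFSE.
rewrite (_ : \tr _ = 2 * (a z * Num.conj (a z) + b z * Num.conj (b z))); last first.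
  rewrite /S2 -scalemxAl -scalemxAr scalerA mulII mk_mul mk_scale mk_trace !simp0; ring.
by rewrite !n2E -rmorphD; exact: Re_half.
Qed.

Let gFS_xy z : D z -> gFS (mdx surf z) (mdy surf z) = 0.
Proof.
move=> Dz; rewrite surf_y// surf_x// gFS_conj ?Fu// gFSE.
rewrite (_ : \tr _ = 0) ?mul0r//.
rewrite /S1 /S2 -scalemxAr mk_mul mk_scale mk_trace !simp0; ring.
Qed.

Lemma surf_CP2 z : D z -> CP2 (surf z).
Proof.
move=> Dz; have E3J : (E3 R)^t* = E3 R by rewrite /E3 mk_adj !rmorph0 rmorph1.
have E3K : E3 R *m E3 R = E3 R by rewrite /E3 mk_mul; rewrite ?simp0; congr mk; ring.
split.
- by rewrite /surf !adjM adjK E3J mulmxA.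
- by rewrite /surf unitary_conjM ?E3K// Fu.
- rewrite /surf mxtrace_mulC mulmxA unitary_Jmul ?Fu// mul1mx /E3 mk_trace; ring.
Qed.

Lemma surf_conformal : conformal_immersion D surf.
Proof.
split; first exact: surf_smooth.
move=> z Dz; have [a0 b0] := ab0 Dz; split.
- exact: surf_CP2.
- by rewrite gFS_xx// addr_gt0// normc2_gt0.
- exact: (etrans (gFS_xx Dz) (esym (gFS_yy Dz))).
- exact: gFS_xy.
Qed.

Lemma surf_omega z : D z -> omega surf z = ln ((n2 (a z) + n2 (b z)) / 2).
Proof. by move=> Dz; rewrite omegaE gFS_xx. Qed.

Lemma surf_lagrangian : (forall z, D z -> n2 (a z) = n2 (b z)) -> lagrangian D surf.
Proof.
move=> ab z Dz; rewrite surf_x// surf_y// /Jcplx.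
rewrite (_ : 'i%C *: _ = F z *m ('i%C *: (S1 z *m E3 R - E3 R *m S1 z)) *m (F z)^t*); last first.
  rewrite -scalemxAr -scalemxAl; congr (_ *: _).
  by rewrite /surf !unitary_conjM ?Fu// mulmxBr mulmxBl.
rewrite gFS_conj ?Fu// gFSE.
rewrite (_ : \tr _ = 2 * (a z * Num.conj (a z) - b z * Num.conj (b z))); last first.
  rewrite /S1 /S2 /E3 -scalemxAl -scalemxAr scalerA mulII !mkS mk_trace !simp0; ring.
by rewrite !n2E ab// subrr mulr0 mul0r.
Qed.

(** The mixed derivative of [surf] is computed in both orders, as [Y1] and as [Y2] in the frame.
    When [U] has zero (0, 1) entry, [Y1] visibly vanishes at (1, 2) and (2, 0), and [Y2] at (0, 2)
    and (2, 1). Since they are equal, all four entries that [tanproj] retains are zero. *)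
Lemma surf_minimal : (forall z, D z -> U z o0 o1 = 0) -> minimal D surf.
Proof.
move=> U01 z Dz.
have Xs : msmooth D X.
  by apply: (msmooth_mk oD); try exact: csmooth_cst; [exact: as_|exact: (csmoothN oD bs_)].
pose Y1 := X z *m (U z)^t* - (U z)^t* *m X z + Mw 'i%C X z.
pose Y2 := U z *m (X z)^t* - (X z)^t* *m U z + (Mw 'i%C X z)^t*.
have e1 : Mw 'i%C (Mw (- 'i%C) surf) z = F z *m Y1 *m (F z)^t*.
  by rewrite (Mw_congr oD _ Dz surf_z) Mw_zb.
have e2 : Mw 'i%C (Mw (- 'i%C) surf) z = F z *m Y2 *m (F z)^t*.
  rewrite (Mw_comm oD _ _ surf_smooth Dz) (Mw_congr oD _ Dz surf_zb).
  by rewrite (Mw_z Dz (msmoothJ oD Xs)) (MwJ oD _ Xs Dz) conjNI.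
have Y12 : Y1 = Y2.
  by apply: (unitary_conj_inj (Fu Dz)); rewrite -e1 -e2.
have MX : Mw 'i%C X z = mk 0 0 (Dw 'i%C a z) 0 0 0 0 (Dw 'i%C (fun y => - b y) z) 0.
  by rewrite Mw_mk !Dw_cst.
have [y02 y21] : Y2 o0 o2 = 0 /\ Y2 o2 o1 = 0.
  rewrite /Y2 MX /X (mk_eta (U z)) !mkS U01// U12// U20// !mkE.
  by rewrite !rmorph0 !simp0.
have [y12 y20] : Y1 o1 o2 = 0 /\ Y1 o2 o0 = 0.
  rewrite /Y1 MX /X (mk_eta (U z)) !mkS U01// U12// U20// !mkE.
  by rewrite !rmorph0 !simp0.
have tan0 : tanproj (surf z) (mdx (mdx surf) z + mdy (mdy surf) z) = 0.
  rewrite (laplacian_Mw oD surf_smooth Dz) e1 tanproj_conj ?Fu//.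
  rewrite (mk_eta Y1) y12 y20 Y12 y02 y21 /E3 !mkS !simp0.
  by rewrite !subrr !simp0 -mk0 mulmx0 mul0mx.
apply: mean_curvature0 tan0; exact: (etrans (gFS_xx Dz) (esym (gFS_yy Dz))).
Qed.

Lemma surf_derived : contractible D ->
  without_complex_points D surf /\ can_be_derived_from D F surf.
Proof.
move=> cD.
have sa : smooth D (fun z => Num.sqrt (n2 (a z))).
  by apply: smooth_sqrt => // [z /ab0[h _]|]; [exact: normc2_gt0|exact: smooth_normc2].
have sb : smooth D (fun z => Num.sqrt (n2 (b z))).
  by apply: smooth_sqrt => // [z /ab0[_ h]|]; [exact: normc2_gt0|exact: smooth_normc2].
have pa z : D z -> 0 < nm (a z).
  by move=> /ab0[h _]; rewrite lt_neqAle nm_ge0 andbT eq_sym nm_eq0.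
have pb z : D z -> 0 < nm (b z).
  by move=> /ab0[_ h]; rewrite lt_neqAle nm_ge0 andbT eq_sym nm_eq0.
have nsa : csmooth D (fun z => ((nm (a z))^-1)%:C).
  apply: csmooth_real; apply: smoothV => // [z /pa/lt0r_neq0//|].
  by apply: smooth_congr sa => // z _; rewrite sqrt_n2.
have nsb : csmooth D (fun z => ((nm (b z))^-1)%:C).
  apply: csmooth_real; apply: smoothV => // [z /pb/lt0r_neq0//|].
  by apply: smooth_congr sb => // z _; rewrite sqrt_n2.
(* For a lift [t] times the last column of [F], the frame differs from [F] by the diagonal phases -
   i t a/|a|, i t conj b/|b| and t. Their product is t^3 a conj b/|a b|, so determinant one requires
   t^3 to be this [g]. *)
pose g z := Num.conj (a z) * b z * (((nm (a z))^-1)%:C * ((nm (b z))^-1)%:C).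
have gs : csmooth D g.
  apply: (csmoothM oD); last exact: (csmoothM oD).
  by apply: (csmoothM oD) => //; exact: (csmoothJ oD).
have g1 z : D z -> nm (g z) = 1.
  move=> Dz; have := pa z Dz; have := pb z Dz => b0 a0.
  rewrite /g !nmM nm_conj !nm_real !ger0_norm ?invr_ge0 ?nm_ge0//.
  by rewrite mulrACA !divff ?mulr1 ?gt_eqF.
have [t [ts t3]] := unimodular_cube_root oD cD gs g1.
have t1 z : D z -> nm (t z) = 1.
  move=> Dz; have := g1 z Dz; rewrite -t3// nmX => /eqP.
  by rewrite pexpr_eq1 ?nm_ge0// => /eqP.
have tt z : D z -> t z * Num.conj (t z) = 1 by move=> Dz; apply/nm_unit/t1.
pose l z : 'cV[C]_3 := t z *: (F z *m cv 0 0 1).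
have Fes : msmooth D (fun z => F z *m (cv 0 0 1 : 'cV[C]_3)).
  by apply: (msmoothM oD) => //; exact: msmooth_cst.
have ls : msmooth D l by exact: (msmoothZ oD).
have lE z : l z = F z *m cv 0 0 (t z) by rewrite /l scalemxAr cvZ !simp0.
have Mwl s z : D z -> Mw s l z = Dw s t z *: (F z *m cv 0 0 1) + t z *: (Mw s F z *m cv 0 0 1).
  move=> Dz; rewrite (MwZ oD _ ts Fes Dz) (MwM oD _ Fs (msmooth_cst D _) Dz).
  by rewrite Mw_cst mulmx0 addr0.
(* The component along [l] is the third coordinate in the frame. Removing it also removes the
   derivative of [t], which enters only there. *)
have bl z (p q r : C) : D z ->
    F z *m cv p q r - bdot (F z *m cv p q r) (conjv (l z)) *: l z = F z *m cv p q 0.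
  move=> Dz; rewrite lE bdot_unitary ?Fu// bdot_cv !rmorph0 !simp0 scalemxAr -mulmxBr.
  rewrite cvZ cvN cvD !simp0; congr (_ *m cv _ _ _).
  by rewrite -mulrA (mulrC (Num.conj _)) tt// mulr1 subrr.
have Ue z : D z -> U z *m cv 0 0 1 = cv (a z) 0 (U z o2 o2).
  by move=> Dz; rewrite {1}(mk_eta (U z)) mk_mulcv U12// !simp0.
have UJe z : D z -> (U z)^t* *m cv 0 0 1 = cv 0 (Num.conj (b z)) (Num.conj (U z o2 o2)).
  by move=> Dz; rewrite {1}(mk_eta (U z)) mk_adj mk_mulcv U20// rmorph0 !simp0.
have xiE z : D z -> xi l z = (t z * a z) *: (F z *m cv 1 0 0).
  move=> Dz; rewrite /xi mdzE Mwl// Fz// -mulmxA Ue// !scalemxAr -mulmxDr.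
  by rewrite !cvZ cvD !simp0 bl.
have etaE z : D z -> Defs.eta l z = (- t z * Num.conj (b z)) *: (F z *m cv 0 1 0).
  move=> Dz; rewrite /Defs.eta mdzbarE Mwl// Fzb// mulNmx -mulmxA UJe// -mulmxN !scalemxAr -mulmxDr.
  by rewrite cvN !cvZ cvD !simp0 bl// mulrN mulNr.
have unitv (v : 'cV[C]_3) (k : C) z : D z -> bdot v (conjv v) = 1 ->
    Re (bdot (k *: (F z *m v)) (conjv (k *: (F z *m v)))) = n2 k.
  by move=> Dz v1; rewrite bdot_scale bdot_unitary ?Fu// v1 mulr1 n2E.
have Ea z : D z -> coef_a surf l z = expR (- omega surf z) * n2 (a z).
  move=> Dz; rewrite /coef_a xiE// unitv//; last by rewrite bdot_cv !rmorph0 rmorph1 !simp0.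
  by rewrite !n2_nm nmM t1// mul1r.
have Eb z : D z -> coef_b surf l z = expR (- omega surf z) * n2 (b z).
  move=> Dz; rewrite /coef_b etaE// unitv//; last by rewrite bdot_cv !rmorph0 rmorph1 !simp0.
  by rewrite !n2_nm nmM nmN nm_conj t1// mul1r.
have lft : Defs.lift D surf l.
  split=> // z Dz; split.
    rewrite /S5 /=; have : bdot (l z) (conjv (l z)) = 1.
      by rewrite lE bdot_unitary ?Fu// bdot_cv !rmorph0 !simp0 tt.
    by rewrite bdot_norm.
  by rewrite lE hopf_mul cv_outer tt// scale1r.
have wcp : without_complex_points D surf.
  exists l => // z Dz; have [h1 h2] := ab0 Dz.
  by rewrite Ea// Eb// !mulr_gt0 ?expR_gt0//; exact: normc2_gt0.
(* Applied with [x] equal to [- omega] and [y] the modulus of [a] or [b]: the conformal factor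
   cancels from the normalisation of the first two columns. *)
have half (x y : R) : 0 < y -> expR (x / 2) / Num.sqrt (expR x * y ^+ 2) = y^-1.
  move=> y0; rewrite [in X in Num.sqrt X](splitr x) expRD -expr2 -exprMn sqrtr_sqr.
  rewrite ger0_norm ?mulr_ge0 ?expR_ge0 ?ltW// invfM mulrA divff ?mul1r//.
  by rewrite gt_eqF// expR_gt0.
split; first exact: wcp.
split; [exact: surf_conformal|exact: wcp|].
pose p z := - 'i%C * t z * a z * ((nm (a z))^-1)%:C.
pose q z := 'i%C * t z * Num.conj (b z) * ((nm (b z))^-1)%:C.
have nI : nm ('i%C : C) = 1 by apply/nm_unit; rewrite conjI mulrN mulII opprK.
have p1 z : D z -> p z * Num.conj (p z) = 1.
  move=> Dz; apply/nm_unit; rewrite /p !nmM nmN nI t1// !mul1r nm_real.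
  by rewrite ger0_norm ?invr_ge0 ?nm_ge0// divff// gt_eqF// pa.
have q1 z : D z -> q z * Num.conj (q z) = 1.
  move=> Dz; apply/nm_unit; rewrite /q !nmM nI t1// !mul1r nm_real nm_conj.
  by rewrite ger0_norm ?invr_ge0 ?nm_ge0// divff// gt_eqF// pb.
exists l, (fun z => mk (p z) 0 0 0 (q z) 0 0 0 (t z)); split; first exact: lft.
  apply: (msmooth_mk oD); try exact: csmooth_cst; last exact: ts.
    apply: (csmoothM oD); last exact: nsa.
    apply: (csmoothM oD); last exact: as_.
    by apply: (csmoothM oD) => //; exact: csmooth_cst.
  apply: (csmoothM oD); last exact: nsb.
  apply: (csmoothM oD); last exact: (csmoothJ oD bs_).
  by apply: (csmoothM oD) => //; exact: csmooth_cst.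
move=> z Dz; split; first exact: mk_is_diag.
  split.
    apply/unitarymxP; rewrite mk_adj mk_mul mk_scalar !rmorph0 !simp0.
    by rewrite p1// q1// tt.
  rewrite mk_det_diag.
  have -> : p z * q z * t z = - ('i%C * 'i%C) * (t z ^+ 3) * (a z * Num.conj (b z)) *
      (((nm (a z))^-1)%:C * ((nm (b z))^-1)%:C) by rewrite /p /q; ring.
  rewrite t3// mulII opprK mul1r /g.
  set v := (_^-1)%:C; set w := (_^-1)%:C.
  have -> : Num.conj (a z) * b z * (v * w) * (a z * Num.conj (b z)) * (v * w) =
    (a z * Num.conj (a z) * (v * v)) * (b z * Num.conj (b z) * (w * w)) by ring.
  by rewrite /v /w !normalize_unit ?mulr1// gt_eqF ?pa ?pb.
rewrite /frame Ea// Eb// !n2_nm (half _ _ (pa z Dz)) (half _ _ (pb z Dz)).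
rewrite xiE// etaE// lE !scalerA mul_diag_cols; congr cols3.
- by congr (_ *: _); rewrite /p; ring.
- by congr (_ *: _); rewrite /q; ring.
- by rewrite scalemxAr cvZ !simp0.
Qed.

End MovingFrame.

(** * Eigenspaces of the powers of sigma *)

Section Eigenspaces.
Variable R : realType.
Local Notation C := R[i].

Lemma RIcont_sum (T : topologicalType) (I : Type) (r : seq I) (P : pred I) (f : I -> T -> C) z :
  (forall i, RIcont (f i) z) -> RIcont (fun t => \sum_(i <- r | P i) f i t) z.
Proof.
move=> fc; elim: r => [|i r IH].
  by apply: RIcont_congr (RIcont_cst 0 z); apply: (@filterE _ (nbhs z)) => t; rewrite big_nil.
case Pi : (P i).
  apply: RIcont_congr (RIcontD (fc i) IH).
  by apply: (@filterE _ (nbhs z)) => t; rewrite big_cons Pi.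
by apply: RIcont_congr IH; apply: (@filterE _ (nbhs z)) => t; rewrite big_cons Pi.
Qed.

Lemma RIcont_real (t : R) : RIcont (fun s : R => s%:C : C) t.
Proof. by split; [exact: cvg_id|exact: cst_continuous]. Qed.

(** The closed forms below for the powers of [sigma] hold at invertible matrices; this provides them
    along the curve 1 + tX for small [t]. *)
Lemma det_near0 (X : 'M[C]_3) : \forall t \near (0 : R), (1%:M + t%:C *: X) \in unitmx.
Proof.
have entry i j : RIcont (fun t : R => (1%:M + t%:C *: X) i j) 0.
  rewrite (_ : (fun t : R => _) = fun t : R => (1%:M : 'M[C]_3) i j + t%:C * X i j).
    exact: (RIcontD (RIcont_cst _ _) (RIcontM (RIcont_real 0) (RIcont_cst _ _))).
  by apply/funext => t; rewrite !mxE.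
have dc : RIcont (fun t : R => \det (1%:M + t%:C *: X)) 0.
  apply: RIcont_sum => s; apply: RIcontM; first exact: RIcont_cst.
  by apply: RIcont_prod => i _; exact: entry.
have := (RIcontP _ _).1 dc 1 ltr01; apply: filterS => t /=.
rewrite scale0r addr0 det1 unitmxE unitfE => h.
by apply/eqP => d0; move: h; rewrite d0 sub0r nmN nm1 ltxx.
Qed.

Lemma velocity_line (X : 'M[C]_3) : has_velocity (fun t : R => 1%:M + t%:C *: X) 0 X.
Proof.
have := velocityD (velocity_cst (1%:M : 'M[C]_3) 0) (velocity_scale X (@cder_real R 0)).
by rewrite add0r scale1r.
Qed.

Lemma velocity_tr m n (g : R -> 'M[C]_(m, n)) t A :
  has_velocity g t A -> has_velocity (fun s => (g s)^T) t A^T.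
Proof.
move=> gA i j; rewrite mxE; have := gA j i.
under [X in is_derive _ _ X _ /\ _ -> _]eq_fun do rewrite -[g _]trmxK mxE.
by under [X in _ /\ is_derive _ _ X _ -> _]eq_fun do rewrite -[g _]trmxK mxE.
Qed.

Lemma velocity_conj (kappa : 'M[C]_3 -> 'M[C]_3) (K K' X A : 'M[C]_3) :
  (forall g, g \in unitmx -> kappa g = K *m g *m K') ->
  has_velocity (fun t : R => kappa (1%:M + t%:C *: X)) 0 A -> A = K *m X *m K'.
Proof.
move=> kE kA; have := velocityM (velocityM (velocity_cst K 0) (velocity_line X)) (velocity_cst K' 0).
rewrite mul0mx add0r mulmx0 addr0; apply: velocity_unique.
by apply: velocity_near kA; apply: filterS (det_near0 X) => t /kE.
Qed.

(* Differentiates [g^T (L kappa(g) L) = 1] along [g = 1 + tX]. *)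
Lemma velocity_contragredient (kappa : 'M[C]_3 -> 'M[C]_3) (L X A : 'M[C]_3) :
  L *m L = 1%:M ->
  (forall g, g \in unitmx -> kappa g = L *m invmx g^T *m L) ->
  has_velocity (fun t : R => kappa (1%:M + t%:C *: X)) 0 A -> A = - (L *m X^T *m L).
Proof.
move=> LL kE kA.
have k0 : kappa (1%:M + (0 : R)%:C *: X) = 1%:M.
  by rewrite scale0r addr0 kE ?unitmx1// trmx1 invmx1 mulmx1 LL.
have := velocityM (velocity_tr (velocity_line X))
  (velocityM (velocityM (velocity_cst L 0) kA) (velocity_cst L 0)).
rewrite k0 mul0mx add0r mulmx0 addr0 mulmx1 LL mulmx1 scale0r addr0 trmx1 mul1mx => h.
have h0 : has_velocity (fun s : R => (1%:M + s%:C *: X)^T *m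
    (L *m kappa (1%:M + s%:C *: X) *m L)) 0 0.
  apply: velocity_near (velocity_cst (1%:M : 'M[C]_3) 0).
  apply: filterS (det_near0 X) => t ut; rewrite kE//.
  have LKL (B : 'M[C]_3) : L *m (L *m B *m L) *m L = B.
    by rewrite !mulmxA LL mul1mx -mulmxA LL mulmx1.
  by rewrite LKL mulmxV// unitmx_tr.
have e := velocity_unique h h0.
have -> : X^T = - (L *m A *m L) by apply/eqP; rewrite -addr_eq0 e.
by rewrite mulmxN mulNmx opprK !mulmxA LL mul1mx -mulmxA LL mulmx1.
Qed.

Lemma expiD (x y : R) : expi (x + y) = expi x * expi y.
Proof. by apply: complexP; rewrite ReIm /= ?cosD ?sinD//; rewrite mulrC (mulrC (cos x)) addrC. Qed.

Let e : C := epsilon R.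

(** The cube of epsilon is -1, and its imaginary part sin(pi/3) is positive, so it is not -1. The
    remaining factor of x^3 + 1 gives the relation by which all later powers are reduced. *)
Lemma epsilon_eq : e ^+ 2 = e - 1.
Proof.
have e3 : e ^+ 3 = -1.
  rewrite /e /epsilon !exprS expr0 mulr1 -!expiD.
  rewrite (_ : pi / 3 + (pi / 3 + pi / 3) = pi); last by field.
  by rewrite /expi cospi sinpi; apply: complexP; rewrite /= ?oppr0.
have e1 : e + 1 != 0.
  rewrite eq_complex negb_and; apply/orP; right => /=.
  rewrite addr0 gt_eqF// sin_gt0_pi// ?divr_gt0 ?pi_gt0//=.
  by rewrite ltr_pdivrMr// mulr_natr mulrS ltrDl mulrn_wgt0// pi_gt0.
apply/eqP; rewrite -subr_eq0 -(mulrI_eq0 _ (mulfI e1)).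
have -> : (e + 1) * (e ^+ 2 - (e - 1)) = e ^+ 3 + 1 by ring.
by rewrite e3 addNr.
Qed.

Lemma expi0 : expi 0 = 1 :> C.
Proof. by rewrite /expi cos0 sin0. Qed.

Lemma expi_m6 : expi (2 * pi * (-1)%:~R / 6%:R) = 1 - e :> C.
Proof.
have h : e * expi (2 * pi * (-1)%:~R / 6%:R) = 1.
  by rewrite /e /epsilon -expiD -expi0; congr expi; field.
have e2 := epsilon_eq.
have : (1 - e) * (e * expi (2 * pi * (-1)%:~R / 6%:R)) = 1 - e by rewrite h mulr1.
rewrite mulrA (_ : (1 - e) * e = 1) ?mul1r//.
have -> : (1 - e) * e = e - e ^+ 2 by ring.
by rewrite e2; ring.
Qed.

Lemma expi_m3 : expi (2 * pi * (-1)%:~R / 3%:R) = - e :> C.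
Proof.
have -> : 2 * pi * (-1)%:~R / 3%:R =
    2 * pi * (-1)%:~R / 6%:R + 2 * pi * (-1)%:~R / 6%:R :> R by field.
rewrite expiD expi_m6; have -> : (1 - e) * (1 - e) = 1 - 2 * e + e ^+ 2 by ring.
rewrite epsilon_eq; ring.
Qed.

Lemma expi_2 (m : int) : (m = 1) \/ (m = -1) -> expi (2 * pi * m%:~R / 2%:R) = -1 :> C.
Proof.
move=> mE; have -> : 2 * pi * m%:~R / 2%:R = pi * m%:~R :> R by field.
rewrite /expi; case: mE => ->; rewrite ?mulr1 ?mulrN1 ?cosN ?sinN cospi sinpi;
  by apply: complexP; rewrite /= ?oppr0.
Qed.

Let P : 'M[C]_3 := mk 0 (e - 1) 0 (- e) 0 0 0 0 1.

Lemma PmxE : Pmx R = P.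
Proof.
rewrite /Pmx /P /mk -/e (_ : e ^+ 4 = e ^+ 2 * e ^+ 2); last by ring.
rewrite epsilon_eq (_ : (e - 1) * (e - 1) = - e)//.
have -> : (e - 1) * (e - 1) = e ^+ 2 - 2 * e + 1 by ring.
rewrite epsilon_eq; ring.
Qed.

Let ee : (e - 1) * - e = 1.
Proof.
have -> : (e - 1) * - e = e - e ^+ 2 by ring.
rewrite epsilon_eq; ring.
Qed.

Let ee' : - e * (e - 1) = 1. Proof. by rewrite mulrC ee. Qed.

Let sq1 : (e - 1) * (e - 1) = - e.
Proof.
have -> : (e - 1) * (e - 1) = e ^+ 2 - 2 * e + 1 by ring.
rewrite epsilon_eq; ring.
Qed.

Let sq2 : - e * - e = e - 1.
Proof. by rewrite mulrNN -expr2 epsilon_eq. Qed.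

Let PP : P *m P = 1%:M.
Proof. by rewrite /P mk_mul !simp0 ee ee' mk_scalar. Qed.

Let PTPT : P^T *m P^T = 1%:M.
Proof. by rewrite -trmx_mul PP trmx1. Qed.

Let inv_of (A B : 'M[C]_3) : A *m B = 1%:M -> invmx A = B.
Proof.
move=> AB; have [Au _] := mulmx1_unit AB.
by rewrite -[LHS]mulmx1 -AB mulKmx.
Qed.

Lemma sigma1E g : sigma g = P *m invmx g^T *m P.
Proof. by rewrite /sigma PmxE. Qed.

(** The two inverse transposes cancel, so the square is inner: conjugation by the diagonal matrix
    [P *m P^T], whose inverse is [P^T *m P] because [P] is an involution. *)
Lemma sigma2E g : g \in unitmx -> iter 2 (@sigma R) g = (P *m P^T) *m g *m (P^T *m P).
Proof.
move=> gu; rewrite /= !sigma1E !trmx_mul trmx_inv trmxK.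
rewrite (@inv_of _ (P^T *m g *m P^T)); first by rewrite !mulmxA.
by rewrite -!mulmxA (mulmxA P^T P^T) PTPT mul1mx mulKmx.
Qed.

Let L : 'M[C]_3 := mk 0 1 0 1 0 0 0 0 1.

Let PPTP : P *m P^T *m P = L.
Proof. by rewrite /P mk_tr !mk_mul !simp0 sq1 sq2 ee ee'. Qed.

Let LL : L *m L = 1%:M.
Proof. by rewrite /L mk_mul !simp0 mk_scalar. Qed.

(** One more inverse transpose restores the form of [sigma], with [P] replaced by P P^T P. There the
    powers of epsilon cancel and the swap [L] of the first two coordinates remains. *)
Lemma sigma3E g : g \in unitmx -> iter 3 (@sigma R) g = L *m invmx g^T *m L.
Proof.
move=> gu; rewrite iterS sigma2E// sigma1E.
have K1 : (P *m P^T) *m (P^T *m P) = 1%:M by rewrite mulmxA -(mulmxA P) PTPT mulmx1.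
have K2 : (P^T *m P) *m (P *m P^T) = 1%:M by rewrite mulmxA -(mulmxA P^T) PP mulmx1.
rewrite (@inv_of _ ((P^T *m P) *m invmx g^T *m (P *m P^T))).
  by rewrite !mulmxA PPTP -!mulmxA (mulmxA P) PPTP.
rewrite (_ : (_ *m g *m _)^T = (P^T *m P) *m g^T *m (P *m P^T)); last first.
  by rewrite !trmx_mul !trmxK !mulmxA.
rewrite -!(mulmxA (P^T *m P)) -(mulmxA g^T) (mulmxA (P *m P^T)) K1 mul1mx.
by rewrite mulKVmx ?unitmx_tr.
Qed.

Let e1 : 1 - e != 0.
Proof. by apply/eqP => h; move: ee'; rewrite -(opprB 1) h oppr0 mulr0 => /eqP; rewrite eq_sym oner_eq0. Qed.

Let e2 : 2 - e != 0.
Proof.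
apply/eqP => h; have : (2 - e) * (1 + e) = 2 + e - e ^+ 2 by ring.
rewrite h mul0r epsilon_eq; have -> : 2 + e - (e - 1) = 3%:R by ring.
by move/eqP; rewrite eq_sym pnatr_eq0.
Qed.

Let e3 : 1 - 2 * e != 0.
Proof.
apply/eqP => h; have : (1 - 2 * e) * (1 - 2 * e) = 1 - 4 * e + 4 * e ^+ 2 by ring.
rewrite h mul0r epsilon_eq; have -> : 1 - 4 * e + 4 * (e - 1) = - 3%:R by ring.
by move/eqP; rewrite eq_sym oppr_eq0 pnatr_eq0.
Qed.

Let e4 : 1 + e != 0.
Proof.
apply/eqP => h; have : (2 - e) * (1 + e) = 2 + e - e ^+ 2 by ring.
rewrite h mulr0 epsilon_eq; have -> : 2 + e - (e - 1) = 3%:R by ring.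
by move/eqP; rewrite eq_sym pnatr_eq0.
Qed.

Let cancel0 (k x : C) : k != 0 -> k * x = 0 -> x = 0.
Proof. by move=> k0 /eqP; rewrite mulf_eq0 (negPf k0) => /eqP. Qed.

(** The differential sends X to - P X^T P. It multiplies entry (0, 1) by epsilon, which is neither 1
    nor the eigenvalue 1 - epsilon of degree -1, and it exchanges entries (0, 2) and (2, 1) with the
    factor 1 - epsilon. Hence the former vanishes in degrees -1 and 0, and the latter two agree in
    degree -1. *)
Let eigen6 (l : C) X : has_velocity (fun t : R => sigma (1%:M + t%:C *: X)) 0 (l *: X) ->
  [/\ l * X o0 o1 = e * X o0 o1, l * X o2 o2 = - X o2 o2,
      l * X o0 o2 = (1 - e) * X o2 o1 & l * X o2 o1 = (1 - e) * X o0 o2].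
Proof.
move=> /(velocity_contragredient PP (fun g _ => sigma1E g)) h.
rewrite (mk_eta X) mk_tr /P !mkS !simp0 in h; move/matrixP: h => h.
have h01 := h o0 o1; have h22 := h o2 o2; have h02 := h o0 o2; have h21 := h o2 o1.
rewrite !mkE in h01 h22 h02 h21; split.
- rewrite h01; transitivity (- ((e - 1) * (e - 1)) * X o0 o1); first by ring.
  by rewrite sq1 opprK.
- exact: h22.
- by rewrite h02; ring.
- by rewrite h21; ring.
Qed.

Lemma eigen6_m1 X : eigen_sl3 (@sigma R) 6 (-1) X -> X o0 o1 = 0 /\ X o0 o2 = X o2 o1.
Proof.
rewrite /eigen_sl3 /= expi_m6 => -[_ /eigen6[h1 _ h3 _]]; split; last exact: (mulfI e1).
apply: (cancel0 e3); have -> : (1 - 2 * e) * X o0 o1 = (1 - e) * X o0 o1 - e * X o0 o1 by ring.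
by rewrite h1 subrr.
Qed.

Lemma eigen6_0 X : eigen_sl3 (@sigma R) 6 0 X ->
  [/\ X o0 o1 = 0, X o0 o2 = 0 & X o2 o1 = 0].
Proof.
rewrite /eigen_sl3 /= mulr0 mul0r expi0 => -[_ /eigen6[h1 _ h3 h4]].
rewrite !mul1r in h1 h3 h4.
have x02 : X o0 o2 = 0.
  apply: (cancel0 e4); rewrite mulrDl mul1r {1}h3 h4 mulrA.
  have -> : (1 - e) * (1 - e) = e ^+ 2 - 2 * e + 1 by ring.
  by rewrite epsilon_eq; ring.
split=> //; last by rewrite h4 x02 mulr0.
by apply: (cancel0 e1); rewrite mulrBl mul1r -h1 subrr.
Qed.

(** Conjugation by a diagonal matrix scales each entry. The factor epsilon - 1 at (0, 1) differs
    from the eigenvalues - epsilon and 1 of degrees -1 and 0. *)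
Let eigen3 (l : C) X : has_velocity (fun t : R => iter 2 (@sigma R) (1%:M + t%:C *: X)) 0 (l *: X) ->
  l * X o0 o1 = (e - 1) * X o0 o1.
Proof.
move=> /(velocity_conj sigma2E) h.
rewrite (mk_eta X) /P mk_tr !mkS !simp0 in h; move/matrixP/(_ o0 o1): h.
by rewrite !mkE => ->; rewrite sq1 mulrAC sq2.
Qed.

Lemma eigen3_m1 X : eigen_sl3 (iter 2 (@sigma R)) 3 (-1) X -> X o0 o1 = 0.
Proof.
rewrite /eigen_sl3 expi_m3 => -[_ /eigen3 h].
apply: (cancel0 e3); have -> : (1 - 2 * e) * X o0 o1 = - e * X o0 o1 - (e - 1) * X o0 o1 by ring.
by rewrite h subrr.
Qed.

Lemma eigen3_0 X : eigen_sl3 (iter 2 (@sigma R)) 3 0 X -> X o0 o1 = 0.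
Proof.
rewrite /eigen_sl3 mulr0 mul0r expi0 => -[_ /eigen3 h].
apply: (cancel0 e2); have -> : (2 - e) * X o0 o1 = 1 * X o0 o1 - (e - 1) * X o0 o1 by ring.
by rewrite h subrr.
Qed.

Let eigen2 (l : C) X : has_velocity (fun t : R => iter 3 (@sigma R) (1%:M + t%:C *: X)) 0 (l *: X) ->
  l *: X = - mk (X o1 o1) (X o0 o1) (X o2 o1) (X o1 o0) (X o0 o0) (X o2 o0)
     (X o1 o2) (X o0 o2) (X o2 o2).
Proof.
move=> /(velocity_contragredient LL sigma3E) ->; congr (- _).
by rewrite {1}(mk_eta X) mk_tr /L !mk_mul !simp0.
Qed.

Lemma eigen2_1 (m : int) X : m = 1 \/ m = -1 -> eigen_sl3 (iter 3 (@sigma R)) 2 m X ->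
  [/\ X o1 o1 = X o0 o0, X o2 o1 = X o0 o2, X o1 o2 = X o2 o0 & X o2 o2 = - 2 * X o0 o0].
Proof.
move=> mE; rewrite /eigen_sl3 (expi_2 mE) => -[tr0 /eigen2].
rewrite scaleN1r => /oppr_inj /matrixP h.
have x11 := h o0 o0; have x21 := h o0 o2; have x12 := h o2 o0; rewrite !mkE in x11 x21 x12.
(* The eigenvalue equation is void at entry (2, 2), whose value comes from the vanishing trace. *)
split=> //; move: tr0; rewrite /mxtrace sum3 -x11 => /eqP; rewrite addrC addr_eq0 => /eqP ->.
ring.
Qed.

Lemma eigen2_0 X : eigen_sl3 (iter 3 (@sigma R)) 2 0 X ->
  [/\ X o1 o1 = - X o0 o0, X o0 o1 = 0 & X o1 o0 = 0] /\
  [/\ X o2 o2 = 0, X o2 o1 = - X o0 o2 & X o1 o2 = - X o2 o0].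
Proof.
rewrite /eigen_sl3 mulr0 mul0r expi0 => -[_ /eigen2].
rewrite scale1r => /matrixP h.
have self (x : C) : x = - x -> x = 0.
  by move=> /eqP; rewrite -addr_eq0 -mulr2n mulrn_eq0 => /eqP.
have h00 := h o0 o0; have h01 := h o0 o1; have h10 := h o1 o0; have h22 := h o2 o2.
have h02 := h o0 o2; have h20 := h o2 o0.
rewrite mk_opp !mkE in h00 h01 h10 h22 h02 h20.
split; split; rewrite ?h00 ?h02 ?h20 ?opprK //; exact: self.
Qed.

End Eigenspaces.

(** * The structure equations for the involution *)

Section OrderTwo.
Variable R : realType.
Local Notation C := R[i].

(** Entry relations of the eigenspaces of the involution: [even_shape] for eigenvalue 1, [odd_shape]
    for eigenvalue -1. *)
Definition even_shape (X : 'M[C]_3) :=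
  [/\ X o1 o1 = - X o0 o0, X o0 o1 = 0 & X o1 o0 = 0] /\
  [/\ X o2 o2 = 0, X o2 o1 = - X o0 o2 & X o1 o2 = - X o2 o0].

Definition odd_shape (X : 'M[C]_3) :=
  [/\ X o1 o1 = X o0 o0, X o2 o1 = X o0 o2, X o1 o2 = X o2 o0 & X o2 o2 = - 2 * X o0 o0].

Lemma even_shape_adj X : even_shape X -> even_shape (- X^t*).
Proof.
move=> [[h1 h2 h3] [h4 h5 h6]]; split; split; rewrite !mxE ?h1 ?h2 ?h3 ?h4 ?h5 ?h6 ?rmorph0 ?oppr0 //.
- by rewrite rmorphN opprK.
- by rewrite rmorphN !opprK.
- by rewrite rmorphN !opprK.
Qed.

Lemma odd_shape_adj X : odd_shape X -> odd_shape (- X^t*).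
Proof.
move=> [h1 h2 h3 h4]; split; rewrite !mxE ?h1 ?h2 ?h3 ?h4 //.
by rewrite rmorphM rmorphN rmorph_nat mulrN.
Qed.

(** Entries linked by a sign in one shape are linked by the opposite sign in the other, so sum and
    difference separate the two parts. As both shapes are stable under minus the adjoint, this
    identifies the dzbar components as minus the adjoints of the dz components. *)
Lemma shape_unique (X X' Y Y' : 'M[C]_3) : even_shape X -> even_shape X' ->
  odd_shape Y -> odd_shape Y' -> X + Y = X' + Y' -> X = X' /\ Y = Y'.
Proof.
move=> [[a1 a2 a3] [a4 a5 a6]] [[b1 b2 b3] [b4 b5 b6]] [c1 c2 c3 c4] [d1 d2 d3 d4] /matrixP h.
have two : (2 : C) != 0 by rewrite pnatr_eq0.
have half (x x' y y' : C) : x + y = x' + y' -> - x + y = - x' + y' -> x = x' /\ y = y'.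
  move=> e1 e2; have ey : y = y'.
    apply: (mulfI two); have -> : 2 * y = (x + y) + (- x + y) by ring.
    by rewrite e1 e2; ring.
  by split=> //; move: e1; rewrite ey => /addIr.
have [x00 y00] : X o0 o0 = X' o0 o0 /\ Y o0 o0 = Y' o0 o0.
  apply: half; first by have := h o0 o0; rewrite !mxE.
  by have := h o1 o1; rewrite !mxE a1 b1 c1 d1.
have [x02 y02] : X o0 o2 = X' o0 o2 /\ Y o0 o2 = Y' o0 o2.
  apply: half; first by have := h o0 o2; rewrite !mxE.
  by have := h o2 o1; rewrite !mxE a5 b5 c2 d2.
have [x20 y20] : X o2 o0 = X' o2 o0 /\ Y o2 o0 = Y' o2 o0.
  apply: half; first by have := h o2 o0; rewrite !mxE.
  by have := h o1 o2; rewrite !mxE a6 b6 c3 d3.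
have XX : X = X'.
  apply/matrixP; apply: ord3P; apply: ord3P;
  by rewrite ?a1 ?a2 ?a3 ?a4 ?a5 ?a6 ?b1 ?b2 ?b3 ?b4 ?b5 ?b6 ?x00 ?x02 ?x20.
split=> //; apply/matrixP => i j; have := h i j; rewrite !mxE XX; exact: addrI.
Qed.

Lemma even_shapeE X : even_shape X -> X o2 o0 = 0 ->
  X = mk (X o0 o0) 0 (X o0 o2) 0 (- X o0 o0) 0 0 (- X o0 o2) 0.
Proof.
move=> [[a1 a2 a3] [a4 a5 a6]] a7; rewrite {1}(mk_eta X).
by rewrite a1 a2 a3 a4 a5 a6 a7 oppr0.
Qed.

Lemma odd_shapeE X : odd_shape X -> X o2 o0 = 0 ->
  X = mk (X o0 o0) (X o0 o1) (X o0 o2) (X o1 o0) (X o0 o0) 0 0 (X o0 o2) (- 2 * X o0 o0).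
Proof.
move=> [a1 a2 a3 a4] a5; rewrite {1}(mk_eta X).
by rewrite a1 a2 a3 a4 a5.
Qed.

(** Three coefficients are determined by three values; the points 1, -1 and 2 keep the linear
    algebra short. *)
Lemma laurent_coef (X Y Z : 'M[C]_3) :
  (forall l : C, l != 0 -> l^-1 *: X + Y + l *: Z = 0) -> X = 0 /\ Y = 0.
Proof.
move=> h.
have n1 : (-1 : C) != 0 by rewrite oppr_eq0 oner_eq0.
have n2' : (2 : C) != 0 by rewrite pnatr_eq0.
have n3 : (3 : C) != 0 by rewrite pnatr_eq0.
have /matrixP h1 := h 1 (oner_neq0 _); have /matrixP h2 := h (-1) n1.
have /matrixP h3 := h 2 n2'.
have E i j : X i j = 0 /\ Y i j = 0.
  have := h1 i j; have := h2 i j; have := h3 i j; rewrite !mxE.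
  rewrite invr1 invrN invr1; move: (X i j) (Y i j) (Z i j) => x y t e3 e2 e1.
  have y0 : y = 0.
    apply: (mulfI n2'); transitivity ((1 * x + y + 1 * t) + (-1 * x + y + -1 * t)); first by ring.
    by rewrite e1 e2; ring.
  split=> //; apply: (mulfI n3); transitivity (4 * (1 * x + y + 1 * t) - 2 * (2^-1 * x + y + 2 * t) - 2 * y).
    by field.
  by rewrite e1 e3 y0; ring.
by split; apply/matrixP => i j; rewrite mxE; have [] := E i j.
Qed.

Variable D : set C.
Hypothesis oD : open D.
Variables (F U : C -> 'M[C]_3).
Hypothesis Fz : forall z, D z -> invmx (F z) *m mdz F z = U z.
Hypothesis Fzb : forall z, D z -> invmx (F z) *m mdzbar F z = - (U z)^t*.
Hypothesis U12 : forall z, D z -> U z o1 o2 = 0.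
Hypothesis U20 : forall z, D z -> U z o2 o0 = 0.

Lemma order_two_structure : primitive_harmonic D (iter 3 (@sigma R)) 2 F ->
  exists w p s r u d : C -> C,
  [/\ [/\ csmooth D w, csmooth D p & csmooth D s],
      [/\ csmooth D r, csmooth D u & csmooth D d],
      forall z, D z ->
        U z = mk (u z + w z) (p z) (s z + d z) (r z) (- u z + w z) 0 0 (s z - d z) (- 2 * w z),
      forall z, D z ->
       [/\ Dw 'i%C w z = - (s z * Num.conj (d z)), w z * d z = 0 &
          Dw 'i%C s z = p z * Num.conj (d z) + Num.conj (u z) * s z] /\
       (Dw 'i%C p z = 2 * Num.conj (u z) * p z /\ Dw 'i%C r z = - 2 * Num.conj (u z) * r z) &
      (forall z, D z -> d z = 0) -> forall z, D z ->
        p z * Num.conj (s z) = 3 * s z * Num.conj (w z) /\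
        Dw 'i%C u z + Num.conj (Dw 'i%C u z) =
          r z * Num.conj (r z) - p z * Num.conj (p z) - s z * Num.conj (s z)].
Proof.
move=> [Am [A0 [A0' [A1 [[Ams A0s A0's A1s] eig FA MC]]]]].
have shapes z : D z -> [/\ odd_shape (Am z), even_shape (A0 z), even_shape (A0' z) & odd_shape (A1 z)].
  move=> Dz; have [h1 h2 h3 h4] := eig z Dz; split.
  - by apply: eigen2_1 h1; right.
  - exact: eigen2_0 h2.
  - exact: eigen2_0 h3.
  - by apply: eigen2_1 h4; left.
have UE z : D z -> U z = Am z + A0 z by move=> Dz; have [<- _] := FA z Dz; rewrite Fz.
have VE z : D z -> A0' z = - (A0 z)^t* /\ A1 z = - (Am z)^t*.
  move=> Dz; have [h1 h2 h3 h4] := shapes z Dz.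
  apply: shape_unique => //; [exact: even_shape_adj|exact: odd_shape_adj|].
  have [_ <-] := FA z Dz; rewrite Fzb// UE// -opprD; congr (- _).
  by apply/matrixP => i j; rewrite !mxE rmorphD addrC.
(* The entries (1, 2) and (2, 0) agree in the odd part and are opposite in the even part; both
   vanish in the sum, hence in each part. *)
have z20 z : D z -> Am z o2 o0 = 0 /\ A0 z o2 o0 = 0.
  move=> Dz; have [[_ _ h1 _] [_ [_ _ h2]] _ _] := shapes z Dz.
  have := U12 Dz; have := U20 Dz; rewrite UE// !mxE h1 h2.
  move: (Am z o2 o0) (A0 z o2 o0) => x y e1 e2.
  have n2' : (2 : C) != 0 by rewrite pnatr_eq0.
  have x0 : x = 0.
    apply: (mulfI n2'); transitivity ((x + y) + (x - y)); first by ring.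
    by rewrite e1 e2; ring.
  by split=> //; move: e1; rewrite x0 add0r.
pose w z := Am z o0 o0; pose p z := Am z o0 o1; pose s z := Am z o0 o2.
pose r z := Am z o1 o0; pose u z := A0 z o0 o0; pose d z := A0 z o0 o2.
have ws : csmooth D w by exact: Ams.
have ps : csmooth D p by exact: Ams.
have ss : csmooth D s by exact: Ams.
have rs : csmooth D r by exact: Ams.
have us : csmooth D u by exact: A0s.
have ds : csmooth D d by exact: A0s.
have AmE z : D z -> Am z = mk (w z) (p z) (s z) (r z) (w z) 0 0 (s z) (- 2 * w z).
  by move=> Dz; apply: odd_shapeE; [have [] := shapes z Dz|have [] := z20 z Dz].
have A0E z : D z -> A0 z = mk (u z) 0 (d z) 0 (- u z) 0 0 (- d z) 0.
  by move=> Dz; apply: even_shapeE; [have [] := shapes z Dz|have [] := z20 z Dz].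
(* The [l^-1] coefficient of the zero curvature equation, a Lax equation for [Am], and its constant
   coefficient. *)
have coefs z : D z ->
    Mw 'i%C Am z = Am z *m A0' z - A0' z *m Am z /\
    Mw (- 'i%C) A0' z - Mw 'i%C A0 z + ((Am z *m A1 z - A1 z *m Am z) +
      (A0 z *m A0' z - A0' z *m A0 z)) = 0.
  move=> Dz.
  have [|X0 Y0] := @laurent_coef
    (Am z *m A0' z - A0' z *m Am z - Mw 'i%C Am z)
    (Mw (- 'i%C) A0' z - Mw 'i%C A0 z + ((Am z *m A1 z - A1 z *m Am z) +
      (A0 z *m A0' z - A0' z *m A0 z)))
    (Mw (- 'i%C) A1 z + (A0 z *m A1 z - A1 z *m A0 z)).
    move=> l l0; have := MC l l0 z Dz; rewrite mdzE mdzbarE.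
    have lA : msmooth D (fun z => l *: A1 z) by apply: (msmoothZ oD) => //; exact: csmooth_cst.
    have lA' : msmooth D (fun z => l^-1 *: Am z) by apply: (msmoothZ oD) => //; exact: csmooth_cst.
    rewrite (MwD oD _ A0's lA Dz) (MwD oD _ lA' A0s Dz).
    rewrite (MwZ oD _ (csmooth_cst D l) A1s Dz) (MwZ oD _ (csmooth_cst D l^-1) Ams Dz) !Dw_cst !scale0r !add0r.
    move=> h; rewrite -[RHS]h {h}.
    rewrite !mulmxDl !mulmxDr -!scalemxAl -!scalemxAr scalerA mulVf// scale1r scalerA mulfV// scale1r.
    move: (Mw _ _ _) (Mw _ A0' z) (Mw _ A0 z) (Mw _ A1 z) => m1 m2 m3 m4.
    move: (_ *m _) (A0' z *m Am z) (A0 z *m A1 z) (A1 z *m A0 z) (Am z *m A1 z) (A1 z *m Am z)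
      (A0 z *m A0' z) (A0' z *m A0 z) => n1 n2 n3 n4 n5 n6 n7 n8.
    by apply/matrixP => i j; rewrite !mxE; ring.
  by split=> //; apply/eqP; rewrite eq_sym -subr_eq0; apply/eqP.
have MAm z : D z -> Mw 'i%C Am z = mk (Dw 'i%C w z) (Dw 'i%C p z) (Dw 'i%C s z)
    (Dw 'i%C r z) (Dw 'i%C w z) 0 0 (Dw 'i%C s z) (Dw 'i%C (fun z => - 2 * w z) z).
  by move=> Dz; rewrite (Mw_congr oD _ Dz AmE) Mw_mk !Dw_cst.
have MA0 z : D z -> Mw 'i%C A0 z = mk (Dw 'i%C u z) 0 (Dw 'i%C d z) 0 (Dw 'i%C (fun z => - u z) z)
    0 0 (Dw 'i%C (fun z => - d z) z) 0.
  by move=> Dz; rewrite (Mw_congr oD _ Dz A0E) Mw_mk !Dw_cst.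
exists w, p, s, r, u, d; split=> //.
- by move=> z Dz; rewrite UE// AmE// A0E// !mkS; congr mk; ring.
- move=> z Dz; have [/matrixP h _] := coefs z Dz; have [A0'E _] := VE z Dz.
  have h00 := h o0 o0; have h12 := h o1 o2; have h02 := h o0 o2.
  have h01 := h o0 o1; have h10 := h o1 o0.
  rewrite MAm// A0'E AmE// A0E// !mkS !mkE ?rmorph0 ?rmorphN ?simp0 ?opprK in h00 h12 h02 h01 h10.
  split; split.
  + by rewrite h00; ring.
  (* Entry (1, 2) of [Am] is identically zero, so its equation is algebraic: 3 w conj d = 0. *)
  + have n3 : (3 : C) != 0 by rewrite pnatr_eq0.
    have : w z * Num.conj (d z) = 0.
      by apply: (mulfI n3); rewrite mulr0 h12; ring.
    move=> /eqP; rewrite mulf_eq0 conjC_eq0 => /orP[] /eqP ->; by rewrite ?mul0r ?mulr0.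
  + by rewrite h02; ring.
  + by rewrite h01; ring.
  + by rewrite h10; ring.
- move=> d0 z Dz; have [_ /matrixP h] := coefs z Dz; have [A0'E A1E] := VE z Dz.
  have Dd : Dw 'i%C d z = 0 by rewrite (Dw_congr oD _ Dz d0) Dw_cst.
  have Dd' : Dw 'i%C (fun z => - d z) z = 0.
    by rewrite (Dw_congr oD (h := fun=> 0) _ Dz) ?Dw_cst// => y Dy; rewrite d0 ?oppr0.
  have MA0' : Mw (- 'i%C) A0' z = - (Mw 'i%C A0 z)^t*.
    rewrite (Mw_congr oD (G := fun y => - (A0 y)^t*) _ Dz); last by move=> y Dy; have [] := VE y Dy.
    by rewrite (MwN oD _ (msmoothJ oD A0s) Dz) (MwJ oD _ A0s Dz) conjNI.
  have z0 i j : (0 : 'M[C]_3) i j = 0 by rewrite mxE.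
  (* With [d = 0] the even part is diagonal, so entry (0, 2) of the constant coefficient contains no
     derivative, while entry (0, 0) is the curvature equation for [u]. *)
  have h00 := etrans (h o0 o0) (z0 _ _); have h02 := etrans (h o0 o2) (z0 _ _).
  rewrite MA0' MA0// A0'E A1E AmE// A0E// d0// Dd Dd' !mkS !mkE in h00 h02.
  rewrite ?rmorph0 ?rmorphM ?rmorphN ?rmorph_nat ?simp0 /= in h02.
  rewrite ?rmorph0 ?rmorphN ?simp0 in h00.
  split.
    apply/eqP; rewrite -subr_eq0; apply/eqP.
    apply: oppr_inj; rewrite oppr0 -[RHS]h02; ring.
  apply/eqP; rewrite -subr_eq0; apply/eqP; apply: oppr_inj; rewrite oppr0 -[RHS]h00; ring.
Qed.

End OrderTwo.

(** * The diagonal torus *)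

Section ImaginaryUnit.
Variable R : realType.
Local Notation C := R[i].

Lemma Re_iM (y : C) : Re ('i%C * y) = - Im y.
Proof. by rewrite mulrC ReiNIm. Qed.

Lemma Im_iM (y : C) : Im ('i%C * y) = Re y.
Proof. by rewrite mulrC ImiRe. Qed.

End ImaginaryUnit.

Section Torus.
Variable R : realType.
Local Notation C := R[i].
Variable Q : 'M[C]_3.
Hypothesis Qu : Q \is unitarymx.

Definition dgl (a b c : C) : 'M[C]_3 := Q *m mk a 0 0 0 b 0 0 0 c *m Q^t*.

Lemma dglM a b c a' b' c' : dgl a b c *m dgl a' b' c' = dgl (a * a') (b * b') (c * c').
Proof. by rewrite /dgl unitary_conjM// mk_mul !simp0. Qed.

Lemma dglD a b c a' b' c' : dgl a b c + dgl a' b' c' = dgl (a + a') (b + b') (c + c').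
Proof. by rewrite /dgl -mulmxDl -mulmxDr mk_add !simp0. Qed.

Lemma dglZ k a b c : k *: dgl a b c = dgl (k * a) (k * b) (k * c).
Proof. by rewrite /dgl scalemxAl scalemxAr mk_scale !simp0. Qed.

Lemma dglN a b c : - dgl a b c = dgl (- a) (- b) (- c).
Proof. by rewrite -scaleN1r dglZ !mulN1r. Qed.

Lemma dglJ a b c : (dgl a b c)^t* = dgl (Num.conj a) (Num.conj b) (Num.conj c).
Proof. by rewrite /dgl !adjM adjK mulmxA mk_adj !rmorph0. Qed.

Lemma dgl1 : dgl 1 1 1 = 1%:M.
Proof. by rewrite /dgl -mk_scalar mulmx1 unitary_mulJ. Qed.

Lemma dgl_tr a b c : \tr (dgl a b c) = a + b + c.
Proof. by rewrite /dgl mxtrace_mulC mulmxA unitary_Jmul// mul1mx mk_trace. Qed.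

Lemma dgl_det a b c : \det (dgl a b c) = a * b * c.
Proof.
rewrite /dgl !det_mulmx mk_det_diag mulrAC -det_mulmx unitary_mulJ// det1 mul1r //.
Qed.

Definition torus_algebra : set 'M[C]_3 := [set X | exists x y z : R,
  x + y + z = 0 /\ X = dgl ('i%C * x%:C) ('i%C * y%:C) ('i%C * z%:C)].

Definition torus_group : set 'M[C]_3 := [set g | exists a b c : C,
  [/\ nm a = 1, nm b = 1, nm c = 1, a * b * c = 1 & g = dgl a b c]].

Lemma conj_expi (x : R) : Num.conj (expi x) = expi (- x).
Proof. by apply: complexP; rewrite !ReIm /= ?cosN ?sinN. Qed.

Lemma expi_add (x y : R) : expi (x + y) = expi x * expi y.
Proof. by apply: complexP; rewrite !ReIm /= ?cosD ?sinD//; rewrite mulrC (mulrC (cos x)) addrC. Qed.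

Lemma nm_expi (x : R) : nm (expi x) = 1.
Proof.
apply/nm_unit; rewrite conj_expi -expi_add subrr /expi cos0 sin0 //.
Qed.

Lemma expi_surj (a : C) : nm a = 1 -> exists x : R, expi x = a.
Proof.
move=> a1; have n1 : Re a ^+ 2 + Im a ^+ 2 = 1.
  by have := n2_nm a; rewrite a1 expr1n.
have b1 : -1 <= Re a <= 1.
  have : `|Re a| <= 1 by rewrite -a1 Re_le_nm.
  by rewrite ler_norml.
have s2 : sin (acos (Re a)) = `|Im a|.
  rewrite sin_acos//; rewrite (_ : 1 - Re a ^+ 2 = Im a ^+ 2) ?sqrtr_sqr//.
  by rewrite -n1 addrAC subrr add0r.
have [i0|i0] := leP 0 (Im a).
  by exists (acos (Re a)); apply: complexP; rewrite /= ?acosK ?in_itv//= s2 ger0_norm.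
exists (- acos (Re a)); apply: complexP; rewrite /= ?cosN ?acosK ?in_itv//=.
by rewrite sinN s2 ltr0_norm// opprK.
Qed.

Lemma cder_expi (x t : R) : cder (fun s => expi (x * s)) t ('i%C * x%:C * expi (x * t)).
Proof.
have dx1 : is_derive t 1 (fun s : R => x * s) x.
  have h := is_deriveM (is_derive_cst x t 1) (is_derive_id t (1 : R)).
  by apply: (is_derive_eq h); rewrite /GRing.scale /= mulr1 mulr0 addr0.
have E : 'i%C * x%:C * expi (x * t) = (- sin (x * t) * x) +i* (cos (x * t) * x).
  apply: complexP.
    by rewrite -mulrA Re_iM Im_mul Re_real Im_real mul0r addr0 mulrC -mulNr.
  by rewrite -mulrA Im_iM Re_mul Re_real Im_real mul0r subr0 mulrC.
rewrite E; split; first exact: (is_derive1_comp (is_derive_cos (x * t)) dx1).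
exact: (is_derive1_comp (is_derive_sin (x * t)) dx1).
Qed.

Lemma conj_imag (x : R) : Num.conj ('i%C * x%:C : C) = - ('i%C * x%:C).
Proof.
have -> : Num.conj ('i%C * x%:C : C) = Num.conj 'i%C * Num.conj x%:C by rewrite rmorphM.
by rewrite conjI conj_real mulNr.
Qed.

Lemma imagB (x y : R) : 'i%C * (x - y)%:C = 'i%C * x%:C + - ('i%C * y%:C) :> C.
Proof. by rewrite (rmorphB (real_complex R)) mulrBr. Qed.

Lemma dgl_velocity (x y z t : R) :
  has_velocity (fun s => dgl (expi (x * s)) (expi (y * s)) (expi (z * s))) t
    (dgl ('i%C * x%:C) ('i%C * y%:C) ('i%C * z%:C) *m
     dgl (expi (x * t)) (expi (y * t)) (expi (z * t))).
Proof.
rewrite dglM /dgl.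
have hd : has_velocity (fun s : R => mk (expi (x * s)) 0 0 0 (expi (y * s)) 0 0 0 (expi (z * s))) t
   (mk ('i%C * x%:C * expi (x * t)) 0 0 0 ('i%C * y%:C * expi (y * t)) 0 0 0 ('i%C * z%:C * expi (z * t))).
  have c0 := @cder_cst R 0 t.
  have ent i j : cder (fun s : R => mk (expi (x * s)) 0 0 0 (expi (y * s)) 0 0 0 (expi (z * s)) i j) t
     (mk ('i%C * x%:C * expi (x * t)) 0 0 0 ('i%C * y%:C * expi (y * t)) 0 0 0 ('i%C * z%:C * expi (z * t)) i j).
    have sub (g h : R -> C) (a : C) : g =1 h -> cder h t a -> cder g t a by move=> /funext ->.
    move: i j; apply: ord3P; apply: ord3P; rewrite mkE; (apply: sub; first by move=> s; rewrite mkE);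
      by [exact: cder_expi|exact: c0].
  by move=> i j; exact: ent.
have := velocityM (velocityM (velocity_cst Q t) hd) (velocity_cst (Q^t*) t).
by rewrite mul0mx add0r mulmx0 addr0.
Qed.

Lemma dgl_comm a b c a' b' c' : dgl a b c *m dgl a' b' c' = dgl a' b' c' *m dgl a b c.
Proof. by rewrite !dglM; congr dgl; rewrite mulrC. Qed.

(** Uniqueness of the solution: multiplied by the explicit exponential curve of the opposite matrix,
    any solution has velocity zero, hence stays at its initial value 1. *)
Lemma torus_expmx (x y z : R) g :
  is_expmx (dgl ('i%C * x%:C) ('i%C * y%:C) ('i%C * z%:C)) g <->
  g = dgl (expi x) (expi y) (expi z).
Proof.
have e0 : expi 0 = 1 :> C by rewrite /expi cos0 sin0.
split=> [[c [c0 cX <-]]|->]; last first.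
  exists (fun s => dgl (expi (x * s)) (expi (y * s)) (expi (z * s))); split.
  - by rewrite !mulr0 e0 dgl1.
  - by move=> t; rewrite dgl_comm; exact: dgl_velocity.
  - by rewrite !mulr1.
pose E s := dgl (expi (- x * s)) (expi (- y * s)) (expi (- z * s)).
have y0 t : has_velocity (fun s => c s *m E s) t 0.
  have := velocityM (cX t) (dgl_velocity (- x) (- y) (- z) t).
  rewrite (_ : _ + _ = 0)//.
  rewrite -[X in X + _]mulmxA -mulmxDr -mulmxDl dglD.
  by rewrite !rmorphN !mulrN !subrr /dgl -mk0 mulmx0 mul0mx mul0mx mulmx0.
have := velocity_cst_eq 1 0 y0; rewrite c0 mul1mx /E !mulr0 !mulr1 e0 dgl1 => h.
rewrite -[LHS]mulmx1 -dgl1 -[X in _ = X]mul1mx -h -mulmxA dglM -!expi_add !addNr e0 //.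
Qed.

Lemma torus_lie_subgroup : lie_subgroup_SU3 torus_group torus_algebra.
Proof.
have mulH g g' : torus_group g -> torus_group g' -> torus_group (g *m g').
  move=> [a [b [c [a1 b1 c1 abc ->]]]] [a' [b' [c' [a1' b1' c1' abc' ->]]]].
  exists (a * a'), (b * b'), (c * c'); split; rewrite ?nmM ?a1 ?b1 ?c1 ?a1' ?b1' ?c1' ?mulr1 ?dglM//.
  by transitivity ((a * b * c) * (a' * b' * c')); [ring|rewrite abc abc' mulr1].
have oneH : torus_group 1%:M.
  by exists 1, 1, 1; split; rewrite ?nm1 ?mulr1 ?dgl1.
have subSU : torus_group `<=` @SU3 R.
  move=> g [a [b [c [a1 b1 c1 abc ->]]]]; split; last by rewrite dgl_det.
  apply/unitarymxP; rewrite dglJ dglM.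
  by rewrite ((nm_unit a).1 a1) ((nm_unit b).1 b1) ((nm_unit c).1 c1) dgl1.
split.
- split.
  + move=> X [x [y [z [xyz ->]]]]; split.
      by rewrite dglJ dglN !conj_imag.
    by rewrite dgl_tr -!mulrDr -!rmorphD /= xyz mulr0.
  + exists 0, 0, 0; split; first by rewrite !addr0.
    by rewrite mulr0 /dgl -mk0 mulmx0 mul0mx.
  + move=> X Y [x [y [z [xyz ->]]]] [x' [y' [z' [xyz' ->]]]].
    exists (x + x'), (y + y'), (z + z'); split.
      by transitivity ((x + y + z) + (x' + y' + z')); [ring|rewrite xyz xyz' addr0].
    by rewrite dglD !rmorphD /= !mulrDr.
  + move=> k X [x [y [z [xyz ->]]]]; exists (k * x), (k * y), (k * z); split.
      by rewrite -!mulrDr xyz mulr0.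
    by rewrite dglZ !rmorphM /=; congr dgl; rewrite mulrCA.
  + move=> X Y [x [y [z [_ ->]]]] [x' [y' [z' [_ ->]]]].
    rewrite dgl_comm subrr; exists 0, 0, 0; split; first by rewrite !addr0.
    by rewrite mulr0 /dgl -mk0 mulmx0 mul0mx.
- exact: subSU.
- split => // g Hg; have [gu _] := subSU g Hg; rewrite unitary_inv//.
  case: Hg => a [b [c [a1 b1 c1 abc ->]]].
  exists (Num.conj a), (Num.conj b), (Num.conj c); split; rewrite ?nm_conj ?dglJ//.
  by rewrite -!rmorphM abc rmorph1.
- move=> g [s [sX ->]]; elim: s sX => [|x s IH] sX; first by rewrite big_nil.
  rewrite big_cons; apply: mulH; last by apply: IH => y ys; apply: sX; rewrite inE ys orbT.
  have [X [u [v [t [uvt ->]]]] /torus_expmx ->] := sX x (mem_head _ _).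
  exists (expi u), (expi v), (expi t); split; rewrite ?nm_expi//.
  by rewrite -!expi_add uvt /expi cos0 sin0.
(* Every element of the torus is a single exponential, with third angle [- x - y] forced by the
   determinant, so one coset with representative 1 is enough. *)
- exists (fun=> 1%:M) => g [a [b [c [a1 b1 c1 abc gE]]]]; exists 0%N, g; split; last by rewrite mul1mx.
  have [x xa] := expi_surj a1; have [y yb] := expi_surj b1.
  exists [:: g]; split; last by rewrite big_seq1.
  move=> h; rewrite inE => /eqP ->.
  exists (dgl ('i%C * x%:C) ('i%C * y%:C) ('i%C * (- x - y)%:C)).
    by exists x, y, (- x - y); split => //; rewrite -opprD subrr.
  apply/torus_expmx; rewrite gE xa yb; congr dgl.
  have ab0 : a * b != 0 by rewrite -nm_eq0 nmM a1 b1 mulr1 oner_eq0.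
  apply: (mulfI ab0); rewrite abc -xa -yb -!expi_add -opprD subrr /expi cos0 sin0 //.
Qed.

(** In the basis [Q] the tangent vector of diag(i x, i y, i z) has entries i (x - y) v_0 conj v_1
    and similar ones. When no coordinate of [v] is zero, a zero tangent vector forces equal angles,
    and their sum is zero. So the tangent map is injective on this two-dimensional algebra. *)
Lemma torus_two_dim_orbit (v : 'cV[C]_3) :
  v o0 0 != 0 -> v o1 0 != 0 -> v o2 0 != 0 ->
  two_dim_orbit torus_algebra (Q *m (v *m v^t*) *m Q^t*).
Proof.
move=> v0 v1 v2.
pose X := dgl ('i%C * 1%:C) ('i%C * 0%:C) ('i%C * (-1)%:C).
pose Y := dgl ('i%C * 0%:C) ('i%C * 1%:C) ('i%C * (-1)%:C).
set p := Q *m _ *m _.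
have vv : v *m v^t* = mk (v o0 0 * Num.conj (v o0 0)) (v o0 0 * Num.conj (v o1 0)) (v o0 0 * Num.conj (v o2 0))
    (v o1 0 * Num.conj (v o0 0)) (v o1 0 * Num.conj (v o1 0)) (v o1 0 * Num.conj (v o2 0))
    (v o2 0 * Num.conj (v o0 0)) (v o2 0 * Num.conj (v o1 0)) (v o2 0 * Num.conj (v o2 0)).
  by apply/matrixP; apply: ord3P; apply: ord3P; rewrite mxE big_ord1 !mxE.
exists X, Y; split.
- by exists 1, 0, (-1); split => //; rewrite addr0 subrr.
- by exists 0, 1, (-1); split => //; rewrite add0r subrr.
move=> W [x [y [z [xyz WE]]]].
have zE : z = - x - y by apply/eqP; rewrite -subr_eq0 -opprD opprK addrC xyz.
have comb (k l : C) (A B : 'M[C]_3) : k *: (A *m p - p *m A) + l *: (B *m p - p *m B) =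
    (k *: A + l *: B) *m p - p *m (k *: A + l *: B).
  by rewrite mulmxDl mulmxDr -!scalemxAl -!scalemxAr !scalerBr opprD addrACA.
have sub4 (a b c d : 'M[C]_3) : a - b - (c - d) = (a - c) - (b - d).
  by rewrite !opprD !opprK addrACA.
have lin (s t : R) : s%:C *: (X *m p - p *m X) + t%:C *: (Y *m p - p *m Y) =
    dgl ('i%C * s%:C) ('i%C * t%:C) ('i%C * (- s - t)%:C) *m p -
    p *m dgl ('i%C * s%:C) ('i%C * t%:C) ('i%C * (- s - t)%:C).
  rewrite comb /X /Y !dglZ dglD.
  have -> : s%:C * ('i%C * 1%:C) + t%:C * ('i%C * 0%:C) = 'i%C * s%:C :> C.
    by rewrite rmorph0 rmorph1 !simp0 mulrC.
  have -> : s%:C * ('i%C * 0%:C) + t%:C * ('i%C * 1%:C) = 'i%C * t%:C :> C.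
    by rewrite rmorph0 rmorph1 !simp0 mulrC.
  have -> // : s%:C * ('i%C * (-1)%:C) + t%:C * ('i%C * (-1)%:C) = 'i%C * (- s - t)%:C :> C.
  by rewrite !rmorphD !rmorphN rmorph1 /=; ring.
exists (x, y); split; first by rewrite WE lin zE.
move=> [s t] /=; rewrite lin WE zE => h.
have {}h : dgl ('i%C * (x - s)%:C) ('i%C * (y - t)%:C) ('i%C * (- (x - s) - (y - t))%:C) *m p -
    p *m dgl ('i%C * (x - s)%:C) ('i%C * (y - t)%:C) ('i%C * (- (x - s) - (y - t))%:C) = 0.
  have -> : dgl ('i%C * (x - s)%:C) ('i%C * (y - t)%:C) ('i%C * (- (x - s) - (y - t))%:C) =
    dgl ('i%C * x%:C) ('i%C * y%:C) ('i%C * (- x - y)%:C) -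
    dgl ('i%C * s%:C) ('i%C * t%:C) ('i%C * (- s - t)%:C).
    have e3 : - (x - s) - (y - t) = (- x - y) - (- s - t) by ring.
    rewrite dglN dglD e3 (imagB x s) (imagB y t).
    by rewrite (imagB (- x - y) (- s - t)).
  rewrite mulmxBl mulmxBr sub4 h; exact: subrr.
set a := x - s in h; set b := y - t in h.
have {}h : mk ('i%C * a%:C) 0 0 0 ('i%C * b%:C) 0 0 0 ('i%C * (- a - b)%:C) *m (v *m v^t*) -
   (v *m v^t*) *m mk ('i%C * a%:C) 0 0 0 ('i%C * b%:C) 0 0 0 ('i%C * (- a - b)%:C) = 0.
  apply: (unitary_conj_inj Qu); rewrite mulmxBr mulmxBl mulmx0 mul0mx -h /dgl /p.
  by rewrite !unitary_conjM.
rewrite vv !mkS !simp0 mk0 in h; move/matrixP: h => h.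
have h01 := h o0 o1; have h02 := h o0 o2; rewrite !mkE in h01 h02.
have i0 : 'i%C != 0 :> C by rewrite eq_complex /= oner_eq0 andbF.
have fin (k l m n : C) : m != 0 -> n != 0 ->
    'i%C * k * (m * Num.conj n) - m * Num.conj n * ('i%C * l) = 0 -> k = l.
  move=> m0 n0 e; have nz : 'i%C * (m * Num.conj n) != 0 by rewrite !mulf_neq0// conjC_eq0.
  apply/eqP; rewrite -subr_eq0; apply/eqP; apply: (mulfI nz); rewrite mulr0 -e; ring.
have ab := complexI (fin _ _ _ _ v0 v1 h01); have ac := complexI (fin _ _ _ _ v0 v2 h02).
have a0 : a = 0.
  by move: ac; rewrite -ab => e; apply/eqP; move: e; clear; move: a => a e; apply/eqP; lra.
have b0 : b = 0 by rewrite -ab.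
by move/eqP: a0; move/eqP: b0; rewrite /a /b !subr_eq0 => /eqP -> /eqP ->.
Qed.

End Torus.

(** * Harmonicity of the logarithm of a holomorphic modulus *)

Section LogModulus.
Variable R : realType.
Local Notation C := R[i].

(** No branch of log w is chosen: its derivative [m], the quotient of w_x by [w], is available
    directly, with f_x = 2 Re m and f_y = - 2 Im m. The claim is a Cauchy-Riemann equation for
    [m]. *)
Lemma log_modulus_harmonic (D : set C) (w : C -> C) (f : C -> R) (k : R) z :
  open D -> csmooth D w -> (forall y, D y -> w y != 0) ->
  (forall y, D y -> Dw 'i%C w y = 0) -> 0 < k ->
  (forall y, D y -> f y = ln (k * n2 (w y))) -> D z ->
  dx (dx f) z + dy (dy f) z = 0.
Proof.
move=> oD ws w0 hol k0 fE Dz.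
pose m y := cpd true w y * (w y)^-1.
have ms : csmooth D m.
  by apply: (csmoothM oD); [exact: csmooth_cpd|exact: csmoothV].
have wxy y : D y -> cpd false w y = 'i%C * cpd true w y.
  move=> Dy; have := hol y Dy; rewrite Dw_def => /eqP.
  rewrite mulf_eq0 invr_eq0 pnatr_eq0 /= addr_eq0 => /eqP ->.
  by rewrite mulrN mulrA -expr2 sqr_i mulN1r opprK.
have pdf b y : D y -> pd b f y = 2 * Re (cpd b w y * (w y)^-1).
  move=> Dy; rewrite (@pd_congr _ b f (fun y => ln (k * n2 (w y)))); last first.
    by apply: (@filterS _ (nbhs y) _ _ _ _ (open_near oD Dy)) => t /fE.
  have [d1 d2] := csmooth_cder b ws Dy.
  have n0 : 0 < n2 (w y) by exact: normc2_gt0 (w0 y Dy).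
  have dn : is_derive (coor b y) 1 (fun t => k * n2 (w (line b y t)))
      (k * (2 * (Re (w y) * Re (cpd b w y) + Im (w y) * Im (cpd b w y)))).
    rewrite (_ : (fun t => _) = cst k * ((fun t => Re (w (line b y t))) * (fun t => Re (w (line b y t))) +
       (fun t => Im (w (line b y t))) * (fun t => Im (w (line b y t))))); last first.
      by apply/funext => t; rewrite /n2 !expr2.
    apply: (is_derive_eq (is_deriveM (is_derive_cst _ _ _)
      (is_deriveD (is_deriveM d1 d1) (is_deriveM d2 d2)))).
    rewrite /GRing.scale /= line_coor.
    move: (Re (w y)) (Im (w y)) (Re (cpd b w y)) (Im (cpd b w y)).
    by move=> x1 x2 x3 x4; ring.
  have p0 : 0 < k * n2 (w (line b y (coor b y))) by rewrite line_coor mulr_gt0.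
  have h := @is_derive1_comp R (@ln R) (fun t => k * n2 (w (line b y t))) (coor b y) _ _ (is_derive1_ln p0) dn.
  rewrite (@pd_val _ b (fun y => ln (k * n2 (w y))) y _ h).
  rewrite line_coor invfM.
  have -> : (w y)^-1 = Num.conj (w y) * ((n2 (w y))^-1)%:C.
    have wy0 := w0 y Dy; apply: (mulfI wy0); rewrite mulfV// mulrA n2E -rmorphM /=.
    by rewrite divff ?gt_eqF.
  rewrite !ReIm; have k0' : k != 0 by rewrite gt_eqF.
  have n0' : n2 (w y) != 0 by rewrite gt_eqF.
  by field; rewrite n0' k0'.
have pdx y : D y -> dx f y = 2 * Re (m y) by move=> /(pdf true).
have pdy y : D y -> dy f y = - 2 * Im (m y).
  move=> Dy; have := pdf false y Dy; rewrite wxy// -mulrA -/(m y) Re_iM => e.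
  by rewrite -[LHS]/(pd false f y) e; ring.
have D2 b (g : C -> R) (c : R) (h : C -> R) : (forall y, D y -> g y = c * h y) -> smooth D h ->
    pd b g z = c * pd b h z.
  move=> gh hs; rewrite (@pd_congr _ b g (fun y => c * h y)); last first.
    by apply: (@filterS _ (nbhs z) _ _ _ _ (open_near oD Dz)) => t /gh.
  apply: pd_val; have h' := is_deriveM (is_derive_cst c (coor b z) 1) (smooth_is_derive b hs Dz).
  by apply: (is_derive_eq h'); rewrite /GRing.scale /= mulr0 addr0.
have [m1 m2] := ms.
have e1 : dx (dx f) z = 2 * pd true (fun y => Re (m y)) z := D2 true _ _ _ pdx m1.
have e2 : dy (dy f) z = - 2 * pd false (fun y => Im (m y)) z := D2 false _ _ _ pdy m2.
(* [m] is holomorphic because [m w] is the z-derivative of [w], whose zbar-derivative vanishes by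
   commutation. *)
have mz : Dw 'i%C m z = 0.
  have mw : forall y, D y -> m y * w y = Dw (- 'i%C) w y.
    move=> y Dy; rewrite /m mulrVK ?unitfE ?w0// Dw_def wxy// mulrA mulNr -expr2 sqr_i opprK mul1r.
    by move: (cpd true w y) => x; field.
  have : Dw 'i%C (fun y => m y * w y) z = 0.
    rewrite (Dw_congr oD _ Dz mw) (Dw_comm oD _ _ ws Dz) (Dw_congr oD (h := fun=> 0) _ Dz) ?Dw_cst//.
  rewrite (DwM _ ms ws Dz) hol// mulr0 addr0 => /eqP.
  by rewrite mulf_eq0 (negPf (w0 z Dz)) orbF => /eqP.
have : Re (cpd true m z + 'i%C * cpd false m z) = 0.
  move: mz; rewrite Dw_def => /eqP; rewrite mulf_eq0 invr_eq0 pnatr_eq0 /= => /eqP h.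
  exact: (congr1 (@complex.Re R) h).
rewrite Re_add Re_iM => e3.
by rewrite e1 e2 mulNr -mulrBr e3 mulr0.
Qed.

End LogModulus.

(** * The flat case *)

Section UnitaryFrames.
Variable R : realType.
Local Notation C := R[i].
Variable D : set C.
Hypothesis oD : open D.

Lemma conj_NJ (x y : C) : Num.conj (- Num.conj x * y) = - x * Num.conj y.
Proof. by rewrite rmorphM rmorphN /= conjCK. Qed.

Lemma conj_mul (x y : C) : Num.conj (x * y) = Num.conj x * Num.conj y.
Proof. exact: rmorphM. Qed.

(** Differentiating F F^t* = 1 in [z] determines the zbar-derivative of a unitary frame from its
    z-derivative. *)
Lemma unitary_Mw_zbar (F : C -> 'M[C]_3) (B : 'M[C]_3) z : msmooth D F ->
  (forall z, D z -> F z \is unitarymx) -> D z ->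
  Mw (- 'i%C) F z = F z *m B -> Mw 'i%C F z = - (F z *m B^t*).
Proof.
move=> Fs Fu Dz FB.
have := Mw_congr oD (- 'i%C) Dz (fun y Dy => unitary_mulJ (Fu y Dy)).
rewrite Mw_cst (MwM oD _ Fs (msmoothJ oD Fs) Dz) (MwJ oD _ Fs Dz) conjNI FB.
rewrite -mulmxA -mulmxDr => /(congr1 (mulmx ((F z)^t*))).
rewrite mulmxA unitary_Jmul ?Fu// mul1mx mulmx0 => /eqP; rewrite addrC addr_eq0 => /eqP h.
by rewrite -[LHS]adjK h adjN adjM adjK.
Qed.

(** The derivative is a commutator of diagonal matrices, hence zero, even when the eigenvalues [l0],
    [l1], [l2] vary with the point. *)
Lemma diagonal_frame_constant (G : C -> 'M[C]_3) (l0 l1 l2 : C -> C) (a b c : C) :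
  connected D -> msmooth D G -> (forall z, D z -> G z \is unitarymx) ->
  (forall z, D z -> Mw (- 'i%C) G z = G z *m mk (l0 z) 0 0 0 (l1 z) 0 0 0 (l2 z)) ->
  forall z0 z, D z0 -> D z ->
  G z *m mk a 0 0 0 b 0 0 0 c *m (G z)^t* = G z0 *m mk a 0 0 0 b 0 0 0 c *m (G z0)^t*.
Proof.
move=> cD Gs Gu Gz z0 z Dz0 Dz; set A := mk a _ _ _ _ _ _ _ _.
have GAs : msmooth D (fun y => G y *m A) by apply: (msmoothM oD) => //; exact: msmooth_cst.
have MA s y : D y -> Mw s (fun y => G y *m A *m (G y)^t*) y =
    Mw s G y *m A *m (G y)^t* + G y *m A *m (Mw (Num.conj s) G y)^t*.
  move=> Dy; rewrite (MwM oD _ GAs (msmoothJ oD Gs) Dy) (MwM oD _ Gs (msmooth_cst D A) Dy).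
  by rewrite Mw_cst mulmx0 addr0 (MwJ oD _ Gs Dy).
have GAJs : msmooth D (fun y => G y *m A *m (G y)^t*).
  by apply: (msmoothM oD) => //; exact: (msmoothJ oD).
have Gzb y : D y -> Mw 'i%C G y = - (G y *m (mk (l0 y) 0 0 0 (l1 y) 0 0 0 (l2 y))^t*).
  by move=> Dy; apply: unitary_Mw_zbar (Gz y Dy).
apply: (Mw_eq0_constant oD cD GAJs _ _ Dz0 Dz) => y Dy.
  rewrite MA// conjNI Gz// Gzb// adjN adjM adjK mulmxN -!mulmxA -mulmxBr.
  rewrite !mulmxA -mulmxBl /A !mk_mul !simp0 (mulrC a) (mulrC b) (mulrC c).
  by rewrite subrr mul0mx mulmx0.
rewrite MA// conjI Gz// Gzb// adjM !mulNmx -!mulmxA addrC -mulmxBr.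
rewrite !mulmxA -mulmxBl /A mk_adj !mk_mul !rmorph0 !simp0 (mulrC a) (mulrC b) (mulrC c).
by rewrite subrr mul0mx mulmx0.
Qed.

(** The rows of [W] are left eigenvectors. If the last entry of a row is zero, the last column of
    the equation kills its first entry and then the first column kills its second, but a row of a
    unitary matrix is not zero. This supplies the non-zero coordinates that make the torus orbit
    two-dimensional. *)
Lemma last_column_neq0 (W : 'M[C]_3) (l0 l1 l2 k c : C) :
  W \is unitarymx -> k != 0 -> c != 0 ->
  W *m mk 1 3 c k 1 0 0 c (- 2) = mk l0 0 0 0 l1 0 0 0 l2 *m W ->
  forall j, W j o2 != 0.
Proof.
move=> Wu k0 c0 /matrixP h j; apply/eqP => wj2.
have [l lE] : exists l, forall i, (mk l0 0 0 0 l1 0 0 0 l2 *m W) j i = l * W j i.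
  move: j {wj2}; apply: ord3P; [exists l0|exists l1|exists l2] => i;
  by rewrite mxE sum3 !mkE !simp0.
have wj0 : W j o0 = 0.
  apply: (mulIf c0); rewrite mul0r.
  by have := h j o2; rewrite lE wj2 mulr0 mxE sum3 !mkE wj2 !simp0.
have wj1 : W j o1 = 0.
  apply: (mulIf k0); rewrite mul0r.
  by have := h j o0; rewrite lE wj0 mulr0 mxE sum3 !mkE wj0 !simp0.
have /matrixP/(_ j j) := unitary_mulJ Wu.
rewrite !mxE sum3 wj0 wj1 wj2 !mul0r !addr0 eqxx.
by move/eqP; rewrite eq_sym oner_eq0.
Qed.

(** The transition matrix [T] commutes with every diagonal matrix, so it is diagonal itself;
    unitarity and the equal determinants give the rest. *)
Lemma unitary_diagonal_transition (P Q : 'M[C]_3) :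
  P \is unitarymx -> Q \is unitarymx -> \det Q = \det P ->
  (forall a b c, Q *m mk a 0 0 0 b 0 0 0 c *m Q^t* = P *m mk a 0 0 0 b 0 0 0 c *m P^t*) ->
  exists a b d : C, [/\ nm a = 1, nm b = 1, nm d = 1, a * b * d = 1 & Q = P *m mk a 0 0 0 b 0 0 0 d].
Proof.
move=> Pu Qu dPQ h; pose T := P^t* *m Q.
have GT : Q = P *m T by rewrite /T mulmxA unitary_mulJ// mul1mx.
have comm a b d : T *m mk a 0 0 0 b 0 0 0 d = mk a 0 0 0 b 0 0 0 d *m T.
  move: (h a b d); move: (mk _ _ _ _ _ _ _ _ _) => X hX.
  have e : Q *m X = P *m X *m T.
    by rewrite -[LHS]mulmx1 -(unitary_Jmul Qu) mulmxA hX /T mulmxA.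
  by rewrite {1}/T -mulmxA e !mulmxA (unitary_Jmul Pu) mul1mx.
have TT : T *m T^t* = 1%:M.
  by rewrite /T adjM adjK mulmxA -(mulmxA _ Q) unitary_mulJ// mulmx1 unitary_Jmul.
have dT : \det T = 1.
  by rewrite /T det_mulmx dPQ -det_mulmx unitary_Jmul// det1.
move: T => T in GT comm TT dT *.
(* Commuting with two of the coordinate projectors already annihilates all six off-diagonal
   entries. *)
have /matrixP c1 := comm 1 0 0; have /matrixP c2 := comm 0 1 0.
have t01 := c1 o0 o1; have t02 := c1 o0 o2; have t10 := c1 o1 o0; have t20 := c1 o2 o0.
have t12 := c2 o1 o2; have t21 := c2 o2 o1.
rewrite (mk_eta T) !mk_mul !mkE !simp0 in t01 t02 t10 t20 t12 t21.
have TE : T = mk (T o0 o0) 0 0 0 (T o1 o1) 0 0 0 (T o2 o2).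
  by rewrite {1}(mk_eta T) -t01 -t02 t10 t20 -t12 t21.
rewrite TE mk_adj mk_mul !rmorph0 !simp0 in TT; move/matrixP: TT => TT.
have n0 := TT o0 o0; have n1 := TT o1 o1; have n2' := TT o2 o2.
rewrite mk_scalar !mkE in n0 n1 n2'.
exists (T o0 o0), (T o1 o1), (T o2 o2); split; try exact/nm_unit.
  by rewrite -mk_det_diag -TE.
by rewrite -TE.
Qed.

Lemma outer_reframe (P A W E : 'M[C]_3) : W \is unitarymx -> A *m E *m A^t* = E ->
  P *m E *m P^t* = (P *m A *m W^t*) *m (W *m E *m W^t*) *m (P *m A *m W^t*)^t*.
Proof.
move=> Wu; have := unitary_Jmul Wu; rewrite !adjM adjK.
move: (W^t*) (A^t*) (P^t*) => V B Q e AE; rewrite !mulmxA.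
by rewrite -(mulmxA _ V W) e mulmx1 -(mulmxA _ V W) e mulmx1 -{1}AE !mulmxA.
Qed.

Lemma frame_change (P A B N M W L : 'M[C]_3) (a : C) : N *m A + B = a *: (A *m M) ->
  M *m W = W *m L ->
  (P *m N *m A + P *m B) *m W = P *m A *m W *m (a *: L).
Proof.
move=> e1 e2; rewrite -(mulmxA P) -mulmxDr e1 -scalemxAr -scalemxAl -scalemxAr.
by rewrite -!mulmxA e2.
Qed.

Lemma conj_orbit (Q T X : 'M[C]_3) : Q \is unitarymx ->
  Q *m T *m X *m (Q *m T)^t* = (Q *m T *m Q^t*) *m (Q *m X *m Q^t*) *m (Q *m T *m Q^t*)^t*.
Proof.
move=> Qu; have := unitary_Jmul Qu; rewrite !adjM adjK.
move: (Q^t*) (T^t*) => J S e; rewrite !mulmxA.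
by rewrite -(mulmxA _ J Q) e mulmx1 -(mulmxA _ J Q) e mulmx1.
Qed.

End UnitaryFrames.

(** * Reduction to a constant normal matrix *)

Section FlatCase.

Variable R : realType.
Local Notation C := R[i].
Variable D : set C.
Hypothesis oD : open D.
Hypothesis cD : connected D.
Variables (F : C -> 'M[C]_3) (w p s r u : C -> C).
Hypothesis Fs : msmooth D F.
Hypothesis FSU : forall z, D z -> SU3 (F z).
Let U z : 'M[C]_3 := mk (u z + w z) (p z) (s z) (r z) (- u z + w z) 0 0 (s z) (- 2 * w z).
Hypothesis Fz : forall z, D z -> Mw (- 'i%C) F z = F z *m U z.
Hypothesis Fzb : forall z, D z -> Mw 'i%C F z = - (F z *m (U z)^t*).
Hypotheses (ws : csmooth D w) (ps : csmooth D p) (ss : csmooth D s).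
Hypotheses (rs : csmooth D r) (us : csmooth D u).
Hypothesis s0 : forall z, D z -> s z != 0.
Hypothesis w_zb : forall z, D z -> Dw 'i%C w z = 0.
Hypothesis s_zb : forall z, D z -> Dw 'i%C s z = Num.conj (u z) * s z.
Hypothesis p_zb : forall z, D z -> Dw 'i%C p z = 2 * Num.conj (u z) * p z.
Hypothesis r_zb : forall z, D z -> Dw 'i%C r z = - 2 * Num.conj (u z) * r z.
Hypothesis ps_eq : forall z, D z -> p z * Num.conj (s z) = 3 * s z * Num.conj (w z).
Hypothesis u_zb : forall z, D z -> Dw 'i%C u z + Num.conj (Dw 'i%C u z) =
  r z * Num.conj (r z) - p z * Num.conj (p z) - s z * Num.conj (s z).

Let q z := w z * (s z)^-1.

Let qs : csmooth D q. Proof. by apply: (csmoothM oD) => //; exact: csmoothV. Qed.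

Let qE z : D z -> q z * s z = w z.
Proof. by move=> Dz; rewrite /q divfK ?s0. Qed.

Let q_zb z : D z -> Dw 'i%C q z = - Num.conj (u z) * q z.
Proof.
move=> Dz; have := Dw_congr oD 'i%C Dz qE; rewrite (DwM _ qs ss Dz) w_zb// s_zb// => h.
apply: (mulIf (s0 Dz)); apply/eqP; rewrite -subr_eq0; apply/eqP; rewrite -[RHS]h; ring.
Qed.

Let pE z : D z -> p z = 3 * s z * Num.conj (q z).
Proof.
move=> Dz; have sz : Num.conj (s z) != 0 by rewrite conjC_eq0 s0.
by apply: (mulIf sz); rewrite ps_eq// -(qE Dz) rmorphM /= mulrA.
Qed.

(** Comes from the zbar-derivative of p = 3 s conj q: the equation for [p] contributes 2 conj u,
    that for [s] only conj u, so conj q must supply the other conj u. Conjugation turns this into a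
    z-derivative of [q]. *)
Let q_z z : D z -> Dw (- 'i%C) q z = u z * q z.
Proof.
move=> Dz; have cqs := csmoothJ oD qs.
have := Dw_congr oD 'i%C Dz pE.
have s3 : csmooth D (fun y => 3 * s y) by apply: (csmoothM oD) => //; exact: csmooth_cst.
rewrite (DwM _ s3 cqs Dz) (DwMc _ _ ss Dz) (DwJ _ qs Dz) conjI p_zb// s_zb// pE// => h.
have n3 : 3 * s z != 0 by rewrite mulf_neq0 ?s0// pnatr_eq0.
have : Num.conj (Dw (- 'i%C) q z) = Num.conj (u z * q z).
  have -> : Num.conj (u z * q z) = Num.conj (u z) * Num.conj (q z) by exact: rmorphM.
  move: h; set x := Num.conj (Dw (- 'i%C) q z); set y := Num.conj (u z); set t := Num.conj (q z).
  move: x y t => x y t h.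
  apply: (mulfI n3); apply/eqP; rewrite -subr_eq0; apply/eqP.
  transitivity (3 * (y * s z) * t + 3 * s z * x - 2 * y * (3 * s z * t)); first by ring.
  by rewrite -h subrr.
by move/(can_inj conjCK).
Qed.

Let q_norm z0 z : D z0 -> D z -> q z * Num.conj (q z) = q z0 * Num.conj (q z0).
Proof.
move=> Dz0 Dz; have cqs := csmoothJ oD qs.
apply: (Dw_eq0_constant oD cD (csmoothM oD qs cqs) _ _ Dz0 Dz) => y Dy.
  rewrite (DwM _ qs cqs Dy) (DwJ _ qs Dy) conjNI q_z// q_zb// conj_NJ.
  by move: (Num.conj _) => x; ring.
rewrite (DwM _ qs cqs Dy) (DwJ _ qs Dy) conjI q_z// q_zb// conj_mul.
by move: (q y) (Num.conj (q y)) (Num.conj (u y)) => t x x'; ring.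
Qed.

Lemma minimal_or_nonvanishing :
  (forall z, D z -> p z = 0) \/ (forall z, D z -> w z != 0).
Proof.
have [[z0 [Dz0 w0]]|h] := pselect (exists z, D z /\ w z = 0); last first.
  by right => z Dz; apply/eqP => w0; apply: h; exists z.
have qz0 : q z0 = 0 by rewrite /q w0 mul0r.
left => z Dz; have := q_norm Dz0 Dz; rewrite qz0 mul0r => /eqP.
by rewrite mulf_eq0 conjC_eq0 orbb => /eqP qz; rewrite pE// qz rmorph0 mulr0.
Qed.

Hypothesis w0 : forall z, D z -> w z != 0.
Variable z0 : C.
Hypothesis Dz0 : D z0.

Let q0 z : D z -> q z != 0.
Proof. by move=> Dz; rewrite /q mulf_neq0 ?w0// invr_eq0 s0. Qed.

Let c : R := nm (q z0).

Let c0 : 0 < c.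
Proof. by rewrite lt_neqAle nm_ge0 andbT eq_sym nm_eq0 q0. Qed.

Let ci : C := (c^-1)%:C.

Let qci z : D z -> q z * Num.conj (q z) * (ci * ci) = 1.
Proof.
move=> Dz; rewrite (q_norm Dz0 Dz); apply: normalize_unit; exact: lt0r_neq0 c0.
Qed.

Let ciJ : Num.conj ci = ci. Proof. exact: conj_real. Qed.

(* [A0 = diag (al, conj al, 1)] is the gauge for which [(F A0)_z = w F A0 Ut], with [Ut] a
   constant normal matrix. *)
Let al z := Num.conj (q z) * ci.

Let als : csmooth D al.
Proof. by apply: (csmoothM oD); [exact: (csmoothJ oD)|exact: csmooth_cst]. Qed.

Let alJ z : Num.conj (al z) = q z * ci.
Proof. by rewrite /al rmorphM /= conjCK ciJ. Qed.

Let al1 z : D z -> al z * Num.conj (al z) = 1.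
Proof. by move=> Dz; rewrite alJ -(qci Dz) /al; ring. Qed.

Let al_D (e : C) z : D z -> Dw e al z = Num.conj (Dw (Num.conj e) q z) * ci.
Proof.
move=> Dz; rewrite (DwM _ (csmoothJ oD qs) (csmooth_cst D ci) Dz) Dw_cst mulr0 addr0.
by rewrite (DwJ _ qs Dz).
Qed.

Let al_z z : D z -> Dw (- 'i%C) al z = - u z * al z.
Proof.
by move=> Dz; rewrite al_D// conjNI q_zb// conj_NJ /al mulrA.
Qed.

Let al_zb z : D z -> Dw 'i%C al z = Num.conj (u z) * al z.
Proof. by move=> Dz; rewrite al_D// conjI q_z// conj_mul -mulrA. Qed.

Let al0 z : D z -> al z != 0.
Proof.
move=> Dz; apply/eqP => h; have := al1 Dz; rewrite h mul0r => /eqP.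
by rewrite eq_sym oner_eq0.
Qed.

(** Equality of the mixed derivatives of [al], whose two first derivatives are - u al and conj u al,
    after cancelling the non-zero [al]. *)
Let curl_u z : D z -> Dw 'i%C u z + Num.conj (Dw 'i%C u z) = 0.
Proof.
move=> Dz; have uJs := csmoothJ oD us; have uNs := csmoothN oD us.
have e1 : Dw 'i%C (Dw (- 'i%C) al) z = - Dw 'i%C u z * al z - u z * (Num.conj (u z) * al z).
  rewrite (Dw_congr oD _ Dz al_z) (DwM _ uNs als Dz) (DwN oD _ us Dz) al_zb//.
  by rewrite (mulNr (u z)).
have e2 : Dw (- 'i%C) (Dw 'i%C al) z = Num.conj (Dw 'i%C u z) * al z - Num.conj (u z) * (u z * al z).
  rewrite (Dw_congr oD _ Dz al_zb) (DwM _ uJs als Dz) (DwJ _ us Dz) conjNI al_z//.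
  by rewrite mulNr mulrN.
have e3 : Dw 'i%C (Dw (- 'i%C) al) z = Dw (- 'i%C) (Dw 'i%C al) z by exact: (Dw_comm oD _ _ als Dz).
have key (x y t a b : C) : - y * a - b * (t * a) = x * a - t * (b * a) -> (y + x) * a = 0.
  move=> e; transitivity ((x * a - t * (b * a)) - (- y * a - b * (t * a))); first by ring.
  by rewrite e subrr.
rewrite e1 e2 in e3; apply: (mulIf (al0 Dz)); rewrite mul0r; exact: key e3.
Qed.

(** Entry (1, 0) of the gauged matrix, divided by [w]. It is holomorphic because the factors - 2
    conj u from [r] and 2 conj u from the square of [al] cancel. *)
Let k z := r z * (al z * al z) * (w z)^-1.

Let ks : csmooth D k.
Proof.
apply: (csmoothM oD); last exact: csmoothV.
by apply: (csmoothM oD) => //; exact: (csmoothM oD).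
Qed.

Let kE z : D z -> k z * w z = r z * (al z * al z).
Proof. by move=> Dz; rewrite /k divfK ?w0. Qed.

Let k_zb z : D z -> Dw 'i%C k z = 0.
Proof.
move=> Dz; have al2 := csmoothM oD als als.
have := Dw_congr oD 'i%C Dz kE.
rewrite (DwM _ ks ws Dz) w_zb// mulr0 addr0 (DwM _ rs al2 Dz) (DwM _ als als Dz) r_zb// al_zb// => h.
apply: (mulIf (w0 Dz)); rewrite h mul0r; move: (Num.conj _) => x; ring.
Qed.

(** By [curl_u] the curvature equation becomes |r|^2 = |p|^2 + |s|^2. Here |p| = 3 |q| |s| and |w| =
    |q| |s|, and division by |w|^2 leaves 9 + 1/|q|^2. *)
Let k_norm z : D z -> k z * Num.conj (k z) = 9 + ci * ci.
Proof.
move=> Dz; have wn0 : w z * Num.conj (w z) != 0 by rewrite mulf_neq0 ?conjC_eq0 ?w0.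
have h := u_zb Dz; rewrite curl_u// in h.
have rr : r z * Num.conj (r z) = p z * Num.conj (p z) + s z * Num.conj (s z).
  by apply/eqP; rewrite -subr_eq0 opprD addrA -h.
apply: (mulIf wn0).
have -> : k z * Num.conj (k z) * (w z * Num.conj (w z)) = (k z * w z) * Num.conj (k z * w z).
  by rewrite conj_mul; move: (Num.conj (k z)) (Num.conj (w z)) (k z) => x y t; ring.
have pp : p z * Num.conj (p z) = 9 * (s z * Num.conj (s z)) * (q z * Num.conj (q z)).
  rewrite pE// (conj_mul (3 * s z)) (conj_mul 3) conjCK (rmorph_nat Num.conj).
  by move: (q z) (Num.conj (q z)) (s z) (Num.conj (s z)) => a b x y; ring.
have ww : w z * Num.conj (w z) = q z * Num.conj (q z) * (s z * Num.conj (s z)).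
  rewrite -(qE Dz) (conj_mul (q z)).
  by move: (q z) (Num.conj (q z)) (s z) (Num.conj (s z)) => a b x y; ring.
rewrite ww kE// (conj_mul (r z)) (conj_mul (al z) (al z)).
transitivity (r z * Num.conj (r z) * ((al z * Num.conj (al z)) * (al z * Num.conj (al z)))).
  by move: (al z) (Num.conj (al z)) (r z) (Num.conj (r z)) => a b x y; ring.
rewrite al1// !mulr1 rr pp.
have := qci Dz; move: (q z * Num.conj (q z)) (s z * Num.conj (s z)) ci => x y t xt.
transitivity (9 * y * x + x * (t * t) * y); last by ring.
by rewrite xt mul1r.
Qed.

Let cc_real : 9 + ci * ci != 0.
Proof.
have -> : 9 + ci * ci = (9 + c^-1 * c^-1)%:C by rewrite rmorphD rmorphM rmorph_nat.
rewrite (inj_eq (@complexI R) _ 0) gt_eqF// addr_gt0// mulr_gt0 ?invr_gt0//.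
Qed.

(** A holomorphic function of constant non-zero modulus is constant: the z-derivative of k conj k is
    k_z conj k. *)
Let k_const z : D z -> k z = k z0.
Proof.
move=> Dz; have kJs := csmoothJ oD ks.
apply: (Dw_eq0_constant oD cD ks _ k_zb Dz0 Dz) => y Dy.
have := Dw_congr oD (- 'i%C) Dy k_norm.
rewrite Dw_cst (DwM _ ks kJs Dy) (DwJ _ ks Dy) conjNI k_zb// rmorph0 mulr0 addr0 => /eqP.
rewrite mulf_eq0 => /orP[/eqP//|kJ0].
by have := k_norm Dy; rewrite (eqP kJ0) mulr0 => h; move: cc_real; rewrite -h eqxx.
Qed.

Let Ut : 'M[C]_3 := mk 1 3 ci (k z0) 1 0 0 ci (- 2).

(** The diagonal entries of the two products are compared through |k|^2 = 9 + [ci]^2, which is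
    [k_norm]. *)
Let Ut_normal : Ut \is normalmx.
Proof.
apply/normalmxP; rewrite /Ut mk_adj !mk_mul !rmorph0 !rmorph1 rmorphN !rmorph_nat ciJ !simp0.
have kk := k_norm Dz0; have kk' : Num.conj (k z0) * k z0 = 9 + ci * ci by rewrite mulrC.
by rewrite kk kk'; congr mk; ring.
Qed.

Let W : 'M[C]_3 := spectralmx Ut.
Let Wu : W \is unitarymx. Proof. exact: spectral_unitarymx. Qed.

Let l0 : C := spectral_diag Ut 0 o0.
Let l1 : C := spectral_diag Ut 0 o1.
Let l2 : C := spectral_diag Ut 0 o2.
Let Lam : 'M[C]_3 := mk l0 0 0 0 l1 0 0 0 l2.

Let UtE : Ut = W^t* *m Lam *m W.
Proof.
have /orthomx_spectralP := Ut_normal; rewrite -/W (unitary_inv Wu) => {1}->.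
by rewrite mk_diag.
Qed.

Let UtW : Ut *m W^t* = W^t* *m Lam.
Proof. 
transitivity (W^t* *m Lam *m W *m W^t*); first by congr (_ *m _); exact: UtE.
by rewrite -mulmxA (unitary_mulJ Wu) mulmx1. Qed.

Let WUt : W *m Ut = Lam *m W.
Proof.
transitivity (W *m (W^t* *m Lam *m W)); first by congr (_ *m _); exact: UtE.
by rewrite !mulmxA (unitary_mulJ Wu) mul1mx.
Qed.

Let A0 z : 'M[C]_3 := mk (al z) 0 0 0 (Num.conj (al z)) 0 0 0 1.

Let A0s : msmooth D A0.
Proof.
by apply: (msmooth_mk oD); try exact: csmooth_cst; [exact: als|exact: (csmoothJ oD als)].
Qed.

Let A0u z : D z -> A0 z \is unitarymx.
Proof.
move=> Dz; apply/unitarymxP; rewrite /A0 mk_adj mk_mul !rmorph0 rmorph1 conjCK !simp0.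
by rewrite (mulrC (Num.conj _)) al1// mk_scalar.
Qed.

(** The gauged frame followed by the constant change to an eigenbasis of [Ut]; in it the derivative
    is diagonal. *)
Let G z := F z *m A0 z *m W^t*.

Let Fu z : D z -> F z \is unitarymx. Proof. by case/FSU. Qed.

Let Gu z : D z -> G z \is unitarymx.
Proof.
move=> Dz; apply/unitarymxP; rewrite /G !adjM adjK !mulmxA -(mulmxA _ (W^t*)) unitary_Jmul// mulmx1.
by rewrite -(mulmxA _ (A0 z)) unitary_mulJ ?A0u// mulmx1 unitary_mulJ ?Fu.
Qed.

Let Gs : msmooth D G.
Proof. by apply: (msmoothM oD); [exact: (msmoothM oD)|exact: msmooth_cst]. Qed.

Let UA0 z : D z -> U z *m A0 z + Mw (- 'i%C) A0 z = w z *: (A0 z *m Ut).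
Proof.
move=> Dz; have aJ : Dw (- 'i%C) (fun y => Num.conj (al y)) z = u z * Num.conj (al z).
  by rewrite (DwJ _ als Dz) conjNI al_zb// conj_mul conjCK.
rewrite /A0 Mw_mk !Dw_cst aJ al_z// /U /Ut !mkS !simp0 -(k_const Dz) alJ.
have e1 : w z * (al z * ci) = s z.
  transitivity (q z * Num.conj (q z) * (ci * ci) * s z); last by rewrite qci// mul1r.
  by rewrite -(qE Dz) /al; ring.
have e2 : w z * (q z * ci * k z) = r z * al z.
  transitivity (k z * w z * (q z * ci)); first by ring.
  rewrite kE// -alJ; transitivity (r z * al z * (al z * Num.conj (al z))); first by ring.
  by rewrite al1// mulr1.
rewrite e1 e2; congr mk; try ring.
  by rewrite pE// -(qE Dz) /al; ring.
by rewrite -(qE Dz); ring.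
Qed.

Let G_z z : D z -> Mw (- 'i%C) G z = G z *m mk (w z * l0) 0 0 0 (w z * l1) 0 0 0 (w z * l2).
Proof.
move=> Dz; have FA := msmoothM oD Fs A0s.
rewrite (MwM oD _ FA (msmooth_cst D _) Dz) Mw_cst mulmx0 addr0 (MwM oD _ Fs A0s Dz) Fz//.
rewrite (_ : mk (w z * l0) _ _ _ _ _ _ _ _ = w z *: Lam); last by rewrite /Lam mk_scale !simp0.
exact: (frame_change _ (UA0 Dz) UtW).
Qed.

Let detG z : D z -> \det (G z) = \det (W^t*).
Proof.
move=> Dz; have [_ dF] := FSU Dz.
by rewrite /G !det_mulmx dF mul1r /A0 mk_det_diag mulr1 al1// mul1r.
Qed.

(** The coordinates in the frame [G] of the last column of [F]. They are constant because the gauge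
    [A0] fixes the third basis vector. *)
Let v : 'cV[C]_3 := W *m cv 0 0 1.

Let surfE z : D z -> surf F z = G z *m (v *m v^t*) *m (G z)^t*.
Proof.
move=> Dz; have vv : v *m v^t* = W *m E3 R *m W^t*.
  by rewrite -[LHS]/(hopf v) hopf_mul cv_outer rmorph1 mulr1 scale1r.
have AE : A0 z *m E3 R *m (A0 z)^t* = E3 R.
  by rewrite /A0 /E3 mk_adj !mk_mul !rmorph0 rmorph1 !simp0.
by rewrite vv; exact: (outer_reframe _ Wu AE).
Qed.

Let v_neq0 : [/\ v o0 0 != 0, v o1 0 != 0 & v o2 0 != 0].
Proof.
have ci0 : ci != 0 by rewrite (inj_eq (@complexI R) _ 0) invr_eq0 gt_eqF.
have k0 : k z0 != 0.
  by apply/eqP => h; have := k_norm Dz0; rewrite h mul0r => e; move: cc_real; rewrite -e eqxx.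
have row j : v j 0 != 0.
  rewrite /v mxE sum3 !cvE !simp0.
  exact: (last_column_neq0 Wu k0 ci0 WUt).
by split; exact: row.
Qed.

Let G_diag z : D z -> exists a b d : C,
  [/\ nm a = 1, nm b = 1, nm d = 1, a * b * d = 1 & G z = G z0 *m mk a 0 0 0 b 0 0 0 d].
Proof.
move=> Dz; apply: unitary_diagonal_transition; [exact: Gu|exact: Gu|by rewrite !detG|].
by move=> a b d; exact: (diagonal_frame_constant oD a b d cD Gs Gu G_z Dz0 Dz).
Qed.

Lemma surf_flat_homogeneous : flat_homogeneous D (surf F).
Proof.
split.
  move=> z Dz; rewrite /gauss_curvature.
  (* Both entries [a] and [b] of the frame equal [s] here, so half the sum of their squares is |s|^2
     = |w|^2 / c^2. *)
  have om y : D y -> omega (surf F) y = ln ((c^-1 * c^-1) * n2 (w y)).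
    move=> Dy; rewrite (surf_omega oD Fs Fu Fz Fzb) //; [|by move=> *; rewrite mkE..].
    rewrite !mkE -mulr2n -(mulr_natr (n2 _) 2) mulfK ?pnatr_eq0//; congr ln.
    have nq : nm (q y) = c.
      have := q_norm Dz0 Dy; rewrite !n2E => /complexI; rewrite !n2_nm => /eqP.
      by rewrite eqrXn2 ?nm_ge0// => /eqP.
    rewrite -(qE Dy) !n2_nm nmM nq; have cn0 : c != 0 by rewrite gt_eqF.
    by field.
  have -> : dx (dx (omega (surf F))) z + dy (dy (omega (surf F))) z = 0.
    apply: (log_modulus_harmonic oD ws w0 w_zb _ om Dz).
    by rewrite mulr_gt0 ?invr_gt0.
  by rewrite oppr0 mul0r.
have [v0 v1 v2] := v_neq0.
exists (torus_group (G z0)), (torus_algebra (G z0)), (G z0 *m (v *m v^t*) *m (G z0)^t*); split.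
- by apply: torus_lie_subgroup; exact: Gu.
- by have <- := surfE Dz0; exact: (surf_CP2 Fu Dz0).
- exact: (torus_two_dim_orbit (Gu Dz0) v0 v1 v2).
move=> _ [z Dz <-]; have [a [b [d [a1 b1 d1 abd Gz]]]] := G_diag Dz.
exists (dgl (G z0) a b d); first by exists a, b, d.
rewrite (surfE Dz) Gz; exact: (conj_orbit _ _ (Gu Dz0)).
Qed.

End FlatCase.

(** * The dichotomy for the involution *)

Section OrderTwoCases.
Variable R : realType.
Local Notation C := R[i].
Variable D : set C.
Hypothesis oD : open D.

Lemma order_two_cases (w p s u d : C -> C) z0 : connected D -> D z0 ->
  csmooth D s -> csmooth D d ->
  (forall z, D z -> s z + d z != 0) ->
  (forall z, D z -> [/\ Dw 'i%C w z = - (s z * Num.conj (d z)), w z * d z = 0 &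
     Dw 'i%C s z = p z * Num.conj (d z) + Num.conj (u z) * s z]) ->
  (forall z, D z -> d z = 0) \/ (forall z, D z -> s z = 0 /\ p z = 0).
Proof.
move=> cD Dz0 ss ds ne eqs.
have oD' : open [set t | D t /\ d t != 0].
  by rewrite openE => t [Dt dt]; exact: (csmooth_near_neq0 oD ds Dt dt).
(* Where [d] is non-zero, w d = 0 forces [w] to vanish on an open set; its zbar-derivative, which is
   - s conj d, then vanishes too. *)
have sd z : D z -> s z * Num.conj (d z) = 0.
  move=> Dz; have [dz|dz] := eqVneq (d z) 0; first by rewrite dz rmorph0 mulr0.
  have [wz _ _] := eqs z Dz; apply: oppr_inj; rewrite oppr0 -wz.
  rewrite (@Dw_congr _ _ oD' 'i%C w (fun=> 0) z (conj Dz dz)) ?Dw_cst// => t [Dt dt].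
  by have [_ /eqP wd _] := eqs t Dt; move: wd; rewrite mulf_eq0 (negPf dt) orbF => /eqP.
(* As s + d has no zero, exactly one of [s] and [d] vanishes at each point. The sets where [s] or
   [d] is non-zero are open, so vanishing of [d] is locally constant. *)
have loc z : D z -> exists2 A, nbhs z A & forall t, A t -> D t -> (d t = 0 <-> d z = 0).
  move=> Dz; have [dz|dz] := eqVneq (d z) 0.
    have sz : s z != 0 by have := ne z Dz; rewrite dz addr0.
    exists [set t | D t /\ s t != 0]; first exact: (csmooth_near_neq0 oD ss Dz sz).
    move=> t [Dt st] _; split=> // _; have /eqP := sd t Dt.
    by rewrite mulf_eq0 (negPf st) /= conjC_eq0 => /eqP.
  exists [set t | D t /\ d t != 0]; first exact: (csmooth_near_neq0 oD ds Dz dz).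
  by move=> t [Dt dt] _; split=> e; move: dt dz; rewrite e eqxx.
have [d0|/eqP d0] := eqVneq (d z0) 0.
  left => z Dz; exact: (@connected_local R D (fun z => d z = 0) oD cD loc z0 Dz0 d0 z Dz).
right => z Dz.
have dn0 t : D t -> d t <> 0.
  move=> Dt; apply: (@connected_local R D (fun z => d z <> 0) oD cD _ z0 Dz0 d0 t Dt) => x Dx.
  by have [A zA hA] := loc x Dx; exists A => // y Ay Dy; have := hA y Ay Dy; tauto.
have s0 t : D t -> s t = 0.
  move=> Dt; have /eqP := sd t Dt; rewrite mulf_eq0 conjC_eq0 => /orP[/eqP//|/eqP dt].
  by case: (dn0 t Dt dt).
split; first exact: s0.
(* With [s] identically zero, the equation for its derivative reduces to p conj d = 0. *)
have [_ _] := eqs z Dz; rewrite (Dw_congr oD 'i%C Dz s0) Dw_cst s0// mulr0 addr0 => /esym/eqP.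
by rewrite mulf_eq0 conjC_eq0 => /orP[/eqP//|/eqP dt]; case: (dn0 z Dz dt).
Qed.

End OrderTwoCases.

Unset Implicit Arguments.

(** * The three types of primitive harmonic frames *)

Theorem theorem2p6 (R : realType) (D : set R[i])
    (fhat : R[i] -> 'cV[R[i]]_3) (Fhat : R[i] -> 'M[R[i]]_3)
    (Uhat Vhat : R[i] -> 'M[R[i]]_3)
    (u11 u12 u13 u21 u32 w : R[i] -> R[i])
    (hD : contractible_domain D)
    (hf : msmooth D fhat) (hfS : forall z, D z -> S5 (fhat z))
    (hF : msmooth D Fhat) (hFS : forall z, D z -> SU3 (Fhat z))
    (hFe3 : forall z, D z -> Fhat z *m delta_mx ord_max 0 = fhat z)
    (hMC : forall z, D z ->
       invmx (Fhat z) *m mdz Fhat z = Uhat z /\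
       invmx (Fhat z) *m mdzbar Fhat z = Vhat z)
    (hU : forall z, D z ->
       Uhat z = mx3 [:: [:: u11 z + w z; u12 z; u13 z];
                        [:: u21 z; - u11 z + w z; 0];
                        [:: 0; u32 z; - 2 * w z]])
    (hV : forall z, D z -> Vhat z = - (Uhat z) ^t*)
    (hne : forall z, D z -> u13 z != 0 /\ u32 z != 0) :
  [/\ primitive_harmonic D (@sigma R) 6 Fhat ->
        exists f, [/\ minimal D f, lagrangian D f & can_be_derived_from D Fhat f],
      primitive_harmonic D (iter 2 (@sigma R)) 3 Fhat ->
        exists f, [/\ minimal D f, without_complex_points D f
                    & can_be_derived_from D Fhat f] &
      primitive_harmonic D (iter 3 (@sigma R)) 2 Fhat ->
        exists f, ((minimal D f /\ lagrangian D f) \/ flat_homogeneous D f) /\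
                  can_be_derived_from D Fhat f].
Proof.
have [oD cD ctr] := hD; have [z0 [_ [Dz0 _ _ _]]] := ctr.
have Fu z : D z -> Fhat z \is unitarymx by case/hFS.
have Fi z : D z -> Fhat z \in unitmx by move=> Dz; exact: (unitarymx_unit (Fu z Dz)).
have Fz z : D z -> Mw (- 'i%C) Fhat z = Fhat z *m Uhat z.
  by move=> Dz; have [<- _] := hMC z Dz; rewrite mulKVmx ?Fi// mdzE.
have Vz z : D z -> invmx (Fhat z) *m mdzbar Fhat z = - (Uhat z)^t*.
  by move=> Dz; have [_ ->] := hMC z Dz; exact: hV.
have Fzb z : D z -> Mw 'i%C Fhat z = - (Fhat z *m (Uhat z)^t*).
  by move=> Dz; rewrite -mulmxN -(Vz z Dz) mulKVmx ?Fi// mdzbarE.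
have U12 z : D z -> Uhat z o1 o2 = 0 by move=> Dz; rewrite hU// mxE.
have U20 z : D z -> Uhat z o2 o0 = 0 by move=> Dz; rewrite hU// mxE.
have ab0 z : D z -> Uhat z o0 o2 != 0 /\ Uhat z o2 o1 != 0.
  by move=> Dz; have [h1 h2] := hne z Dz; rewrite hU// !mxE.
have [nocp derived] := surf_derived oD hF Fu Fz Fzb U12 U20 ab0 ctr.
have min01 := surf_minimal oD hF Fu Fz Fzb U12 U20.
have lagr := surf_lagrangian oD hF Fu Fz Fzb U12 U20.
split.
- move=> [Am [A0 [A0' [A1 [_ eig FA _]]]]]; exists (surf Fhat).
  have UA z : D z -> Uhat z = Am z + A0 z.
    by move=> Dz; have [<- _] := FA z Dz; have [-> _] := hMC z Dz.
  split; [apply: min01|apply: lagr|exact: derived] => z Dz.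
    have [/eigen6_m1[m01 _] /eigen6_0[z01 _ _] _ _] := eig z Dz.
    by rewrite (UA z Dz) mxE m01 z01 addr0.
  have [/eigen6_m1[_ m02] /eigen6_0[_ z02 z21] _ _] := eig z Dz.
  by rewrite (UA z Dz) !mxE m02 z02 z21.
- move=> [Am [A0 [A0' [A1 [_ eig FA _]]]]]; exists (surf Fhat).
  split; [apply: min01|exact: nocp|exact: derived] => z Dz.
  have UA : Uhat z = Am z + A0 z by have [<- _] := FA z Dz; have [-> _] := hMC z Dz.
  have [/eigen3_m1 m01 /eigen3_0 z01 _ _] := eig z Dz.
  by rewrite UA mxE m01 z01 addr0.
have Uz z : D z -> invmx (Fhat z) *m mdz Fhat z = Uhat z by move=> Dz; have [] := hMC z Dz.
move=> /(order_two_structure oD Uz Vz U12 U20).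
move=> [q [p [s [r [u [d [[qs ps ss] [rs us ds] UE eqs d0eqs]]]]]]].
exists (surf Fhat); split; last exact: derived.
have sd0 z : D z -> s z + d z != 0.
  by move=> Dz; have [+ _] := ab0 z Dz; rewrite UE// mkE.
have eqs1 z : D z -> [/\ Dw 'i%C q z = - (s z * Num.conj (d z)), q z * d z = 0 &
    Dw 'i%C s z = p z * Num.conj (d z) + Num.conj (u z) * s z].
  by move=> Dz; have [] := eqs z Dz.
have [d0|sp0] := order_two_cases oD cD Dz0 ss ds sd0 eqs1; last first.
  left; split; [apply: min01|apply: lagr] => z Dz; have [s0 p0] := sp0 z Dz.
    by rewrite UE// mkE.
  by rewrite UE// !mkE s0 sub0r add0r !n2_nm nmN.
pose W z : 'M[R[i]]_3 := mk (u z + q z) (p z) (s z) (r z) (- u z + q z) 0 0 (s z) (- 2 * q z).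
have UW z : D z -> Uhat z = W z by move=> Dz; rewrite UE// d0// addr0 subr0.
have Wz z : D z -> Mw (- 'i%C) Fhat z = Fhat z *m W z by move=> Dz; rewrite -UW//; exact: Fz.
have Wzb z : D z -> Mw 'i%C Fhat z = - (Fhat z *m (W z)^t*).
  by move=> Dz; rewrite -UW//; exact: Fzb.
have s0 z : D z -> s z != 0 by move=> Dz; have := sd0 z Dz; rewrite d0// addr0.
have q_zb z : D z -> Dw 'i%C q z = 0.
  by move=> Dz; have [-> _ _] := eqs1 z Dz; rewrite d0// rmorph0 mulr0 oppr0.
have s_zb z : D z -> Dw 'i%C s z = Num.conj (u z) * s z.
  by move=> Dz; have [_ _ ->] := eqs1 z Dz; rewrite d0// rmorph0 mulr0 add0r.
have p_zb z : D z -> Dw 'i%C p z = 2 * Num.conj (u z) * p z.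
  by move=> Dz; have [_ []] := eqs z Dz.
have r_zb z : D z -> Dw 'i%C r z = - 2 * Num.conj (u z) * r z.
  by move=> Dz; have [_ []] := eqs z Dz.
have ps_eq z : D z -> p z * Num.conj (s z) = 3 * s z * Num.conj (q z).
  by move=> Dz; have [] := d0eqs d0 z Dz.
have u_zb z : D z -> Dw 'i%C u z + Num.conj (Dw 'i%C u z) =
    r z * Num.conj (r z) - p z * Num.conj (p z) - s z * Num.conj (s z).
  by move=> Dz; have [] := d0eqs d0 z Dz.
have [p0|q0] := minimal_or_nonvanishing oD cD qs ss s0 q_zb s_zb p_zb ps_eq.
  left; split; [apply: min01|apply: lagr] => z Dz; rewrite UW// /W !mkE//.
  exact: p0.
right; exact: (surf_flat_homogeneous oD cD hF hFS Wz Wzb qs ss rs us s0 q_zb s_zb p_zb r_zb ps_eq u_zb q0 Dz0).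
Qed.
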